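(* Let $\rho(L)$ be the spectral weight of $L$. (i) $\rho(L)$ belongs to the dual Macaev ideal $\mathcal{L}^{(1,\infty)}(h)$ and $$\frac1c\le \mathrm{Tr}_\omega(\rho(L))\le 1\qquad\text{for all Dixmier ultrafilters }\omega,$$ where $$c:=\limsup_{x\to+\infty}\frac{N_L(x)}{N_L^-(x)}=\limsup_{k\to\infty}\frac{M_k}{M_{k-1}}$$ (with $1/c=0$ if $c=+\infty$). (ii) $\rho(L)^s$ is trace class for all $s>1$ and $\limsup_{s\downarrow1}(s-1)\mathrm{Tr}(\rho(L)^s)\le 1$. (iii) If $\limsup_{x\to+\infty}\frac{N_L(x)}{N_L^-(x)}=\lim_{k\to\infty}\frac{M_k}{M_{k-1}}=1$, then: (iii.a) $\mu_n(\rho(L))\sim 1/n$ as $n\to\infty$; (iii.b) $\mathrm{Tr}_\omega(\rho(L))=1$ for all Dixmier ultrafilters $\omega$, and $\rho(L)$ is measurable; (iii.c) $\lim_{s\downarrow1}(s-1)\mathrm{Tr}(\rho(L)^s)=1$.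
   Context: Let $h$ be a Hilbert space and $(L,D(L))$ a densely defined, nonnegative, unbounded self-adjoint operator on $h$ with spectral measure $E^L$, having discrete spectrum off its kernel: $sp(L)\setminus\{0\}$ is discrete in the sense that $L^{-1}$ (defined as $0$ on $\ker L$ and as the inverse of $L$ on $(\ker L)^\perp$) is compact. Convention: for measurable $f:\mathbb{R}_+\to\mathbb{R}_+$, the operator $f(L)$ is $0$ on $\ker L$ and given by the usual functional calculus on $(\ker L)^\perp$. Write $0<\widetilde\lambda_1<\widetilde\lambda_2<\cdots$ for the distinct nonzero eigenvalues of $L$ (tending to $+\infty$), $m_k=\mathrm{Tr}(E^L(\{\widetilde\lambda_k\}))$ for the multiplicities, $M_k=\sum_{j=1}^k m_j$, $M_0=0$. The eigenvalue counting function is $N_L(x)=\mathrm{Tr}(E^L((0,x]))$, and $N_L^-(x)=\lim_{\delta\downarrow0}N_L(x-\delta)$. The spectral weight of $L$ is $\rho(L):=N_L(L)^{-1}$, i.e. the operator that is $0$ on $\ker L$ and $1/M_k$ on the eigenspace of $\widetilde\lambda_k$. For compact $T$, $\mu_n(T)$, $n\ge1$, are the singular values of $T$ in decreasing order with multiplicity. The dual Macaev ideal is $\mathcal{L}^{(1,\infty)}(h)=\{T \text{ compact}:\sup_{N\ge2}\frac{1}{\log N}\sum_{n=1}^N\mu_n(T)<+\infty\}$. A Dixmier ultrafilter is given by a state $\omega$ on $L^\infty(\mathbb{R}_+^* )$ (write $\omega\text{-}\lim_{t\to+\infty}f(t)=\omega(f)$) such that for all $f$ and $s>0$: $\mathrm{ess}\liminf_{t\to+\infty}f\le\omega(f)\le\mathrm{ess}\limsup_{t\to+\infty}f$;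 $\omega\text{-}\lim f(st)=\omega\text{-}\lim f(t)$; $\omega\text{-}\lim f(t^s)=\omega\text{-}\lim f(t)$; $\omega\text{-}\lim\frac1{\log t}\int_1^tf(u)\frac{du}{u}=\omega\text{-}\lim f(t)$. On $\ell^\infty(\mathbb{N})$ put $\omega\text{-}\lim_{n\to\infty}f(n):=\omega\text{-}\lim_{t\to+\infty}f([t])$, $[t]$ the integer part. The Dixmier trace is $\mathrm{Tr}_\omega(T)=\omega\text{-}\lim_{N\to\infty}\frac1{\log N}\sum_{n=1}^N\mu_n(T)$ for $0\le T\in\mathcal{L}^{(1,\infty)}(h)$, extended linearly. $T$ is measurable if $\mathrm{Tr}_\omega(T)$ does not depend on $\omega$. *)

(* Defs.v *)
From HB Require Import structures.
From mathcomp Require Import all_boot all_order all_algebra.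
From mathcomp Require Export complex.
From mathcomp Require Import all_classical all_reals all_analysis.
From mathcomp Require Import ess_sup_inf.
Import Order.TTheory GRing.Theory Num.Theory.
Import numFieldNormedType.Exports.

Set Implicit Arguments.
Unset Strict Implicit.
Unset Printing Implicit Defensive.

Local Open Scope classical_set_scope.
Local Open Scope ring_scope.
Local Open Scope complex_scope.

(** * Complex Hilbert spaces *)

(* {dot H for conjc}: positive definite, linear in the first argument and
   antilinear in the second one. *)
HB.mixin Record isHilbert (R : realType) H & CompleteNormedModule R[i] H := {
  inner : {dot H for (@conjc R)};
  inner_norm : forall x : H, inner x x = `|x| ^+ 2
}.

#[short(type="hilbertType")]
HB.structure Definition Hilbert (R : realType) :=
  {H of CompleteNormedModule R[i] H & isHilbert R H}.

Notation "''[' x , y ]" := (inner x y) : ring_scope.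

Section operators.
Context (R : realType) (H : hilbertType R).
Implicit Types (x y z : H) (T : H -> H).

(* The norm of the library has values in R[i]. *)
Definition hnorm x : R := complex.Re `|x|.

(* A partially defined operator; the values of [op_fun] outside [op_dom] are
   irrelevant. *)
Record operator := Operator { op_dom : set H ; op_fun :> H -> H }.

Definition total_op T : operator := Operator setT T.

Definition linear_op (A : operator) : Prop :=
  op_dom A 0 /\
  forall (a : R[i]) x y, op_dom A x -> op_dom A y ->
    op_dom A (a *: x + y) /\ A (a *: x + y) = a *: A x + A y.

(* The graph of the adjoint: y is in the domain of A^* and A^* y = z. *)
Definition adjoint_graph (A : operator) y z : Prop :=
  forall x, op_dom A x -> '[A x, y] = '[x, z].

Definition selfadjoint (A : operator) : Prop :=
  [/\ linear_op A, dense (op_dom A) &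
      forall y z, adjoint_graph A y z <-> op_dom A y /\ z = A y].

Definition nonnegative_op (A : operator) : Prop :=
  forall x, op_dom A x -> 0 <= '[A x, x].

Definition unbounded (A : operator) : Prop :=
  ~ exists C : R, forall x, op_dom A x -> hnorm (A x) <= C * hnorm x.

Definition ker_op (A : operator) : set H := [set x | op_dom A x /\ A x = 0].

Definition eigenvalue_op (A : operator) (a : R) : Prop :=
  exists x, [/\ op_dom A x, x != 0 & A x = a%:C *: x].

Definition orthogonal_set (V : set H) : set H :=
  [set x | forall y, V y -> '[x, y] = 0].

Definition compact_op T : Prop :=
  linear T /\ precompact (T @` [set x | `|x| <= 1]).

Definition inverse_off_kernel (A : operator) (K : H -> H) : Prop :=
  [/\ linear K,
      forall x, ker_op A x -> K x = 0 &
      forall x, orthogonal_set (ker_op A) x ->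
        [/\ op_dom A (K x), orthogonal_set (ker_op A) (K x) & A (K x) = x]].

(** * Dimension and trace *)

Definition hdim (V : set H) : \bar R :=
  ereal_sup [set n%:R%:E | n in [set n : nat | exists v : 'I_n -> H,
    forall i j, V (v i) /\ '[v i, v j] = (i == j)%:R]].

Definition orthonormal_basis (B : set H) : Prop :=
  (forall e f, B e -> B f -> '[e, f] = (e == f)%:R) /\
  orthogonal_set B = [set 0].

Definition hilbert_basis : set H := get orthonormal_basis.

(* The trace of a nonnegative operator; its value does not depend on the chosen
   orthonormal basis. *)
Definition trace T : \bar R :=
  (\esum_(e in hilbert_basis) (complex.Re '[T e, e])%:E)%E.

(** * Singular values and operator ideals *)

(* The dimension of the kernel of T^* T - s^2. *)
Definition singular_multiplicity T (s : R) : \bar R :=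
  hdim [set x | adjoint_graph (total_op T) (T x) ((s ^+ 2)%:C *: x)].

(* The n-th (n >= 1) singular value, in decreasing order and with
   multiplicity: the least s >= 0 such that fewer than n singular values,
   counted with multiplicity, are larger than s. *)
Definition singular_value T (n : nat) : R :=
  inf [set s : R | 0 <= s /\
    (\esum_(u in [set u : R | (s < u)%R]) singular_multiplicity T u < n%:R%:E)%E].

Definition singular_log_mean T (N : nat) : R :=
  (ln N%:R)^-1 * \sum_(1 <= n < N.+1) singular_value T n.

Definition dual_macaev T : Prop :=
  compact_op T /\
  (ereal_sup [set (singular_log_mean T N)%:E | N in [set N | (2 <= N)%N]]
     < +oo)%E.

Definition trace_class T : Prop :=
  compact_op T /\ (\sum_(1 <= n <oo) (singular_value T n)%:E < +oo)%E.

(** * Spectral measures and functional calculus *)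

Record spectral_measure := SpectralMeasure {
  smeas_fun :> set (measurableTypeR R) -> H -> H ;
  smeas_linear : forall A, measurable A -> linear (smeas_fun A) ;
  smeas_idem : forall A x, measurable A ->
    smeas_fun A (smeas_fun A x) = smeas_fun A x ;
  smeas_sym : forall A x y, measurable A ->
    '[smeas_fun A x, y] = '[x, smeas_fun A y] ;
  smeas_set0 : forall x, smeas_fun set0 x = 0 ;
  smeas_setT : forall x, smeas_fun setT x = x ;
  smeas_setI : forall A B x, measurable A -> measurable B ->
    smeas_fun (A `&` B) x = smeas_fun A (smeas_fun B x) ;
  smeas_sigma_additive : forall x,
    semi_sigma_additive (fun A => (hnorm (smeas_fun A x) ^+ 2)%:E) }.

(* As E(A) is an orthogonal projection, |E(A)x|^2 = <E(A)x, x>. *)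
Definition smeas_at (E : spectral_measure) x
    (A : set (measurableTypeR R)) : \bar R :=
  (hnorm (E A x) ^+ 2)%:E.

Section smeas_at_measure.
Context (E : spectral_measure) (x : H).

Let smeas_at0 : smeas_at E x set0 = 0%E.
Proof. by rewrite /smeas_at smeas_set0 /hnorm normr0 expr0n. Qed.

Let smeas_at_ge0 A : (0 <= smeas_at E x A)%E.
Proof. by rewrite lee_fin sqr_ge0. Qed.

HB.instance Definition _ := isMeasure.Build _ _ _ (smeas_at E x)
  smeas_at0 smeas_at_ge0 (@smeas_sigma_additive E x).

End smeas_at_measure.

(* A is the integral of f against E. The operator is determined by its
   quadratic form, by polarization. *)
Definition spectral_integral (E : spectral_measure) (f : R -> R)
    (A : operator) : Prop :=
  [/\ linear_op A,
      op_dom A =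
        [set x | (\int[smeas_at E x]_t (f t ^+ 2)%:E < +oo)%E] &
      forall x, op_dom A x ->
        '[A x, x] = (\int[smeas_at E x]_t f t)%:C].

Definition spectral_measure_of (A : operator) (E : spectral_measure) : Prop :=
  spectral_integral E id A.

(* The everywhere defined operator f(A), for A nonnegative with spectral
   measure E, and f(A) = 0 on the kernel of A. *)
Definition fun_calculus (E : spectral_measure) (f : R -> R) : H -> H :=
  get [set T | spectral_integral E (patch (fun=> 0) `]0, +oo[ f) (total_op T)].

Definition op_power T (s : R) : H -> H :=
  get [set P | exists2 E, spectral_measure_of (total_op T) E &
    spectral_integral E (patch (fun=> 0) `]0, +oo[ (fun t => t `^ s)) (total_op P)].

(** * Counting function and spectral weight *)

Definition eig_counting (E : spectral_measure) (x : R) : R :=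
  fine (trace (E `]0, x]%classic)).

Definition eig_counting_left (E : spectral_measure) (x : R) : R :=
  lim (eig_counting E (x - d) @[d --> 0^'+]).

Definition spectral_weight (E : spectral_measure) : H -> H :=
  fun_calculus E (fun t : R => (eig_counting E t)^-1).

(* [lam k] stands for the (k+1)-st nonzero eigenvalue, so that
   [cumul_mult E lam k] is the sum of the first k multiplicities. *)
Definition cumul_mult (E : spectral_measure) (lam : nat -> R) (k : nat) : R :=
  \sum_(j < k) fine (trace (E [set lam j])).

End operators.

(** * Dixmier traces *)

Section dixmier.
Context (R : realType).
Implicit Types (f g : R -> R).

(* The Lebesgue measure of ]a, +oo[, as a measure on the line. *)
Definition lebesgue_above (a : R) : {measure set (measurableTypeR R) -> \bar R} :=
  mrestr lebesgue_measure (measurable_itv `]a, +oo[).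

Definition ess_limsup_pinfty f : \bar R :=
  ereal_inf [set ess_sup (lebesgue_above a) (EFin \o f) | a in [set a | 0 < a]].

Definition ess_liminf_pinfty f : \bar R :=
  ereal_sup [set ess_inf (lebesgue_above a) (EFin \o f) | a in [set a | 0 < a]].

(* Only the values at t > 1 matter for the behaviour at infinity. *)
Definition log_mean f (t : R) : R :=
  (ln t)^-1 * \int[lebesgue_measure]_(u in `[1, t]) (f u / u).

(* Real-valued functions suffice: a state on the complex space is the complex
   linear extension of its restriction to them. *)
Record dixmier_state (omega : (R -> R) -> R) : Prop := DixmierState {
  dixmier_linear : forall a f g,
    f \in Lfun (lebesgue_above 0) +oo%E -> g \in Lfun (lebesgue_above 0) +oo%E ->
    omega (fun t => a * f t + g t) = a * omega f + omega g ;
  dixmier_ae : forall f g,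
    f \in Lfun (lebesgue_above 0) +oo%E -> g \in Lfun (lebesgue_above 0) +oo%E ->
    (\forall t \ae lebesgue_above 0, f t = g t) -> omega f = omega g ;
  dixmier_ge0 : forall f, f \in Lfun (lebesgue_above 0) +oo%E ->
    (\forall t \ae lebesgue_above 0, 0 <= f t) -> 0 <= omega f ;
  dixmier_one : omega (fun=> 1) = 1 ;
  dixmier_bounds : forall f, f \in Lfun (lebesgue_above 0) +oo%E ->
    (ess_liminf_pinfty f <= (omega f)%:E <= ess_limsup_pinfty f)%E ;
  dixmier_dilation : forall f s, f \in Lfun (lebesgue_above 0) +oo%E ->
    0 < s -> omega (fun t => f (s * t)) = omega f ;
  dixmier_power : forall f s, f \in Lfun (lebesgue_above 0) +oo%E ->
    0 < s -> omega (fun t => f (t `^ s)) = omega f ;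
  dixmier_log_mean : forall f, f \in Lfun (lebesgue_above 0) +oo%E ->
    omega (log_mean f) = omega f }.

Definition omega_lim_seq (omega : (R -> R) -> R) (u : nat -> R) : R :=
  omega (fun t => u (Num.truncn t)).

(* For nonnegative operators of the dual Macaev ideal. *)
Definition dixmier_trace (H : hilbertType R) (omega : (R -> R) -> R)
    (T : H -> H) : R :=
  omega_lim_seq omega (singular_log_mean T).

Definition dixmier_measurable (H : hilbertType R) (T : H -> H) : Prop :=
  dual_macaev T /\
  forall omega1 omega2, dixmier_state omega1 -> dixmier_state omega2 ->
    dixmier_trace omega1 T = dixmier_trace omega2 T.

End dixmier.

(* Main.v *)
Require Import Defs.
From mathcomp Require Import all_boot all_order all_algebra.
From mathcomp Require Import all_classical all_reals all_analysis.
From mathcomp Require Import measurable_realfun ess_sup_inf ring lra.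
Import Order.TTheory GRing.Theory Num.Theory.
Import numFieldNormedType.Exports.

Local Open Scope classical_set_scope.
Local Open Scope ring_scope.

Set Implicit Arguments.
Unset Strict Implicit.
Unset Printing Implicit Defensive.

(* Since the inverse of L is compact, it is bounded below on the range of
   E ]0, C], which is therefore finite dimensional: the spectral measure E is
   atomic on ]0, +oo[, carried by the eigenvalues, which have finite
   multiplicities and tend to +oo. Hence rho(L) is diagonal, equal to 1 / M_k on
   the k-th eigenspace, and its singular values satisfy mu_n = 1 / M_k for
   M_(k-1) < n <= M_k. Thus n mu_n <= 1, and n mu_n > M_(k-1) / M_k; comparing
   the partial sums of mu_n with the harmonic sums gives the bounds on the
   Dixmier traces. The trace of rho(L)^s is the sum of
   (M_k - M_(k-1)) M_k^(-s), a lower Riemann sum of t^(-s), whence the bound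
   1 + 1 / (s - 1); when M_k / M_(k-1) tends to 1 the upper Riemann sums
   (M_k - M_(k-1)) M_(k-1)^(-s) are asymptotically the same. *)
(** * Hilbert space preliminaries *)

Section hilbert_space.
Context {R : realType} {H : hilbertType R}.
Implicit Types (x y z : H) (a : R[i]).

(** The operators [f(L)] and [rho(L)^s] are values of [get], pinned down only through a quadratic
    form, and the spectral measure behind the power is itself chosen. Nothing can be computed before
    two facts are known: an admissible operator exists, and every admissible one acts by the same
    scalars on the eigenspaces. Existence comes from summing the series of scaled projections.
    Uniqueness comes from polarization: the measures of vectors carried by disjoint sets add up, so
    the form has no cross terms, and where [f] is constant the operator is a scalar.

    The predicate [diagonal_op] records the outcome. Compactness, singular values and traces are
    established once for it and then applied to the weight and its powers; the trace formula with
    coefficients 0 and 1 also yields the counting function.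

    Finite dimension is expressed by a bound on the size of orthonormal families: this is what
    compactness delivers through separated points, and a family of maximal size is at once a basis
    of the eigenspace. *)

Lemma realcM (r s : R) : (r * s)%:C%C = r%:C%C * s%:C%C.
Proof. exact: rmorphM. Qed.

Lemma innerC x y : '[x, y] = conjc '[y, x].
Proof. by rewrite hermC expr0 mul1r. Qed.

Lemma innerDl x y z : '[x + y, z] = '[x, z] + '[y, z].
Proof. exact: linearDl. Qed.

Lemma innerDr x y z : '[x, y + z] = '[x, y] + '[x, z].
Proof. exact: linearDr. Qed.

Lemma innerZl a x y : '[a *: x, y] = a * '[x, y].
Proof. exact: linearZl_LR. Qed.

Lemma innerZr a x y : '[x, a *: y] = conjc a * '[x, y].
Proof. exact: linearZr_LR. Qed.

Lemma innerNr x y : '[x, - y] = - '[x, y].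
Proof. exact: linearNr. Qed.

Lemma innerBl x y z : '[x - y, z] = '[x, z] - '[y, z].
Proof. exact: linearBl. Qed.

Lemma innerBr x y z : '[x, y - z] = '[x, y] - '[x, z].
Proof. exact: linearBr. Qed.

Lemma inner0l x : '[0, x] = 0.
Proof. exact: linear0l. Qed.

Lemma inner0r x : '[x, 0] = 0.
Proof. exact: linear0r. Qed.

Lemma inner_suml (I : Type) (r : seq I) (F : I -> H) y :
  '[\sum_(i <- r) F i, y] = \sum_(i <- r) '[F i, y].
Proof. exact: linear_sumlz. Qed.

Lemma hnormE x : `|x| = (hnorm x)%:C%C.
Proof. by rewrite /hnorm RRe_real// normr_real. Qed.

Lemma hnorm_ge0 x : 0 <= hnorm x.
Proof. by rewrite -ler0c -hnormE. Qed.

Lemma inner_self x : '[x, x] = (hnorm x ^+ 2)%:C%C.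
Proof. by rewrite inner_norm hnormE -rmorphXn. Qed.

Lemma hnorm2 x : hnorm x ^+ 2 = complex.Re '[x, x].
Proof. by rewrite inner_self. Qed.

Lemma hnorm_eq0 x : (hnorm x == 0) = (x == 0).
Proof. by rewrite -[RHS]normr_eq0 hnormE (inj_eq (@complexI _)). Qed.

Lemma hnorm0 : hnorm (0 : H) = 0.
Proof. by apply/eqP; rewrite hnorm_eq0. Qed.

Lemma hnorm_triangle x y : hnorm (x + y) <= hnorm x + hnorm y.
Proof. by rewrite -lecR rmorphD/= -!hnormE ler_normD. Qed.

Lemma hnorm_opp x : hnorm (- x) = hnorm x.
Proof. by rewrite /hnorm normrN. Qed.

Lemma hnorm_sub x y : hnorm (x - y) = hnorm (y - x).
Proof. by rewrite -hnorm_opp opprB. Qed.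

Lemma hnorm_scale a x : hnorm (a *: x) = complex.Re `|a| * hnorm x.
Proof.
by apply: (@complexI R); rewrite realcM -!hnormE normrZ RRe_real ?normr_real.
Qed.

Lemma hnorm_scaler (r : R) x : hnorm (r%:C%C *: x) = `|r| * hnorm x.
Proof. by rewrite hnorm_scale normc_def /= expr0n addr0 sqrtr_sqr. Qed.

Lemma inner_eq0 x : '[x, x] = 0 -> x = 0.
Proof.
by rewrite inner_self => /(@complexI R)/eqP; rewrite sqrf_eq0 hnorm_eq0 => /eqP.
Qed.

Lemma inner_inj x y : (forall z, '[x, z] = '[y, z]) -> x = y.
Proof.
move=> xy; apply/eqP; rewrite -subr_eq0; apply/eqP/inner_eq0.
by rewrite innerBl xy subrr.
Qed.

Lemma hnorm2D x y : '[x, y] = 0 -> hnorm (x + y) ^+ 2 = hnorm x ^+ 2 + hnorm y ^+ 2.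
Proof.
move=> xy; have yx : '[y, x] = 0 by rewrite innerC xy conjc0.
by rewrite !hnorm2 innerDl !innerDr xy yx addr0 add0r raddfD.
Qed.

Lemma cauchy_schwarz x y : `|'[x, y]| <= (hnorm x * hnorm y)%:C%C.
Proof.
have [->|y0] := eqVneq y 0.
  by rewrite inner0r normr0 hnorm0 mulr0.
have hy : 0 < hnorm y by rewrite lt_neqAle hnorm_ge0 eq_sym hnorm_eq0 y0.
pose c := '[x, y] / (hnorm y ^+ 2)%:C%C.
have hyC : (hnorm y ^+ 2)%:C%C != 0 :> R[i].
  by rewrite -inner_self; apply: contra_neq y0 => /inner_eq0.
have ort : '[x - c *: y, c *: y] = 0.
  by rewrite innerZr innerBl innerZl inner_self /c divfK// subrr mulr0.
have := hnorm2D ort; rewrite subrK => xE.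
have cx : hnorm (c *: y) <= hnorm x.
  rewrite -(@ler_pXn2r _ 2)// ?nnegrE ?hnorm_ge0//.
  by rewrite xE lerDr sqr_ge0.
rewrite hnorm_scale in cx.
have -> : `|'[x, y]| = `|c| * (hnorm y ^+ 2)%:C%C.
  rewrite /c normrM normfV.
  by rewrite [X in _ / X * _]ger0_norm ?divfK// ler0c sqr_ge0.
rewrite -[`|c|]RRe_real ?normr_real// -realcM lecR expr2 mulrA.
by rewrite ler_wpM2r// hnorm_ge0.
Qed.

Lemma Re_inner_le x y : `|complex.Re '[x, y]| <= hnorm x * hnorm y.
Proof. by rewrite -lecR (le_trans (normc_ge_Re _) (cauchy_schwarz _ _)). Qed.

(** Carries estimates and identities for real parts over to imaginary parts. *)
Lemma Im_innerE x y : complex.Im '[x, y] = complex.Re '[x, 'i%C *: y].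
Proof. by rewrite innerZr; case: '[x, y] => u w /=; lra. Qed.

Lemma hballE x y (e : R) : ball x e%:C%C y <-> hnorm (x - y) < e.
Proof. by rewrite -ball_normE /ball_/= hnormE ltcR. Qed.

Lemma hcauchy_cvg (u : nat -> H) :
  (forall e : R, 0 < e -> exists N, forall n m, (N <= n)%N -> (N <= m)%N ->
     hnorm (u n - u m) < e) ->
  exists l, (fun n => hnorm (u n - l)) @ \oo --> (0 : R).
Proof.
move=> uC.
have : cauchy (u @ \oo).
  apply/cauchy_ballP => e e0.
  (* A positive element of [R[i]] is real, so every complex radius comes from a real one. *)
  have /complex_realP[r er] : e \is Num.real by rewrite gtr0_real.
  have r0 : 0 < r by move: e0; rewrite er -[0]/(0%:C%C) ltcR.
  have [N hN] := uC _ r0.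
  exists ([set u n | n in [set n | (N <= n)%N]], [set u n | n in [set n | (N <= n)%N]]).
    by split; exists N => // n /= Nn; exists n.
  move=> [_ _] /= [[n Nn <-] [m Nm <-]].
  by rewrite -ball_normE /ball_/= hnormE er ltcR; exact: hN.
move=> /cauchy_cvg /cvg_ex[l ul]; exists l.
apply/cvgrPdist_lt => e e0.
have eC : 0 < e%:C%C :> R[i] by rewrite -[0]/(0%:C%C) ltcR.
move/cvgrPdist_lt : ul => /(_ _ eC)[N _ hN]; exists N => // n Nn.
rewrite sub0r normrN ger0_norm ?hnorm_ge0// -ltcR -hnormE distrC.
exact: hN.
Qed.

End hilbert_space.

(** * Parseval's identity and the existence of Hilbert bases *)

Section orthonormal_families.
Context {R : realType} {H : hilbertType R}.
Implicit Types (x y z : H) (F G : seq H).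

(** The squared modulus as an element of [R], since the norm of [R[i]] is [R[i]]-valued. *)
Definition sqnormc (z : R[i]) : R := complex.Re z ^+ 2 + complex.Im z ^+ 2.

Lemma sqnormcE (z : R[i]) : z * conjc z = (sqnormc z)%:C%C.
Proof.
case: z => u w; apply/eqP; rewrite eq_complex /sqnormc /=.
by apply/andP; split; apply/eqP; ring.
Qed.

Lemma sqnormc_ge0 (z : R[i]) : 0 <= sqnormc z.
Proof. by rewrite addr_ge0 ?sqr_ge0. Qed.

Lemma sqnormc_eq0 (z : R[i]) : sqnormc z = 0 -> z = 0.
Proof.
move=> /eqP; rewrite paddr_eq0 ?sqr_ge0// !sqrf_eq0 => /andP[/eqP r0 /eqP i0].
by apply/eqP; rewrite eq_complex r0 i0 !eqxx.
Qed.

Lemma sqnormcJ (z : R[i]) : sqnormc (conjc z) = sqnormc z.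
Proof. by case: z => u w; rewrite /sqnormc /= sqrrN. Qed.

Lemma sqnormc_norm (z : R[i]) : (sqnormc z)%:C%C = `|z| ^+ 2.
Proof. by rewrite -sqnormcE sqr_normc. Qed.

Lemma sqnormc_inner_le x y : sqnormc '[x, y] <= hnorm x ^+ 2 * hnorm y ^+ 2.
Proof.
rewrite -exprMn -lecR sqnormc_norm.
rewrite (rmorphXn (real_complex R)) ler_pXn2r// ?nnegrE ?cauchy_schwarz//.
by rewrite ler0c mulr_ge0// hnorm_ge0.
Qed.

Definition orthonormal_seq F :=
  uniq F /\ {in F &, forall e f, '[e, f] = (e == f)%:R}.

Definition proj_seq F x : H := \sum_(e <- F) '[x, e] *: e.

Lemma sum_seq_delta F (f : H -> R[i]) y : uniq F -> y \in F ->
  \sum_(e <- F) f e * (e == y)%:R = f y.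
Proof.
move=> uF yF; rewrite (bigD1_seq y)//= eqxx mulr1 big1 ?addr0// => e ey.
by rewrite (negbTE ey) mulr0.
Qed.

Lemma proj_seq_inner F x f : orthonormal_seq F -> f \in F ->
  '[proj_seq F x, f] = '[x, f].
Proof.
move=> [uF oF] fF; rewrite inner_suml.
rewrite -[RHS](sum_seq_delta (fun e => '[x, e]) uF fF).
rewrite !big_seq; apply: eq_bigr => e eF.
by rewrite innerZl (oF e f).
Qed.

Lemma proj_seq_perp F x z : orthonormal_seq F ->
  (forall e, e \in F -> '[z, e] = 0) -> '[z, proj_seq F x] = 0.
Proof.
move=> oF zF; rewrite innerC inner_suml big_seq big1 ?conjc0// => e eF.
by rewrite innerZl [X in _ * X]innerC zF// conjc0 mulr0.
Qed.

Lemma proj_seq_res F x e : orthonormal_seq F -> e \in F ->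
  '[x - proj_seq F x, e] = 0.
Proof. by move=> oF eF; rewrite innerBl proj_seq_inner// subrr. Qed.

Lemma proj_seq_norm F x : orthonormal_seq F ->
  hnorm (proj_seq F x) ^+ 2 = \sum_(e <- F) sqnormc '[x, e].
Proof.
move=> oF; apply: (@complexI R); rewrite -inner_self {1}/proj_seq inner_suml.
rewrite (raddf_sum (real_complex R)) !big_seq; apply: eq_bigr => e eF.
by rewrite innerZl [X in _ * X]innerC proj_seq_inner// sqnormcE.
Qed.

Lemma proj_seq_pyth F x : orthonormal_seq F ->
  hnorm x ^+ 2 = hnorm (x - proj_seq F x) ^+ 2 + \sum_(e <- F) sqnormc '[x, e].
Proof.
move=> oF; rewrite -proj_seq_norm// -hnorm2D ?subrK//.
by apply: proj_seq_perp => // e eF; rewrite proj_seq_res.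
Qed.

Lemma bessel F x : orthonormal_seq F ->
  \sum_(e <- F) sqnormc '[x, e] <= hnorm x ^+ 2.
Proof. by move=> oF; rewrite (proj_seq_pyth x oF) lerDr sqr_ge0. Qed.

(** Pythagoras for nested families: control of the coefficient sums is control of the projections,
    which gives the Cauchy property in [parseval]. *)
Lemma proj_seq_dist F G x : orthonormal_seq F -> orthonormal_seq G ->
  {subset F <= G} ->
  hnorm (proj_seq G x - proj_seq F x) ^+ 2 =
  \sum_(e <- G) sqnormc '[x, e] - \sum_(e <- F) sqnormc '[x, e].
Proof.
move=> oF oG FG.
have E : x - proj_seq F x = (x - proj_seq G x) + (proj_seq G x - proj_seq F x).
  by rewrite addrA subrK.
have o : '[x - proj_seq G x, proj_seq G x - proj_seq F x] = 0.
  rewrite innerBr !proj_seq_perp ?subrr// => e eF; rewrite proj_seq_res//.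
  exact: FG.
have := proj_seq_pyth x oF; rewrite E hnorm2D//.
have := proj_seq_pyth x oG; lra.
Qed.

Lemma orthonormal_subset (B : set H) F :
  (forall e f, B e -> B f -> '[e, f] = (e == f)%:R) -> uniq F ->
  (forall e, e \in F -> B e) -> orthonormal_seq F.
Proof. by move=> oB uF FB; split=> // e f eF fF; apply: oB; exact: FB. Qed.

(** The basis may be uncountable, so finite families [Fn n] nearly exhausting the sum of
    coefficients are chosen. The projections of [x] onto them are Cauchy, and [x] minus their limit
    is orthogonal to all of [B], hence zero. *)
Lemma parseval (B : set H) x : orthonormal_basis B ->
  (\esum_(e in B) (sqnormc '[x, e])%:E = (hnorm x ^+ 2)%:E)%E.
Proof.
move=> [oB B0].
set S := esum _ _.
have fsum A : finite_set A -> A `<=` B ->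
    orthonormal_seq (finmap.enum_fset (fset_set A)) /\
    (\sum_(e \in A) (sqnormc '[x, e])%:E =
     (\sum_(e <- finmap.enum_fset (fset_set A)) sqnormc '[x, e])%:E)%E.
  move=> finA AB; split; last by rewrite fsbig_finite//= sumEFin.
  apply: (orthonormal_subset oB); first exact: finmap.fset_uniq.
  by move=> e; rewrite in_fset_set// => /set_mem/AB.
have S0 : (0 <= S)%E by apply: esum_ge0 => e _; rewrite lee_fin sqnormc_ge0.
have Sx : (S <= (hnorm x ^+ 2)%:E)%E.
  apply: ge_ereal_sup => _ [A [finA AB] <-].
  by have [oA ->] := fsum _ finA AB; rewrite lee_fin bessel.
have Sfin : S \is a fin_num by rewrite ge0_fin_numE// (le_lt_trans Sx) ?ltry.
pose s := fine S.
have SE : S = s%:E by rewrite fineK.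
have bound F : orthonormal_seq F -> (forall e, e \in F -> B e) ->
    \sum_(e <- F) sqnormc '[x, e] <= s.
  move=> oF FB; rewrite -lee_fin -SE.
  apply: ereal_sup_ubound; exists [set` F].
    by split; [exact: finite_seq|move=> e /= /FB].
  by rewrite -fsbig_seq ?sumEFin//; case: oF.
(* The tolerance is a square because [proj_seq_dist] bounds squared distances. *)
have appr n : exists F, [/\ orthonormal_seq F, forall e, e \in F -> B e &
    s - n.+1%:R^-1 ^+ 2 < \sum_(e <- F) sqnormc '[x, e]].
  have : ((s - n.+1%:R^-1 ^+ 2)%:E < S)%E.
    by rewrite SE lte_fin ltrBlDr ltrDl exprn_gt0// invr_gt0.
  move=> /ereal_sup_gt[_ [A [finA AB] <-]].
  have [oA ->] := fsum _ finA AB; rewrite lte_fin => sA.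
  exists (finmap.enum_fset (fset_set A)); split=> // e.
  by rewrite in_fset_set// => /set_mem/AB.
pose Fn n := projT1 (cid (appr n)).
have FnP n : [/\ orthonormal_seq (Fn n), forall e, e \in Fn n -> B e &
    s - n.+1%:R^-1 ^+ 2 < \sum_(e <- Fn n) sqnormc '[x, e]].
  exact: projT2 (cid (appr n)).
pose y n := proj_seq (Fn n) x.
have near_ext n G : orthonormal_seq G -> (forall e, e \in G -> B e) ->
    {subset Fn n <= G} -> hnorm (proj_seq G x - y n) < n.+1%:R^-1.
  move=> oG GB FG; have [oF FB sF] := FnP n.
  rewrite -(@ltr_pXn2r _ 2)// ?nnegrE ?hnorm_ge0 ?invr_ge0//.
  rewrite proj_seq_dist//; have := bound _ oG GB; move: sF.
  by move: (_ ^+ 2) => q; lra.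
have close n m : hnorm (y n - y m) < n.+1%:R^-1 + m.+1%:R^-1.
  have [oFn FnB _] := FnP n; have [oFm FmB _] := FnP m.
  pose G := undup (Fn n ++ Fn m).
  have GB e : e \in G -> B e.
    by rewrite mem_undup mem_cat => /orP[/FnB|/FmB].
  have oG : orthonormal_seq G.
    by apply: (orthonormal_subset oB) => //; exact: undup_uniq.
  have -> : y n - y m = (y n - proj_seq G x) + (proj_seq G x - y m).
    by rewrite addrA subrK.
  apply: (le_lt_trans (hnorm_triangle _ _)); apply: ltrD.
    rewrite hnorm_sub; apply: near_ext => // e eF.
    by rewrite mem_undup mem_cat eF.
  by apply: near_ext => // e eF; rewrite mem_undup mem_cat eF orbT.
have hsmall (e : R) : 0 < e -> exists N, forall n, (N <= n)%N -> n.+1%:R^-1 < e :> R.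
  move=> e0; have /cvgrPdist_lt/(_ _ e0)[N _ hN] := @cvg_harmonic R.
  by exists N => n /hN /=; rewrite sub0r normrN ger0_norm// invr_ge0.
have [l yl] : exists l, (fun n => hnorm (y n - l)) @ \oo --> (0 : R).
  apply: hcauchy_cvg => e e0.
  have [N hN] := hsmall (e / 2) (divr_gt0 e0 (ltr0Sn _ 1)).
  exists N => n m Nn Nm; apply: (lt_trans (close n m)).
  have := hN _ Nn; have := hN _ Nm.
  by move: n.+1%:R^-1 m.+1%:R^-1 => p q; lra.
have lclose (e : R) : 0 < e -> exists n, n.+1%:R^-1 < e /\ hnorm (y n - l) < e.
  move=> e0; have [N hN] := hsmall e e0.
  have /cvgrPdist_lt/(_ _ e0)[N' _ hN'] := yl.
  exists (maxn N N'); split; first by rewrite hN// leq_maxl.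
  have := hN' (maxn N N') (leq_maxr _ _) => /=.
  by rewrite sub0r normrN ger0_norm// hnorm_ge0.
have xl : x - l = 0.
  have : orthogonal_set B (x - l).
    move=> e Be; apply: sqnormc_eq0; apply/eqP; rewrite eq_le sqnormc_ge0 andbT.
    apply/ler_addgt0Pr => eps eps0; rewrite add0r.
    pose d := Num.sqrt eps / 2.
    have sq0 : 0 < Num.sqrt eps by rewrite sqrtr_gt0.
    have d0 : 0 < d by rewrite divr_gt0.
    have [n [nd nl]] := lclose d d0.
    have [oFn FnB _] := FnP n.
    (* Adjoining [e] makes the residual of [x] orthogonal to [e], while moving the projection by
       less than [n.+1%:R^-1]. *)
    pose G := undup (e :: Fn n).
    have GB f : f \in G -> B f.
      by rewrite mem_undup in_cons => /orP[/eqP->//|/FnB].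
    have oG : orthonormal_seq G.
      by apply: (orthonormal_subset oB) => //; exact: undup_uniq.
    have eG : e \in G by rewrite mem_undup mem_head.
    have e1 : hnorm e ^+ 2 = 1 by rewrite hnorm2 oB// eqxx.
    have -> : x - l = (x - proj_seq G x) + ((proj_seq G x - y n) + (y n - l)).
      by rewrite !addrA !subrK.
    rewrite innerDl proj_seq_res// add0r.
    apply: (le_trans (sqnormc_inner_le _ _)); rewrite e1 mulr1.
    rewrite -[leRHS]sqr_sqrtr ?(ltW eps0)// ler_pXn2r// ?nnegrE ?hnorm_ge0//.
    apply: (le_trans (hnorm_triangle _ _)).
    have : hnorm (proj_seq G x - y n) < n.+1%:R^-1.
      by apply: near_ext => // f fF; rewrite mem_undup in_cons fF orbT.
    by move: nd nl; rewrite /d; move: n.+1%:R^-1 => p; lra.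
  by rewrite B0.
move/subr0_eq : xl => xl; rewrite -xl in yl lclose.
apply/eqP; rewrite eq_le Sx/= SE lee_fin; apply/ler_addgt0Pr => eps eps0.
have sq0 : 0 < Num.sqrt eps by rewrite sqrtr_gt0.
have [n [_ nl]] := lclose _ sq0.
have [oFn FnB _] := FnP n.
rewrite (proj_seq_pyth x oFn) addrC lerD ?bound//.
rewrite -[leRHS]sqr_sqrtr ?(ltW eps0)// ler_pXn2r// ?nnegrE ?hnorm_ge0 ?sqrtr_ge0//.
by rewrite hnorm_sub ltW.
Qed.

(** Zorn's lemma gives a maximal orthonormal set; a nonzero vector orthogonal to it could be
    normalized and adjoined. *)
Lemma hilbert_basisP : orthonormal_basis (@hilbert_basis R H).
Proof.
apply: getPex.
have [F FP Ftot|B [oB Bmax]] := @Zorn_bigcup H [set B : set H |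
    forall e f, B e -> B f -> '[e, f] = (e == f)%:R].
  move=> e f [X FX Xe] [Y FY Yf].
  have [XY|YX] := Ftot _ _ FX FY; first by apply: (FP _ FY) => //; exact: XY.
  by apply: (FP _ FX) => //; exact: YX.
exists B; split=> //; apply/seteqP; split=> [z zB|_ -> y _]; last exact: inner0l.
apply/eqP/negPn/negP => z0.
have hz : hnorm z != 0 by rewrite hnorm_eq0.
pose u := (hnorm z)^-1%:C%C *: z.
have uB e : B e -> '[u, e] = 0 by move=> Be; rewrite innerZl zB// mulr0.
have Bu e : B e -> '[e, u] = 0 by move=> Be; rewrite innerC uB// conjc0.
have u1 : '[u, u] = 1.
  rewrite innerZl innerZr inner_self conjc_real -!realcM.
  by rewrite (_ : _ * _ = 1)//; field.
apply: (Bmax (B `|` [set u])).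
  split; last by move=> /(_ u (or_intror erefl)) /uB; rewrite u1 => /eqP; rewrite oner_eq0.
  by move=> e Be; left.
move=> e f [Be|->] [Bf|->]; rewrite ?u1 ?eqxx//; first exact: oB.
- rewrite Bu//; case: eqP => // eu.
  by have := u1; rewrite -{1}eu Bu// => /eqP; rewrite eq_sym oner_eq0.
- rewrite uB//; case: eqP => // eu.
  by have := u1; rewrite {2}eu uB// => /eqP; rewrite eq_sym oner_eq0.
Qed.

End orthonormal_families.

(** * Spectral measures *)

Section spectral_measures.
Context {R : realType} {H : hilbertType R}.
Implicit Types (E : spectral_measure H) (x y z : H) (A B : set (measurableTypeR R)).

(** * Spectral projections and their scalar measures *)

Section projections.
Variables (E : spectral_measure H).

Lemma smeasP A (mA : measurable A) a x y : E A (a *: x + y) = a *: E A x + E A y.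
Proof. exact: smeas_linear. Qed.

Lemma smeas0 A (mA : measurable A) : E A 0 = 0.
Proof.
by have := smeasP mA (-1) 0 0; rewrite scaler0 addr0 scaleN1r addNr.
Qed.

Lemma smeasD A (mA : measurable A) x y : E A (x + y) = E A x + E A y.
Proof. by have := smeasP mA 1 x y; rewrite !scale1r. Qed.

Lemma smeasZ A (mA : measurable A) a x : E A (a *: x) = a *: E A x.
Proof. by have := smeasP mA a x 0; rewrite !addr0 smeas0// addr0. Qed.

Lemma smeasB A (mA : measurable A) x y : E A (x - y) = E A x - E A y.
Proof. by rewrite -scaleN1r smeasD// smeasZ// scaleN1r. Qed.

Lemma smeas_inner A (mA : measurable A) x :
  '[E A x, x] = (hnorm (E A x) ^+ 2)%:C%C.
Proof. by rewrite -inner_self -[in RHS](smeas_sym E)// smeas_idem. Qed.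

Lemma smeas_contract A (mA : measurable A) x : hnorm (E A x) <= hnorm x.
Proof.
have [->|] := eqVneq (hnorm (E A x)) 0; first exact: hnorm_ge0.
move=> h0; have hp : 0 < hnorm (E A x) by rewrite lt_neqAle eq_sym h0 hnorm_ge0.
rewrite -(ler_pM2l hp) -expr2.
have := Re_inner_le (E A x) x; rewrite smeas_inner//=.
by rewrite ger0_norm ?sqr_ge0.
Qed.

Lemma smeasC A B (mA : measurable A) (mB : measurable B) x :
  E A (E B x) = E B (E A x).
Proof. by rewrite -!smeas_setI// setIC. Qed.

Lemma smeas_disj A B (mA : measurable A) (mB : measurable B) x :
  A `&` B = set0 -> E A (E B x) = 0.
Proof. by move=> AB; rewrite -smeas_setI// AB smeas_set0. Qed.

Lemma smeas_sub A B (mA : measurable A) (mB : measurable B) x :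
  A `<=` B -> E A x = x -> E B x = x.
Proof.
move=> AB Ax; rewrite -[in LHS]Ax -smeas_setI// setIC.
by rewrite (_ : A `&` B = A)//; exact/setIidPl.
Qed.

Lemma smeas_sub0 A B (mA : measurable A) (mB : measurable B) x :
  A `<=` B -> E B x = 0 -> E A x = 0.
Proof.
move=> AB Bx; rewrite -(_ : A `&` B = A); last exact/setIidPl.
by rewrite smeas_setI// Bx smeas0.
Qed.

(** Only the squared norms are assumed additive. The difference [z] of the two sides is killed by
    [E A] and [E B] but fixed by the projection of the union, so its measure of the union, which is
    [hnorm z ^+ 2], vanishes. *)
Lemma smeasU A B (mA : measurable A) (mB : measurable B) x :
  A `&` B = set0 -> E (A `|` B) x = E A x + E B x.
Proof.
move=> AB; have mU := measurableU _ _ mA mB.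
have BA : B `&` A = set0 by rewrite setIC.
apply/eqP; rewrite -subr_eq0; apply/eqP.
set z := _ - _.
have UA y : E A (E (A `|` B) y) = E A y.
  by rewrite -smeas_setI// (setIidPl _ _).2//; exact: subsetUl.
have UB y : E B (E (A `|` B) y) = E B y.
  by rewrite -smeas_setI// (setIidPl _ _).2//; exact: subsetUr.
have Az : E A z = 0.
  by rewrite smeasB// UA smeasD// smeas_idem// smeas_disj// addr0 subrr.
have Bz : E B z = 0.
  by rewrite smeasB// UB smeasD// (smeas_idem E _ mB)// smeas_disj// add0r subrr.
have Uz : E (A `|` B) z = z.
  rewrite smeasB// smeas_idem//; congr (_ - _).
  by rewrite smeasD//; congr (_ + _); [rewrite smeasC// UA|rewrite smeasC// UB].
have := measureU (smeas_at E z) mA mB AB.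
rewrite /= /smeas_at Az Bz Uz hnorm0 expr0n/= adde0 => -[/eqP].
by rewrite sqrf_eq0 hnorm_eq0 => /eqP.
Qed.

Lemma smeas_compl A (mA : measurable A) x : E (~` A) x = x - E A x.
Proof.
have := smeasU mA (measurableC mA) x (setICr A).
by rewrite setUCr smeas_setT => e; apply/esym/eqP; rewrite subr_eq addrC -e.
Qed.

Lemma smeas_splitC A (mA : measurable A) x : x = E A x + E (~` A) x.
Proof. by rewrite smeas_compl// addrC subrK. Qed.

Lemma smeas_at_null x B : smeas_at E x B = 0%E -> E B x = 0.
Proof. by move=> -[/eqP]; rewrite sqrf_eq0 hnorm_eq0 => /eqP. Qed.

(** The projections of [x] and [y] are separated by [B], hence orthogonal, and Pythagoras
    applies. *)
Lemma smeas_atD B (mB : measurable B) x y : E B x = x -> E B y = 0 ->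
  forall A, measurable A ->
  smeas_at E (x + y) A = (smeas_at E x A + smeas_at E y A)%E.
Proof.
move=> Bx By A mA; rewrite /smeas_at smeasD// hnorm2D//.
by rewrite -Bx smeasC// (smeas_sym E)// smeasC// By smeas0// inner0r.
Qed.

(** The measure is finite and [|f| <= 1 + f^2]. *)
Lemma smeas_at_integrable x (f : R -> R) : measurable_fun setT f ->
  (\int[smeas_at E x]_t (f t ^+ 2)%:E < +oo)%E ->
  (smeas_at E x).-integrable setT (EFin \o f).
Proof.
move=> mf f2.
have i1 : (smeas_at E x).-integrable setT (EFin \o cst (1 : R)).
  apply/integrableP; split; first exact/measurable_EFinP/measurable_cst.
  rewrite /= normr1 integral_cst// mul1e; exact: ltry.
have i2 : (smeas_at E x).-integrable setT (EFin \o (fun t => f t ^+ 2)).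
  apply/integrableP; split; first exact/measurable_EFinP/measurable_funX.
  apply: le_lt_trans f2; rewrite le_eqVlt; apply/orP; left; apply/eqP.
  by apply: eq_integral => t _ /=; rewrite ger0_norm// sqr_ge0.
apply: (le_integrable measurableT _ _ (integrableD measurableT i1 i2)).
  exact/measurable_EFinP.
move=> t _ /=; rewrite lee_fin [leRHS]ger0_norm ?addr_ge0 ?sqr_ge0//.
rewrite -(@real_normK _ (f t)) ?num_real//.
have := sqr_ge0 (`|f t| - 1); have := normr_ge0 (f t); move: `|f t| => r r0.
by rewrite sqrrB expr1n mulr1 mulr2n; have := sqr_ge0 r; move: (r ^+ 2) => q; lra.
Qed.

Lemma Rintegral_smeas_atD B (mB : measurable B) x y (f : R -> R) :
  E B x = x -> E B y = 0 ->
  (smeas_at E x).-integrable setT (EFin \o f) ->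
  (smeas_at E y).-integrable setT (EFin \o f) ->
  \int[smeas_at E (x + y)]_t f t =
  \int[smeas_at E x]_t f t + \int[smeas_at E y]_t f t.
Proof.
move=> Bx By ix iy; rewrite /Rintegral -fineD.
- congr fine; rewrite -integral_measure_add//.
  apply: eq_measure_integral => A mA _; rewrite [RHS]measure_addE.
  exact: (smeas_atD mB).
- exact: integrable_fin_num ix.
- exact: integrable_fin_num iy.
Qed.

Lemma ge0_integral_smeas_atD B (mB : measurable B) x y (f : R -> \bar R) :
  E B x = x -> E B y = 0 -> measurable_fun setT f -> (forall t, 0 <= f t)%E ->
  (\int[smeas_at E (x + y)%R]_t f t =
  \int[smeas_at E x]_t f t + \int[smeas_at E y]_t f t)%E.
Proof.
move=> Bx By mf f0; rewrite -ge0_integral_measure_add//.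
apply: eq_measure_integral => A mA _; rewrite [RHS]measure_addE.
exact: (smeas_atD mB).
Qed.

Lemma Rintegral_smeas_at_supp B (mB : measurable B) x (f : R -> R) :
  E B x = x -> (smeas_at E x).-integrable setT (EFin \o f) ->
  \int[smeas_at E x]_t f t = \int[smeas_at E x]_(t in B) f t.
Proof.
move=> Bx ix; rewrite /Rintegral (negligible_integral (measurableC mB))//.
  by rewrite setTD setCK.
by rewrite /= /smeas_at smeas_compl// Bx subrr hnorm0 expr0n.
Qed.

End projections.

Lemma mulcJ_i : 'i%C * conjc 'i%C = 1 :> R[i].
Proof. by apply/eqP; rewrite eq_complex /=; apply/andP; split; apply/eqP; ring. Qed.

(** Additivity of the form at [x + y] gives [<Tx,y> + <Ty,x> = 0], at ['i x + y] it gives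
    [<Tx,y> - <Ty,x> = 0]. Linearity is asked only at the vectors involved, because [T] may be the
    function of a partially defined operator. *)
Lemma polarization_zero (T : H -> H) (x y : H) :
  T (x + y) = T x + T y -> T ('i%C *: x + y) = 'i%C *: T x + T y ->
  T ('i%C *: x) = 'i%C *: T x ->
  '[T (x + y), x + y] = '[T x, x] + '[T y, y] ->
  '[T ('i%C *: x + y), 'i%C *: x + y] = '[T x, x] + '[T y, y] ->
  '[T x, y] = 0.
Proof.
move=> Txy Tixy Tix; rewrite Txy Tixy !(innerDl, innerDr) !innerZl !innerZr.
rewrite mulrA mulcJ_i mul1r.
have -> : conjc 'i%C = - 'i%C :> R[i] by apply/eqP; rewrite eq_complex /= oppr0 !eqxx.
move: '[T x, x] '[T y, y] '[T x, y] '[T y, x] => p q u w h1 h2.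
have h3 : u + w = 0.
  by apply: (addIr (p + q)); rewrite add0r -[RHS]h1; ring.
have h4 : 'i%C * (u - w) = 0.
  by apply: (addIr (p + q)); rewrite add0r -[RHS]h2; ring.
have h5 : u - w = 0.
  by move: h4 => /eqP; rewrite mulf_eq0 => /orP[|/eqP//]; rewrite eq_complex /= oner_eq0 andbF.
have : 2%:R * u = 0 by rewrite -(addr0 0) -{1}h3 -h5; ring.
by move=> /eqP; rewrite mulf_eq0 pnatr_eq0 /= => /eqP.
Qed.

Lemma linear_opD (A : operator H) x y : linear_op A -> op_dom A x -> op_dom A y ->
  op_dom A (x + y) /\ A (x + y) = A x + A y.
Proof. by move=> [_ lA] dx dy; have := lA 1 x y dx dy; rewrite !scale1r. Qed.

Lemma linear_op0 (A : operator H) : linear_op A -> A 0 = 0.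
Proof.
move=> [d0 lA]; have [_] := lA (-1) _ _ d0 d0.
by rewrite scaler0 addr0 scaleN1r addNr.
Qed.

Lemma linear_opZ (A : operator H) a x : linear_op A -> op_dom A x ->
  op_dom A (a *: x) /\ A (a *: x) = a *: A x.
Proof.
move=> lA dx; have [d0 l] := lA; have := l a x 0 dx d0.
by rewrite !addr0 linear_op0// addr0.
Qed.

(** If [z] were nonzero, a point [y] of [D] closer to [z] than [|z|] would give
    [|z|^2 = <z, z - y> < |z|^2]. *)
Lemma dense_inner_eq0 (D : set H) z : dense D ->
  (forall y, D y -> '[z, y] = 0) -> z = 0.
Proof.
move=> dD zD; apply/eqP/negPn/negP => z0.
have hz : 0 < hnorm z by rewrite lt_neqAle eq_sym hnorm_eq0 z0 hnorm_ge0.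
have hzC : 0 < (hnorm z)%:C%C :> R[i] by rewrite -[0]/(0%:C%C) ltcR.
have [y [yb Dy]] := dD _ (ex_intro _ z (ballxx z hzC)) (ball_open z _).
move/hballE : yb => yb.
have : hnorm z ^+ 2 <= hnorm z * hnorm (z - y).
  rewrite [leLHS]hnorm2 (_ : '[z, z] = '[z, z - y]).
    exact: (le_trans (ler_norm _) (Re_inner_le _ _)).
  by rewrite innerBr (zD y)// subr0.
by rewrite expr2 ler_pM2l// leNgt yb.
Qed.

(** * Operators given as spectral integrals *)

Section spectral_integrals.
Variables (E : spectral_measure H) (f : R -> R) (A : operator H).
Hypotheses (mf : measurable_fun setT f) (EA : spectral_integral E f A).

Let linA : linear_op A. Proof. by case: EA. Qed.

Lemma spectral_domE x : op_dom A x <-> (\int[smeas_at E x]_t (f t ^+ 2)%:E < +oo)%E.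
Proof. by case: EA => _ -> _. Qed.

Lemma spectral_form x : op_dom A x -> '[A x, x] = (\int[smeas_at E x]_t f t)%:C%C.
Proof. by case: EA => _ _; apply. Qed.

Lemma spectral_integrable x : op_dom A x -> (smeas_at E x).-integrable setT (EFin \o f).
Proof. by move=> /spectral_domE; exact: smeas_at_integrable. Qed.

Lemma spectral_dom_proj B x : measurable B -> op_dom A x -> op_dom A (E B x).
Proof.
move=> mB /spectral_domE dx; apply/spectral_domE; apply: le_lt_trans dx.
rewrite [in leRHS](smeas_splitC E mB x) (ge0_integral_smeas_atD mB).
- by rewrite leeDl// integral_ge0// => t _; rewrite lee_fin sqr_ge0.
- by rewrite smeas_idem.
- by rewrite smeas_disj ?setICr//; exact: measurableC.
- exact/measurable_EFinP/measurable_funX.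
- by move=> t; rewrite lee_fin sqr_ge0.
Qed.

(* The measures of x and y are carried by disjoint sets, so that the quadratic
   form is additive on x + y and 'i x + y. *)
Lemma spectral_cross B x y : measurable B -> op_dom A x -> op_dom A y ->
  E B x = x -> E B y = 0 -> '[A x, y] = 0.
Proof.
move=> mB dx dy Bx By.
have [_ lA] := linA; have [dix Aix] := linear_opZ 'i%C linA dx.
have [dxy Axy] := linear_opD linA dx dy.
have [dixy Aixy] := lA 'i%C x y dx dy.
apply: (polarization_zero Axy Aixy Aix).
  rewrite !spectral_form// (Rintegral_smeas_atD mB) ?rmorphD//;
  exact: spectral_integrable.
have -> : '[A x, x] = '[A ('i%C *: x), 'i%C *: x].
  by rewrite Aix innerZl innerZr mulrA mulcJ_i mul1r.
rewrite !spectral_form// (Rintegral_smeas_atD mB) ?rmorphD//.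
- by rewrite smeasZ// Bx.
- exact: spectral_integrable.
- exact: spectral_integrable.
Qed.

(** On the range of [E B] the form of [A] is [b |y|^2], and polarization of [A - b] gives
    [<Ax,y> = b <x,y>] there. [spectral_cross] handles the complementary part of [y], and density of
    the domain concludes. *)
Lemma spectral_eigen B x b : measurable B -> dense (op_dom A) -> op_dom A x ->
  E B x = x -> (forall t, B t -> f t = b) -> A x = b%:C%C *: x.
Proof.
move=> mB dA dx Bx fb.
have form y : op_dom A y -> E B y = y -> '[A y, y] = b%:C%C * '[y, y].
  move=> dy By; rewrite spectral_form// (Rintegral_smeas_at_supp mB)//; last first.
    exact: spectral_integrable.
  rewrite (@eq_Rintegral _ _ _ _ _ (cst b)); last by move=> t /set_mem /fb.
  by rewrite Rintegral_cst// [fine _]/(hnorm (E B y) ^+ 2) By inner_self -realcM.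
have bil y : op_dom A y -> E B y = y -> '[A x, y] = b%:C%C * '[x, y].
  move=> dy By; pose T z := A z - b%:C%C *: z.
  suff : '[T x, y] = 0 by rewrite /T innerBl innerZl => /subr0_eq.
  have T0 z : op_dom A z -> E B z = z -> '[T z, z] = 0.
    by move=> dz Bz; rewrite /T innerBl innerZl form// subrr.
  have [_ lA] := linA; have [dix Aix] := linear_opZ 'i%C linA dx.
  have [dxy Axy] := linear_opD linA dx dy.
  have [dixy Aixy] := lA 'i%C x y dx dy.
  have Bi : E B ('i%C *: x + y) = 'i%C *: x + y by rewrite smeasP// Bx By.
  have B1 : E B (x + y) = x + y by rewrite smeasD// Bx By.
  apply: polarization_zero.
  - by rewrite /T Axy scalerDr opprD addrACA.
  - by rewrite /T Aixy scalerDr opprD addrACA scalerBr !scalerA mulrC.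
  - by rewrite /T Aix scalerBr !scalerA mulrC.
  - by rewrite !T0// addr0.
  - by rewrite !T0// addr0.
apply/eqP; rewrite -subr_eq0; apply/eqP.
apply: (dense_inner_eq0 dA) => y dy.
rewrite innerBl innerZl [in '[A x, y]](smeas_splitC E mB y) innerDr.
rewrite bil ?smeas_idem//; last exact: spectral_dom_proj.
rewrite (spectral_cross mB)//; last 2 first.
  by apply: spectral_dom_proj => //; exact: measurableC.
  by rewrite smeas_disj ?setICr//; exact: measurableC.
by rewrite addr0 -(smeas_sym E)// Bx subrr.
Qed.

End spectral_integrals.

(** The measure of an eigenvector is concentrated at [a]: on a set [B] to one side of [a], the part
    [y = E B x] has integral of [t - a] equal to 0, although the integrand has constant sign and no
    zero, so [y = 0]. *)
Lemma spectral_eigenspace E (A : operator H) a x : spectral_measure_of A E ->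
  op_dom A x -> A x = a%:C%C *: x -> E [set a] x = x.
Proof.
move=> EA dx Ax; have mid : measurable_fun setT (@id R) by exact: measurable_id.
have key B : measurable B -> ~ B a ->
    (forall t, B t -> 0 <= t - a) \/ (forall t, B t -> t - a <= 0) -> E B x = 0.
  move=> mB Ba sgn; have mC := measurableC mB.
  set y := E B x.
  have dy : op_dom A y by exact: spectral_dom_proj EA _ _ mB dx.
  have By : E B y = y by rewrite smeas_idem.
  have Ayy : '[A y, y] = a%:C%C * '[y, y].
    (* The part of [x] outside [B] contributes nothing, by [spectral_cross]. *)
    have -> : '[A y, y] = '[A x, y].
      have dCx : op_dom A (E (~` B) x) by exact: spectral_dom_proj EA _ _ mC dx.
      have [linA _ _] := EA; have [_] := linear_opD linA dy dCx.
      rewrite -smeas_splitC// => ->; rewrite innerDl -[LHS]addr0; congr (_ + _).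
      rewrite (spectral_cross mid EA mC)//; first by rewrite smeas_idem.
      by rewrite -By smeas_disj ?setICl.
    by rewrite Ax innerZl -[in '[x, y]]By -(smeas_sym E).
  have iy := spectral_integrable mid EA dy.
  have ic : (smeas_at E y).-integrable setT (EFin \o cst a).
    apply/integrableP; split; first exact/measurable_EFinP/measurable_cst.
    by rewrite /= integral_cst// -EFinM ltry.
  have iya : (smeas_at E y).-integrable setT (EFin \o (fun t => t - a)).
    by have /= := integrableB measurableT iy ic.
  have int0 : \int[smeas_at E y]_(t in B) (t - a) = 0.
    rewrite -(Rintegral_smeas_at_supp mB)//.
    rewrite (RintegralB measurableT iy ic).
    rewrite Rintegral_cst//= smeas_setT; apply/eqP; rewrite subr_eq0; apply/eqP.
    by apply: (@complexI R); rewrite -(spectral_form EA)// Ayy inner_self -realcM.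
  have iyB : (smeas_at E y).-integrable B (EFin \o (fun t => t - a)).
    exact: integrableS iya.
  have : (\int[smeas_at E y]_(t in B) `|(t - a)%:E|)%E = 0%E.
    have fi : (\int[smeas_at E y]_(t in B) (t - a)%:E)%E = 0%E.
      have /fineK <- := integrable_fin_num mB iyB.
      by rewrite -[fine _]/(Rintegral _ _ _) int0.
    case: sgn => sgn.
      rewrite -[RHS]fi; apply: eq_integral => t /set_mem Bt.
      by rewrite gee0_abs// lee_fin sgn.
    have ta0 t : B t -> (0 <= (a - t)%:E)%E.
      by move=> Bt; rewrite lee_fin -opprB oppr_ge0 sgn.
    rewrite -[RHS]oppe0 -[in RHS]fi.
    rewrite [in RHS](_ : (fun t => (t - a)%:E) = (fun t => - (a - t)%:E)%E); last first.
      by apply/funext => t; rewrite -EFinN opprB.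
    rewrite integral_ge0N// oppeK; apply: eq_integral => t /set_mem Bt.
    by rewrite lee0_abs ?lee_fin ?sgn// -EFinN opprB.
  have mt : measurable_fun B (fun t : R => (t - a)%:E).
    by case/integrableP : iyB.
  move/(ae_eq_integral_abs _ mB mt) => [N [mN N0 BN]].
  rewrite -/y -By; apply: smeas_at_null; apply: (subset_measure0 mB mN _ _) => //.
  move=> t Bt; apply: BN => /(_ Bt) -[/eqP]; rewrite subr_eq0 => /eqP ta.
  by apply: Ba; rewrite -ta.
have gt0 : E `]a, +oo[%classic x = 0.
  apply: key => //=; first by rewrite in_itv/= ltxx.
  by left => t /=; rewrite in_itv/= andbT subr_ge0 => /ltW.
have lt0 : E `]-oo, a[%classic x = 0.
  apply: key => //=; first by rewrite in_itv/= ltxx.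
  by right => t /=; rewrite in_itv/= subr_le0 => /ltW.
have := smeas_compl E (measurable_set1 a) x.
have -> : ~` [set a] = `]-oo, a[ `|` `]a, +oo[.
  apply/seteqP; split=> t /=; rewrite !in_itv/= andbT.
    by move/eqP; rewrite neq_lt => /orP.
  by move=> /orP; rewrite -neq_lt => /eqP.
rewrite smeasU//; last first.
  apply/seteqP; split=> t //= []; rewrite !in_itv/= andbT => ta at'.
  by have := lt_trans ta at'; rewrite ltxx.
by rewrite gt0 lt0 addr0 => /esym/subr0_eq.
Qed.

End spectral_measures.

(** * Discreteness of the spectrum off the kernel *)

Section compactness.
Context {R : realType} {H : hilbertType R}.
Implicit Types (x y z w : H) (F : seq H).

Lemma orthonormal_fun_seq n (v : 'I_n -> H) :
  (forall i j, '[v i, v j] = (i == j)%:R) ->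
  exists2 F : seq H, orthonormal_seq F /\ size F = n &
    forall e, e \in F -> exists i, e = v i.
Proof.
move=> ov; exists [seq v i | i <- enum 'I_n]; last first.
  by move=> e /mapP[i _ ->]; exists i.
have vI : injective v.
  move=> i j vij; apply/eqP; case: eqVneq => // ij.
  have := ov i j; rewrite vij ov eqxx (negbTE ij) => /eqP.
  by rewrite oner_eq0.
split; last by rewrite size_map size_enum_ord.
split; first by rewrite map_inj_uniq ?enum_uniq.
by move=> _ _ /mapP[i _ ->] /mapP[j _ ->]; rewrite ov (inj_eq vI).
Qed.

Lemma orthonormal_seq_fun F : orthonormal_seq F ->
  forall i j : 'I_(size F), '[F`_i, F`_j] = (i == j)%:R.
Proof.
move=> [uF oF] i j; rewrite oF ?mem_nth//.
by rewrite nth_uniq.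
Qed.

Lemma orthonormal_normalize y : y != 0 ->
  exists2 a : R[i], a != 0 & '[a *: y, a *: y] = 1.
Proof.
move=> y0; have hy : hnorm y != 0 by rewrite hnorm_eq0.
exists (hnorm y)^-1%:C%C.
  by rewrite -[0]/(0%:C%C) (inj_eq (@complexI _)) invr_eq0.
rewrite innerZl innerZr inner_self conjc_real -!realcM.
by rewrite (_ : _ * _ = 1)//; field.
Qed.

(** A ball of radius [r / 2] holds at most one point of an [r]-separated family, so [k] can be the
    number of such balls in a finite cover. *)
Lemma precompact_separated (A : set H) (r : R) : precompact A -> 0 < r ->
  exists k, forall n (w : 'I_n -> H), (forall i, A (w i)) ->
    (forall i j, i != j -> r <= hnorm (w i - w j)) -> (n <= k)%N.
Proof.
move=> [D AD [cD _]] r0.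
have r20 : 0 < r / 2 by rewrite divr_gt0.
have rC : 0 < (r / 2)%:C%C :> R[i] by rewrite -[0]/(0%:C%C) ltcR.
move: cD; rewrite compact_cover => /(_ _ D (fun z => ball z (r / 2)%:C%C)).
case=> [z _|z Dz|F FD DF]; first exact: ball_open.
  by exists z => //; exact: ballxx.
exists (size (finmap.enum_fset F)) => n w wA sep.
have cP i : exists c, c \in finmap.enum_fset F /\ hnorm (c - w i) < r / 2.
  by have [c /= cF /hballE cw] := DF _ (AD _ (wA i)); exists c.
pose c i := projT1 (cid (cP i)).
have cE i : c i \in finmap.enum_fset F /\ hnorm (c i - w i) < r / 2.
  exact: projT2 (cid (cP i)).
have cI : injective c.
  move=> i j cij; apply/eqP/negPn/negP => /sep.
  have [_ ci] := cE i; have [_ cj] := cE j; rewrite -cij in cj.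
  have := hnorm_triangle (w i - c i) (c i - w j); rewrite addrA subrK.
  rewrite (hnorm_sub (w i)); move: ci cj.
  move: (hnorm (c i - w i)) (hnorm (c i - w j)) (hnorm (w i - w j)) => p q s.
  lra.
rewrite -(size_enum_ord n) -(size_map c).
apply: uniq_leq_size; first by rewrite map_inj_uniq ?enum_uniq.
by move=> _ /mapP[i _ ->]; have [] := cE i.
Qed.

Lemma spectral_dom_bounded (E : spectral_measure H) (f : R -> R) (A : operator H)
    (B : set (measurableTypeR R)) (C : R) x :
  measurable_fun setT f -> spectral_integral E f A -> measurable B ->
  (forall t, B t -> `|f t| <= C) -> E B x = x -> op_dom A x.
Proof.
move=> mf EA mB fC Bx; apply/(spectral_domE EA).
rewrite (ge0_negligible_integral (measurableC mB))//=; last 3 first.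
- exact/measurable_EFinP/measurable_funX.
- by move=> t _; rewrite lee_fin sqr_ge0.
- by rewrite /= /smeas_at smeas_compl// Bx subrr hnorm0 expr0n.
rewrite setTD setCK.
apply: (@le_lt_trans _ _ (\int[smeas_at E x]_(t in B) (cst (C ^+ 2)%:E) t)%E).
  apply: ge0_le_integral => //=.
  - by move=> t _; rewrite lee_fin sqr_ge0.
  - apply/measurable_EFinP/measurable_funX; exact: measurable_funS mf.
  - move=> t Bt; rewrite lee_fin -[leLHS]real_normK ?num_real//.
    have ft := fC _ Bt; have C0 : 0 <= C by exact: le_trans ft.
    by rewrite ler_pXn2r// nnegrE.
by rewrite integral_cst//= -EFinM ltry.
Qed.

(** * The inverse of [L] on bounded spectral ranges *)

Section resolvent.
Variables (L : operator H) (E : spectral_measure H) (Linv : H -> H).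
Hypotheses (L_sa : selfadjoint L) (L_ge0 : nonnegative_op L).
Hypothesis L_E : spectral_measure_of L E.
Hypotheses (LinvP : inverse_off_kernel L Linv) (Linv_cpt : compact_op Linv).

Let mid : measurable_fun setT (@id R). Proof. exact: measurable_id. Qed.
Let linL : linear_op L. Proof. by case: L_sa. Qed.
Let domL : dense (op_dom L). Proof. by case: L_sa. Qed.

Lemma selfadjoint_sym x y : op_dom L x -> op_dom L y -> '[L x, y] = '[x, L y].
Proof. by move=> dx dy; have [_ _ /(_ y (L y))[_]] := L_sa; apply. Qed.

Lemma eigenvalue_gt0 a : a != 0 -> eigenvalue_op L a -> 0 < a.
Proof.
move=> a0 [x [dx x0 Lx]]; rewrite lt_neqAle eq_sym a0/=.
have := L_ge0 dx; rewrite Lx innerZl inner_self -realcM ler0c.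
by rewrite pmulr_lge0// exprn_gt0// lt_neqAle eq_sym hnorm_eq0 x0 hnorm_ge0.
Qed.

Section bounded_range.
Variables (C : R).
Let B : set (measurableTypeR R) := `]0, C]%classic.
Let mB : measurable B. Proof. exact: measurable_itv. Qed.

Lemma range_dom x : E B x = x -> op_dom L x.
Proof.
apply: (spectral_dom_bounded (C := C) mid L_E mB) => t.
by rewrite /B/= in_itv/= => /andP[t0 tC]; rewrite ger0_norm// ltW.
Qed.

(** [L x] is orthogonal to the complementary parts of a dense set of vectors. Stability allows [L]
    to be applied twice in [range_norm_le]. *)
Lemma range_stable x : E B x = x -> E B (L x) = L x.
Proof.
move=> Bx; have mC := measurableC mB.
suff : E (~` B) (L x) = 0 by rewrite smeas_compl// => /subr0_eq.
apply: (dense_inner_eq0 domL) => y dy; rewrite (smeas_sym E)//.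
rewrite (spectral_cross mid L_E mB)//; first exact: range_dom.
  exact: (spectral_dom_proj mid L_E mC dy).
by rewrite smeas_disj ?setICr.
Qed.

Lemma range_form_le x : E B x = x ->
  complex.Re '[L x, x] <= C * hnorm x ^+ 2.
Proof.
move=> Bx; have dx := range_dom Bx.
have ix := spectral_integrable mid L_E dx.
rewrite (spectral_form L_E)//= (Rintegral_smeas_at_supp mB)//.
have ic : (smeas_at E x).-integrable B (EFin \o cst C).
  apply/integrableP; split; first exact/measurable_EFinP/measurable_cst.
  by rewrite /= integral_cst// -EFinM ltry.
have ixB : (smeas_at E x).-integrable B (EFin \o id) by exact: integrableS ix.
have := le_Rintegral mB ixB ic.
rewrite Rintegral_cst// [fine _]/(hnorm (E B x) ^+ 2) Bx; apply.
by move=> t; rewrite /B/= in_itv/= => /andP[].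
Qed.

(* Positivity of the form at L x - C x. *)
Lemma range_norm_le x : 0 < C -> E B x = x -> hnorm (L x) <= C * hnorm x.
Proof.
move=> C0 Bx; have dx := range_dom Bx.
set z := L x; have Bz : E B z = z by exact: range_stable.
have dz := range_dom Bz.
pose w := z - C%:C%C *: x.
have Bw : E B w = w by rewrite smeasB// smeasZ// Bx Bz.
have dw := range_dom Bw.
have Lw : L w = L z - C%:C%C *: z.
  have [_ lL] := linL; have := lL (- C%:C%C) x z dx dz.
  by rewrite !scaleNr ![- _ + _]addrC => -[_].
have h1 := L_ge0 dw; have h2 := range_form_le Bz; have h3 := range_form_le Bx.
have Lzx : '[L z, x] = (hnorm z ^+ 2)%:C%C.
  by rewrite selfadjoint_sym// -/z inner_self.
move: h1; rewrite Lw /w !(innerBl, innerBr) !innerZl !innerZr conjc_real.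
rewrite Lzx -/z inner_self.
have -> : '[L z, z] = (complex.Re '[L z, z])%:C%C.
  by rewrite (spectral_form L_E).
have zx : '[z, x] = (complex.Re '[z, x])%:C%C.
  by rewrite /z (spectral_form L_E).
rewrite zx -!realcM -!(rmorphB (real_complex R)) ler0c => h1.
rewrite -(@ler_pXn2r _ 2)// ?nnegrE ?mulr_ge0 ?hnorm_ge0 ?(ltW C0)//.
rewrite exprMn; move: h1 h2 h3; rewrite -/z.
move: (complex.Re '[L z, z]) (complex.Re '[z, x]) (hnorm z ^+ 2) (hnorm x ^+ 2).
move=> p q s t h1 h2 h3.
(* By [p <= C s] and [q <= C t], the nonnegative number [p - 2 C s + C^2 q] is at most
   [C (C^2 t - s)]. *)
have h4 : 0 <= C * (C ^+ 2 * t - s) by nra.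
by rewrite pmulr_rge0// subr_ge0 in h4.
Qed.

(* |x|^2 = <L u, x> = <u, L x> with u = Linv x. *)
Lemma inverse_lower_bound x : 0 < C -> E B x = x -> hnorm x <= C * hnorm (Linv x).
Proof.
move=> C0 Bx; have dx := range_dom Bx.
have xK : orthogonal_set (ker_op L) x.
  move=> y [dy Ly]; have E0y : E [set 0] y = y.
    by apply: (spectral_eigenspace L_E dy); rewrite Ly scale0r.
  rewrite -E0y -(smeas_sym E)// -Bx smeas_disj ?inner0l//.
  by apply/seteqP; split=> t //= [->]; rewrite /B/= in_itv/= ltxx.
have [_ _ /(_ x xK)[du _ Lu]] := LinvP.
have [->|x0] := eqVneq x 0; first by rewrite hnorm0 mulr_ge0 ?hnorm_ge0// ltW.
have hx : 0 < hnorm x by rewrite lt_neqAle eq_sym hnorm_eq0 x0 hnorm_ge0.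
rewrite -(ler_pM2r hx) -expr2 hnorm2 -{1}Lu selfadjoint_sym//.
apply: (le_trans (ler_norm _)); apply: (le_trans (Re_inner_le _ _)).
rewrite [X in _ <= X * _]mulrC -mulrA.
by rewrite ler_wpM2l ?hnorm_ge0// range_norm_le.
Qed.

End bounded_range.

(** Distinct members of [F] are at distance at least 1, so by [inverse_lower_bound] their images
    under [Linv] are [C^-1]-separated; these lie in the precompact image of the unit ball. *)
Lemma bounded_range_finite (C : R) : 0 < C ->
  exists k, forall F, orthonormal_seq F ->
    (forall e, e \in F -> E `]0, C]%classic e = e) -> (size F <= k)%N.
Proof.
move=> C0; have [linLinv pc] := Linv_cpt.
have r0 : 0 < C^-1 by rewrite invr_gt0.
have [k hk] := precompact_separated pc r0.
exists k => F oF FB.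
have v1 (i : 'I_(size F)) : hnorm F`_i = 1.
  apply/eqP; rewrite -(@eqrXn2 _ 2)// ?hnorm_ge0// expr1n hnorm2.
  by rewrite orthonormal_seq_fun// eqxx.
apply: (hk _ (fun i : 'I_(size F) => Linv F`_i)) => [i|i j ij].
  by exists F`_i => //=; rewrite hnormE v1.
have -> : Linv F`_i - Linv F`_j = Linv (F`_i - F`_j).
  have := linLinv (-1) F`_j F`_i; rewrite !scaleN1r.
  by rewrite ![- _ + _]addrC => ->.
have := @inverse_lower_bound C (F`_i - F`_j) C0.
rewrite smeasB// !FB ?mem_nth// => /(_ erefl).
rewrite -ler_pdivrMl// => le1; apply: le_trans le1; rewrite ler_pMr//.
rewrite -(@ler_pXn2r _ 2)// ?nnegrE ?hnorm_ge0// expr1n.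
have o : '[F`_i, - F`_j] = 0.
  by rewrite innerNr orthonormal_seq_fun// (negbTE ij) oppr0.
by rewrite hnorm2D// hnorm_opp !v1 expr1n lerDl.
Qed.

(** * Eigenvalues as the atoms of the spectral measure *)

Section eigenvalues.
Variable lam : nat -> R.
Hypothesis lam_eig : range lam = [set a | a != 0 /\ eigenvalue_op L a].
Hypothesis lam_incr : forall i j : nat, (i < j)%N -> lam i < lam j.

Lemma lam_eigenvalue j : lam j != 0 /\ eigenvalue_op L (lam j).
Proof. by have : range lam (lam j) by [exists j]; rewrite lam_eig. Qed.

Lemma lam_gt0 j : 0 < lam j.
Proof. by have [l0 /(eigenvalue_gt0 l0)] := lam_eigenvalue j. Qed.

Lemma measurable_range_lam : measurable (range lam : set (measurableTypeR R)).
Proof.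
have -> : range lam = \bigcup_j [set lam j].
  by apply/seteqP; split=> [_ [j _ <-]|_ [j _ ->]]; exists j.
exact: bigcupT_measurable.
Qed.

Lemma atom_eigenvalue x t : 0 < t -> E [set t] x != 0 -> range lam t.
Proof.
move=> t0 y0; rewrite lam_eig; split; first by rewrite gt_eqF.
have Ey : E [set t] (E [set t] x) = E [set t] x by rewrite smeas_idem.
have dy : op_dom L (E [set t] x).
  by apply: (spectral_dom_bounded (C := `|t|) mid L_E _ _ Ey) => // s ->.
exists (E [set t] x); split=> //.
by apply: (spectral_eigen mid L_E _ domL dy Ey) => // s ->.
Qed.

(** If no cut were possible, every threshold would leave one side of [B] null. With [c] the supremum
    of the thresholds whose left side is null, all the mass of [B] would sit at [c], which is not an
    atom. *)
Lemma atomless_split (E' : spectral_measure H) x (B : set (measurableTypeR R)) (a b : R) :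
  measurable B -> B `<=` `[a, b] -> (forall t, B t -> E' [set t] x = 0) ->
  E' B x != 0 -> exists B1, [/\ measurable B1, B1 `<=` B,
    E' B1 x != 0 & E' (B `\` B1) x != 0].
Proof.
move=> mB Bab Bat B0; apply: contrapT => nosplit.
pose mu := smeas_at E' x.
have mlow t : measurable (B `&` `]-oo, t]) by exact: measurableI.
have mup t : measurable (B `&` `]t, +oo[) by exact: measurableI.
have nul A : measurable A -> E' A x = 0 -> mu.-negligible A.
  move=> mA A0; exists A; split=> //.
  by rewrite /mu /= /smeas_at A0 hnorm0 expr0n.
have dich t : E' (B `&` `]-oo, t]) x = 0 \/ E' (B `&` `]t, +oo[) x = 0.
  apply: contrapT => /not_orP[/eqP l0 /eqP u0]; apply: nosplit.
  exists (B `&` `]-oo, t]); split=> //.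
  have -> // : B `\` (B `&` `]-oo, t]) = B `&` `]t, +oo[.
  apply/seteqP; split=> s /=; rewrite !in_itv/= andbT.
    by move=> [Bs nBs]; split=> //; rewrite ltNge; apply/negP => st; exact: nBs.
  by move=> [Bs ts]; split=> // -[_]; rewrite leNgt ts.
pose S : set R := [set t | E' (B `&` `]-oo, t]) x = 0].
have Sa : S (a - 1).
  rewrite /S/= (_ : _ `&` _ = set0) ?smeas_set0//.
  apply/seteqP; split=> s //= [/Bab/=]; rewrite !in_itv/= => /andP[sa _] sa1.
  by have := le_trans sa sa1; rewrite leNgt ltrBlDr ltrDl ltr01.
have Sub t : S t -> t <= b.
  move=> St; rewrite leNgt; apply/negP => bt; move/eqP : B0; apply.
  rewrite -[RHS]St; congr (E' _ x); apply/seteqP; split=> [s Bs|s []//].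
  split=> //=; rewrite in_itv/=; have /= := Bab _ Bs.
  by rewrite in_itv/= => /andP[_ sb]; rewrite (le_trans sb)// ltW.
have hS : has_sup S by split; [exists (a - 1)|exists b => t /Sub].
pose c := sup S.
have low n : mu.-negligible (B `&` `]-oo, c - n.+1%:R^-1]).
  have n0 : 0 < n.+1%:R^-1 :> R by rewrite invr_gt0.
  have [s Ss cs] := sup_adherent n0 hS.
  apply: (@negligibleS _ _ _ mu (B `&` `]-oo, s])); last exact: nul.
  move=> t /= [Bt]; rewrite !in_itv/= => tc; split=> //.
  by rewrite (le_trans tc)// ltW.
have up n : mu.-negligible (B `&` `]c + n.+1%:R^-1, +oo[).
  have n0 : 0 < n.+1%:R^-1 :> R by rewrite invr_gt0.
  apply: nul => //; have [Sc|//] := dich (c + n.+1%:R^-1).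
  have := @ub_le_sup _ S (proj2 hS) _ Sc; rewrite -/c.
  by rewrite leNgt ltrDl n0.
have mid_ : mu.-negligible (B `&` [set c]).
  have [Bc|nBc] := pselect (B c).
    apply: (@negligibleS _ _ _ mu [set c]); first by move=> t [].
    by apply: nul => //; exact: Bat.
  rewrite (_ : _ `&` _ = set0); first exact: negligible_set0.
  by apply/seteqP; split=> t //= [Bt tc]; apply: nBc; rewrite -tc.
have nB : mu.-negligible B.
  apply: (@negligibleS _ _ _ mu (((\bigcup_n (B `&` `]-oo, c - n.+1%:R^-1])) `|`
     (\bigcup_n (B `&` `]c + n.+1%:R^-1, +oo[))) `|` (B `&` [set c]))); last first.
    apply: negligibleU => //; apply: negligibleU; exact: negligible_bigcup.
  have arch (r : R) : 0 < r -> exists n, n.+1%:R^-1 < r.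
    move=> r0; have /cvgrPdist_lt/(_ _ r0)[N _ hN] := @cvg_harmonic R.
    by exists N; have := hN N (leqnn _); rewrite /= sub0r normrN ger0_norm ?invr_ge0.
  move=> t Bt; have [tc|tc|tc] := ltgtP t c; last by right; split.
    left; left; have [n hn] := arch (c - t) ltac:(by rewrite subr_gt0).
    by exists n => //; split=> //=; rewrite in_itv/= lerBrDl -lerBrDr ltW.
  left; right; have [n hn] := arch (t - c) ltac:(by rewrite subr_gt0).
  by exists n => //; split=> //=; rewrite in_itv/= andbT -ltrBrDl.
move/eqP : B0; apply; apply: smeas_at_null.
exact: (measure_negligible mB nB).
Qed.

(** Split off one piece and repeat on the remainder, which still carries mass and has no atoms. *)
Lemma atomless_pieces x (a b : R) k (B : set (measurableTypeR R)) :
  measurable B -> B `<=` `[a, b] -> (forall t, B t -> E [set t] x = 0) ->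
  E B x != 0 -> exists G : nat -> set (measurableTypeR R),
    forall i, (i < k)%N -> [/\ measurable (G i), G i `<=` B, E (G i) x != 0 &
      forall j, (j < k)%N -> i != j -> G i `&` G j = set0].
Proof.
elim: k B => [|k IHk] B mB Bab Bat B0; first by exists (fun=> set0).
have [B1 [mB1 B1B B10 B20]] := atomless_split mB Bab Bat B0.
have [|||G GP] := IHk (B `\` B1) _ _ _ B20; first exact: measurableD.
- by move=> t [/Bab].
- by move=> t [/Bat].
exists (fun i => if i is i'.+1 then G i' else B1) => -[_|i ik].
  split=> // -[//|j jk _]; have [_ GB _ _] := GP _ jk.
  by apply/seteqP; split=> t //= [B1t /GB[_]].
have [mG GB G0 Gd] := GP _ ik; split=> //; first by move=> t /GB[].
move=> [_ _|j jk ij]; last exact: Gd.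
by apply/seteqP; split=> t //= [/GB[_]].
Qed.

(* Otherwise the atomless measure of x on this set could be cut into arbitrarily
   many pieces, giving arbitrarily large orthonormal families in the range of
   E ]0, C]. *)
Lemma continuous_part_bounded (C : R) x : 0 < C ->
  E (`]0, C] `\` range lam) x = 0.
Proof.
move=> C0; apply/eqP/negPn/negP => B0.
have mB : measurable (`]0, C] `\` range lam : set (measurableTypeR R)).
  by apply: measurableD => //; exact: measurable_range_lam.
have [k hk] := bounded_range_finite C0.
have Bab : `]0, C] `\` range lam `<=` `[0, C].
  by move=> t [/=]; rewrite !in_itv/= => /andP[/ltW -> ->].
have Bat t : (`]0, C] `\` range lam) t -> E [set t] x = 0.
  move=> [/=]; rewrite in_itv/= => /andP[t0 _] nt; apply/eqP/negPn/negP => Et.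
  by apply: nt; exact: atom_eigenvalue Et.
have [G GP] := atomless_pieces k.+1 mB Bab Bat B0.
have aP (i : 'I_k.+1) : exists a : R[i], '[a *: E (G i) x, a *: E (G i) x] = 1.
  have [_ _ G0 _] := GP _ (ltn_ord i).
  by have [a _ a1] := orthonormal_normalize G0; exists a.
pose a i := projT1 (cid (aP i)).
have [|F [oF sF] FG] := @orthonormal_fun_seq k.+1 (fun i => a i *: E (G i) x).
  move=> i j; have [mi _ _ Gd] := GP _ (ltn_ord i).
  have [mj _ _ _] := GP _ (ltn_ord j).
  have [->|ij] := eqVneq i j; first exact: (projT2 (cid (aP j))).
  rewrite innerZl innerZr (smeas_sym E)// smeas_disj ?inner0r ?mulr0//.
  by apply: Gd.
have := hk F oF; rewrite sF ltnn => h; suff : false by []; apply: h => e /FG[i ->].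
have [mi GB _ _] := GP _ (ltn_ord i).
rewrite smeasZ// (smeas_sub (A := G i))// ?smeas_idem//.
by move=> t /GB[].
Qed.

Lemma continuous_part x : E (`]0, +oo[ `\` range lam) x = 0.
Proof.
have mr := measurable_range_lam.
apply: smeas_at_null; apply: measure_negligible.
  by apply: measurableD => //; exact: measurable_itv.
apply: (@negligibleS _ _ _ _
  (\bigcup_n ((`]0, n.+1%:R] `\` range lam) : set (measurableTypeR R)))); last first.
  apply: negligible_bigcup => n; exists (`]0, n.+1%:R] `\` range lam); split=> //.
    by apply: measurableD => //; exact: measurable_itv.
  by rewrite /= /smeas_at continuous_part_bounded// hnorm0 expr0n.
move=> t [/=]; rewrite in_itv/= andbT => t0 nt.
exists (Num.truncn t) => //; split=> //=; rewrite in_itv/= t0/=.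
by rewrite ltW// truncnS_gt.
Qed.

(** A family of maximal size exists because the eigenspace lies in the range of [E ]0, lam j]].
    Maximality makes it total in the eigenspace, so the projection is its Fourier sum; the last
    clause later bounds singular multiplicities from above. *)
Lemma eigenspace_basis j : exists F : seq H,
  [/\ orthonormal_seq F, (0 < size F)%N,
      forall e, e \in F -> E [set lam j] e = e,
      forall x, E [set lam j] x = proj_seq F x &
      forall G, orthonormal_seq G -> (forall e, e \in G -> E [set lam j] e = e) ->
        (size G <= size F)%N].
Proof.
have [k hk] := bounded_range_finite (lam_gt0 j).
pose P n := `[< exists F : seq H, [/\ orthonormal_seq F, size F = n &
  forall e, e \in F -> E [set lam j] e = e] >].
have bP n : P n -> (n <= k)%N.
  move=> /asboolP[F [oF <- FE]]; apply: hk => // e /FE.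
  apply: smeas_sub => // t ->/=; rewrite in_itv/= lexx andbT; exact: lam_gt0.
have exP : exists n, P n by exists 0%N; apply/asboolP; exists [::].
case: (ex_maxnP exP bP) => n /asboolP[F [oF sF FE]] nmax.
have extend z : E [set lam j] z = z -> (forall e, e \in F -> '[z, e] = 0) -> z = 0.
  move=> Ez zF; apply/eqP/negPn/negP => z0.
  have [a a0 a1] := orthonormal_normalize z0.
  have azF e : e \in F -> '[a *: z, e] = 0 by move=> eF; rewrite innerZl zF// mulr0.
  have Faz e : e \in F -> '[e, a *: z] = 0 by move=> eF; rewrite innerC azF// conjc0.
  have naz : a *: z \notin F.
    by apply/negP => /azF; rewrite a1 => /eqP; rewrite oner_eq0.
  have := nmax (size (a *: z :: F)); rewrite /= sF ltnn => h.
  suff : false by []; apply: h; apply/asboolP; exists (a *: z :: F); split.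
  - have [uF oF'] := oF; split; first by rewrite /= naz.
    move=> e f; rewrite !inE => /orP[/eqP->|eF] /orP[/eqP->|fF].
    + by rewrite a1 eqxx.
    + by rewrite azF//; case: eqP naz => // ->; rewrite fF.
    + by rewrite Faz//; case: eqP naz => // <-; rewrite eF.
    + exact: oF'.
  - by rewrite /= sF.
  - by move=> e; rewrite inE => /orP[/eqP->|/FE//]; rewrite smeasZ// Ez.
have proj x : E [set lam j] x = proj_seq F x.
  apply/eqP; rewrite -subr_eq0; apply/eqP; apply: extend.
    rewrite smeasB// smeas_idem//; congr (_ - _).
    rewrite /proj_seq big_seq; elim/big_ind : _ => //; first exact: smeas0.
      by move=> u w Eu Ew; rewrite smeasD// Eu Ew.
    by move=> e eF; rewrite smeasZ// FE.
  by move=> e eF; rewrite innerBl proj_seq_inner// (smeas_sym E)// FE// subrr.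
exists F; split=> //.
  rewrite lt0n; apply/negP => /eqP/size0nil F0.
  have [_ [x [dx x0 Lx]]] := lam_eigenvalue j.
  have Ex := spectral_eigenspace L_E dx Lx.
  by move/eqP : x0; apply; rewrite -Ex proj F0 /proj_seq big_nil.
move=> G oG GE; rewrite sF; apply: nmax; apply/asboolP; by exists G.
Qed.

(** Otherwise unit eigenvectors for [k.+1] distinct eigenvalues would form an orthonormal family too
    large for the range of [E ]0, C]]. *)
Lemma lam_unbounded (C : R) : exists j, C < lam j.
Proof.
apply: contrapT => /forallNP nC.
have lamC j : lam j <= C by rewrite leNgt; apply/negP/nC.
have C0 : 0 < C by rewrite (lt_le_trans (lam_gt0 0) (lamC 0%N)).
have [k hk] := bounded_range_finite C0.
have eP (i : 'I_k.+1) : exists e, E [set lam i] e = e /\ '[e, e] = 1.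
  have [F [[_ oF] sF FE _ _]] := eigenspace_basis i.
  have eF : F`_0 \in F by rewrite mem_nth.
  by exists F`_0; split; [exact: FE|rewrite oF// eqxx].
pose e i := projT1 (cid (eP i)).
have eE (i : 'I_k.+1) : E [set lam i] (e i) = e i /\ '[e i, e i] = 1 by exact: projT2 (cid (eP i)).
have [|F [oF sF] FG] := @orthonormal_fun_seq k.+1 e.
  move=> i j; have [Ei e1] := eE i; have [Ej _] := eE j.
  have [<-//|ij] := eqVneq i j.
  rewrite -Ei -Ej (smeas_sym E)// smeas_disj ?inner0r//.
  apply/seteqP; split=> t //= [-> lij]; move: ij; rewrite neq_ltn.
  by case/orP => /lam_incr; rewrite lij ltxx.
have := hk F oF; rewrite sF ltnn => h; suff : false by []; apply: h => f /FG[i ->].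
have [Ei _] := eE i; apply: smeas_sub Ei => // t ->/=.
by rewrite in_itv/= lam_gt0 lamC.
Qed.

End eigenvalues.
End resolvent.
End compactness.

(** * Diagonal operators *)

Section diagonal_operators.
Context {R : realType} {H : hilbertType R}.
Implicit Types (x y z w : H).

(* The operator acting as d j on the range of E {nu j}, and as 0 on the
   orthogonal complement of these ranges. *)
Definition diagonal_op (E : spectral_measure H) (nu d : nat -> R) (T : H -> H) :=
  forall x, (forall j, E [set nu j] (T x) = (d j)%:C%C *: E [set nu j] x) /\
    E (range nu) (T x) = T x.

Lemma measurable_range (nu : nat -> R) :
  measurable (range nu : set (measurableTypeR R)).
Proof.
have -> : range nu = \bigcup_j [set nu j].
  by apply/seteqP; split=> [_ [j _ <-]|_ [j _ ->]]; exists j.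
exact: bigcupT_measurable.
Qed.

Section frame.
Variables (E : spectral_measure H) (nu : nat -> R).
Hypothesis nu_inj : injective nu.
Local Notation P j := (E [set nu j]).
Local Notation Q := (E (range nu)).
Let mP (j : nat) : measurable ([set nu j] : set (measurableTypeR R)).
Proof. exact: measurable_set1. Qed.
Let mQ : measurable (range nu : set (measurableTypeR R)).
Proof. exact: measurable_range. Qed.

Lemma frame_idem j x : P j (P j x) = P j x.
Proof. exact: smeas_idem. Qed.

Lemma frame_orth j k x : j != k -> P j (P k x) = 0.
Proof.
move=> jk; apply: smeas_disj => //.
by apply/seteqP; split=> t //= [-> /nu_inj /eqP]; rewrite (negbTE jk).
Qed.

Lemma frame_rangeK j x : P j (Q x) = P j x.
Proof. by rewrite -smeas_setI// (setIidPl _ _).2// => _ ->; exists j. Qed.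

Lemma frame_range j x : Q (P j x) = P j x.
Proof. by apply: smeas_sub (frame_idem j x) => // _ ->; exists j. Qed.

Lemma frame_sum_proj k a b (c : nat -> R) y :
  P k (\sum_(a <= j < b) (c j)%:C%C *: P j y) =
  if (a <= k < b)%N then (c k)%:C%C *: P k y else 0.
Proof.
elim: b => [|b IHb].
  by rewrite big_geq// smeas0// ltn0 andbF.
have [ab|ba] := leqP a b; last first.
  rewrite big_geq// smeas0//; case: ifP => // /andP[ak kb].
  by have := leq_trans (leq_ltn_trans ak kb) ba; rewrite ltnn.
rewrite big_nat_recr//= smeasD// IHb smeasZ//.
have [->|kb] := eqVneq k b.
  by rewrite ltnn andbF add0r frame_idem ab ltnSn.
by rewrite frame_orth// scaler0 addr0 (ltnS k b) (leq_eqVlt k) (negbTE kb).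
Qed.

Lemma frame_sum_norm a b (c : nat -> R) y :
  hnorm (\sum_(a <= j < b) (c j)%:C%C *: P j y) ^+ 2 =
  \sum_(a <= j < b) c j ^+ 2 * hnorm (P j y) ^+ 2.
Proof.
elim: b => [|b IHb]; first by rewrite !big_geq// hnorm0 expr0n.
have [ab|ba] := leqP a b; last by rewrite !big_geq// hnorm0 expr0n.
rewrite !big_nat_recr//= hnorm2D ?IHb.
  by rewrite hnorm_scaler exprMn real_normK ?num_real.
by rewrite innerZr -(smeas_sym E)// frame_sum_proj ltnn andbF inner0l mulr0.
Qed.

Lemma frame_sumE (c : nat -> R) a b y : (forall j, c j = 1) ->
  \sum_(a <= j < b) (c j)%:C%C *: P j y = \sum_(a <= j < b) P j y.
Proof. by move=> c1; apply: eq_bigr => j _; rewrite c1 scale1r. Qed.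

Lemma frame_norm_cvg y :
  (fun n => \sum_(0 <= j < n) hnorm (P j y) ^+ 2) @ \oo --> hnorm (Q y) ^+ 2.
Proof.
have mU : measurable (\bigcup_j [set nu j] : set (measurableTypeR R)).
  exact: bigcupT_measurable.
have tr : trivIset setT (fun j => [set nu j] : set (measurableTypeR R)).
  by move=> i j _ _ [t [/= -> /nu_inj]].
have := @smeas_sigma_additive _ _ E y _ mP tr mU.
have -> : \bigcup_j [set nu j] = range nu.
  by apply/seteqP; split=> [_ [j _ ->]|_ [j _ <-]]; exists j.
move/fine_cvgP => [_]; apply: cvg_trans.
rewrite (_ : fine \o _ = (fun n => \sum_(0 <= j < n) hnorm (P j y) ^+ 2))//.
by apply/funext => n /=; rewrite sumEFin.
Qed.

(** By Pythagoras the squared error is the tail of the convergent series of [frame_norm_cvg]. *)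
Lemma frame_cvg y :
  (fun n => hnorm (Q y - \sum_(0 <= j < n) P j y)) @ \oo --> (0 : R).
Proof.
have e n : hnorm (Q y - \sum_(0 <= j < n) P j y) =
    Num.sqrt (hnorm (Q y) ^+ 2 - \sum_(0 <= j < n) hnorm (P j y) ^+ 2).
  set S := \sum_(0 <= j < n) P j y.
  have SE : S = \sum_(0 <= j < n) (cst (1 : R) j)%:C%C *: P j y.
    by rewrite frame_sumE.
  have Sn : hnorm S ^+ 2 = \sum_(0 <= j < n) hnorm (P j y) ^+ 2.
    by rewrite SE frame_sum_norm; apply: eq_bigr => j _; rewrite expr1n mul1r.
  have o : '[Q y - S, S] = 0.
    rewrite innerC {1}/S inner_suml big_nat big1 ?conjc0// => j /andP[_ jn].
    rewrite -(frame_idem j) (smeas_sym E)// smeasB// frame_rangeK SE.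
    by rewrite frame_sum_proj /= jn scale1r subrr inner0r.
  have := hnorm2D o; rewrite subrK => ->; rewrite -Sn addrK sqrtr_sqr.
  by rewrite ger0_norm ?hnorm_ge0.
rewrite (_ : (fun n => _) = (fun n => Num.sqrt (hnorm (Q y) ^+ 2 -
   \sum_(0 <= j < n) hnorm (P j y) ^+ 2))); last exact/funext.
rewrite -[X in _ --> X](@sqrtr0 R).
apply: continuous_cvg; first exact: sqrt_continuous.
have := cvgB (cvg_cst (hnorm (Q y) ^+ 2)) (@frame_norm_cvg y).
by rewrite subrr; apply.
Qed.

Lemma frame_eq0 y : Q y = y -> (forall j, P j y = 0) -> y = 0.
Proof.
move=> Qy Py; apply/eqP; rewrite -hnorm_eq0 -sqrf_eq0; apply/eqP.
have := @frame_norm_cvg y; rewrite Qy => h; apply: (cvg_unique _ h) => //.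
rewrite (_ : (fun n => _) = cst 0); first exact: cvg_cst.
apply/funext => n; rewrite big1// => j _.
by rewrite Py hnorm0 expr0n.
Qed.

(** Reduces identities between vectors carried by the atoms to their components. *)
Lemma frame_inj y z : Q y = y -> Q z = z -> (forall j, P j y = P j z) -> y = z.
Proof.
move=> Qy Qz yz; apply/eqP; rewrite -subr_eq0; apply/eqP; apply: frame_eq0.
  by rewrite smeasB// Qy Qz.
by move=> j; rewrite smeasB// yz subrr.
Qed.

Lemma frame_norm_le y x (c : R) : 0 <= c -> Q y = y ->
  (forall j, hnorm (P j y) <= c * hnorm (P j x)) -> hnorm y <= c * hnorm x.
Proof.
move=> c0 Qy le; rewrite -(@ler_pXn2r _ 2)// ?nnegrE ?mulr_ge0 ?hnorm_ge0//.
rewrite exprMn.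
apply: (@le_trans _ _ (c ^+ 2 * hnorm (Q x) ^+ 2)); last first.
  rewrite ler_wpM2l ?sqr_ge0// ler_pXn2r// ?nnegrE ?hnorm_ge0//.
  exact: smeas_contract.
rewrite -[in leLHS]Qy.
apply: (ler_cvg_to (@frame_norm_cvg y) (cvgMl_tmp (a := c ^+ 2) (@frame_norm_cvg x))).
near=> n; rewrite mulr_sumr; apply: ler_sum => j _.
by rewrite -exprMn ler_pXn2r// nnegrE ?mulr_ge0 ?hnorm_ge0.
Unshelve. all: by end_near. Qed.

Lemma frame_form_cvg y z : Q y = y ->
  (fun n => \sum_(0 <= j < n) complex.Re '[P j y, z]) @ \oo --> complex.Re '[y, z].
Proof.
move=> Qy; apply/cvgrPdist_le => e e0.
have d0 : 0 < e / (hnorm z + 1) by rewrite divr_gt0// ltr_wpDl ?hnorm_ge0.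
have /cvgrPdist_le/(_ _ d0)[N _ hN] := @frame_cvg y.
exists N => // n /hN /=; rewrite sub0r normrN ger0_norm ?hnorm_ge0// Qy => le.
rewrite -(raddf_sum (@complex.Re R : Rcomplex R -> R)) -inner_suml -raddfB -innerBl.
apply: (le_trans (Re_inner_le _ _)).
apply: (@le_trans _ _ (e / (hnorm z + 1) * (hnorm z + 1))).
  by rewrite ler_pM ?hnorm_ge0// lerDl.
by rewrite divfK// gt_eqF// ltr_wpDl ?hnorm_ge0.
Qed.

Section diagonal.
Variables (d : nat -> R) (T : H -> H).
Hypothesis dT : diagonal_op E nu d T.

Lemma diagonal_proj j x : P j (T x) = (d j)%:C%C *: P j x.
Proof. by have [] := dT x. Qed.

Lemma diagonal_range x : Q (T x) = T x.
Proof. by have [] := dT x. Qed.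

(** All components of [T x] are prescribed linearly in [x], so linearity need not be part of
    [diagonal_op]. *)
Lemma diagonal_linear : linear T.
Proof.
move=> a x y; apply: frame_inj; first exact: diagonal_range.
  by rewrite smeasP// !diagonal_range.
move=> j; rewrite smeasP// !diagonal_proj smeasP// scalerDr !scalerA.
by rewrite mulrC.
Qed.

Lemma diagonal_eigen j x : T (P j x) = (d j)%:C%C *: P j x.
Proof.
apply: frame_inj; first exact: diagonal_range.
  by rewrite smeasZ// frame_range.
move=> k; rewrite diagonal_proj smeasZ//.
by have [->//|kj] := eqVneq k j; rewrite frame_orth// !scaler0.
Qed.

Lemma diagonal_kernel x : (forall j, P j x = 0) -> T x = 0.
Proof.
move=> Px; apply: frame_eq0; first exact: diagonal_range.
by move=> j; rewrite diagonal_proj Px scaler0.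
Qed.

Lemma diagonalZ a x : T (a *: x) = a *: T x.
Proof.
have T0 : T 0 = 0 by apply: diagonal_kernel => j; rewrite smeas0.
by have := diagonal_linear a x 0; rewrite T0 !addr0.
Qed.

Lemma diagonal_form_cvg x y :
  (fun n => \sum_(0 <= j < n) d j * complex.Re '[P j x, P j y]) @ \oo -->
  complex.Re '[T x, y].
Proof.
have := frame_form_cvg (z := y) (diagonal_range x); apply: cvg_trans.
rewrite (_ : (fun n => _) = (fun n => \sum_(0 <= j < n) complex.Re '[P j (T x), y]))//.
apply/funext => n; apply: eq_bigr => j _.
rewrite diagonal_proj innerZl -(smeas_sym E)// frame_idem.
by case: '[P j x, y] => u v /=; rewrite mul0r subr0.
Qed.

Lemma diagonal_sym_Re x y : complex.Re '[T x, y] = complex.Re '[x, T y].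
Proof.
rewrite [in RHS]innerC.
have -> : forall c : R[i], complex.Re (conjc c) = complex.Re c by case.
apply: (cvg_unique _ (@diagonal_form_cvg x y)) => //.
have := @diagonal_form_cvg y x; apply: cvg_trans.
rewrite (_ : (fun n => _) = (fun n => \sum_(0 <= j < n) d j * complex.Re '[P j y, P j x]))//.
apply/funext => n; apply: eq_bigr => j _; rewrite innerC.
by case: '[_, _].
Qed.

Lemma diagonal_sym x y : '[T x, y] = '[x, T y].
Proof.
apply/eqP; rewrite eq_complex; apply/andP; split; apply/eqP.
  exact: diagonal_sym_Re.
rewrite !Im_innerE diagonal_sym_Re; congr (complex.Re '[_, _]).
by rewrite diagonalZ.
Qed.

Lemma diagonal_form_real x : '[T x, x] = (complex.Re '[T x, x])%:C%C.
Proof.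
have := innerC (T x) x; rewrite -diagonal_sym.
case: '[T x, x] => u v /= [] /eqP; rewrite -subr_eq0 opprK -mulr2n.
by rewrite mulrn_eq0 /= => /eqP ->.
Qed.

End diagonal.

(** With bounded coefficients the partial sums are Cauchy, since the squared norms of the components
    are summable. *)
Lemma diagonal_exists d (C : R) : (forall j, `|d j| <= C) ->
  exists T, diagonal_op E nu d T.
Proof.
move=> dC; have C0 : 0 <= C by exact: le_trans (dC 0%N).
pose s x n := \sum_(0 <= j < n) (d j)%:C%C *: P j x.
have sumC x (e : R) : 0 < e -> exists N, forall n m, (N <= n)%N -> (n <= m)%N ->
    hnorm (s x m - s x n) < e.
  move=> e0; have C20 : 0 < C ^+ 2 + 1 by rewrite ltr_wpDl ?sqr_ge0.
  (* The [+ 1] keeps the denominator positive when [C = 0]. *)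
  pose de := e ^+ 2 / (C ^+ 2 + 1).
  have de0 : 0 < de / 2 by rewrite !divr_gt0 ?exprn_gt0.
  have /cvgrPdist_lt/(_ _ de0)[N _ hN] := @frame_norm_cvg x.
  exists N => n m Nn nm.
  have le : \sum_(n <= j < m) hnorm (P j x) ^+ 2 < de.
    have := hN _ (leq_trans Nn nm); have := hN _ Nn.
    rewrite /= (big_cat_nat (leq0n n) nm)/=.
    by move=> /ltr_normlP[h1 h2] /ltr_normlP[h3 h4]; move: h1 h2 h3 h4; lra.
  have -> : s x m - s x n = \sum_(n <= j < m) (d j)%:C%C *: P j x.
    by apply/eqP; rewrite subr_eq addrC /s (big_cat_nat (leq0n n) nm).
  rewrite -(@ltr_pXn2r _ 2)// ?nnegrE ?hnorm_ge0 ?(ltW e0)// frame_sum_norm.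
  apply: (@le_lt_trans _ _ ((C ^+ 2 + 1) * \sum_(n <= j < m) hnorm (P j x) ^+ 2)).
    rewrite mulr_sumr; apply: ler_sum => j _; rewrite ler_wpM2r ?sqr_ge0//.
    rewrite ler_wpDr// -[leLHS]real_normK ?num_real// ler_pXn2r// nnegrE//.
  by rewrite mulrC -ltr_pdivlMr.
have Tex x : exists l, (fun n => hnorm (s x n - l)) @ \oo --> (0 : R).
  apply: hcauchy_cvg => e e0; have [N hN] := sumC x e e0.
  exists N => n m Nn Nm; have [nm|mn] := leqP n m.
    by rewrite hnorm_sub hN.
  by rewrite hN// ltnW.
pose T x := projT1 (cid (Tex x)).
have TE x : (fun n => hnorm (s x n - T x)) @ \oo --> (0 : R) by exact: projT2 (cid (Tex x)).
(* [E A] is a contraction, so a value it takes on all late partial sums is also its value at the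
   limit. *)
have lim0 x y (A : set (measurableTypeR R)) : measurable A ->
    (\forall n \near \oo, E A (s x n) = y) -> E A (T x) = y.
  move=> mA near; apply/eqP; rewrite -subr_eq0 -hnorm_eq0 eq_le hnorm_ge0 andbT.
  apply/ler_addgt0Pr => e e0; rewrite add0r.
  have /cvgrPdist_lt/(_ _ e0) h := TE x.
  have [n [/= h1 <-]] := filter_ex (filterI h near).
  rewrite -smeasB//. apply: (le_trans (smeas_contract E mA _)).
  by rewrite hnorm_sub; move: h1; rewrite sub0r normrN ger0_norm ?hnorm_ge0// => /ltW.
exists T => x; split=> [j|].
  apply: lim0 => //; exists j.+1 => // n /= jn.
  by rewrite /s frame_sum_proj /= jn.
apply/eqP; rewrite -subr_eq0 -hnorm_eq0 eq_le hnorm_ge0 andbT.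
apply/ler_addgt0Pr => e e0; rewrite add0r.
have e20 : 0 < e / 2 by rewrite divr_gt0.
have /cvgrPdist_lt/(_ _ e20)[N _ /(_ N (leqnn _))] := TE x.
rewrite /= sub0r normrN ger0_norm ?hnorm_ge0// => hN.
have Qs : Q (s x N) = s x N.
  rewrite /s; elim/big_ind : _ => [|u v Qu Qv|j _]; first exact: smeas0.
    by rewrite smeasD// Qu Qv.
  by rewrite smeasZ// frame_range.
have -> : Q (T x) - T x = Q (T x - s x N) + (s x N - T x).
  by rewrite smeasB// Qs addrA subrK.
apply: (le_trans (hnorm_triangle _ _)).
have := smeas_contract E mQ (T x - s x N); rewrite (hnorm_sub (T x)).
by move: hN; move: (hnorm (s x N - T x)) (hnorm (Q _)) => u v; lra.
Qed.

End frame.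
End diagonal_operators.

(** * Diagonal operators as spectral integrals *)

Section diagonal_spectral.
Context {R : realType} {H : hilbertType R}.
Implicit Types (x y z w : H) (E : spectral_measure H).

(** Complex polarization: reality of the form at [x + y] and at ['i x + y] forces [<Ty,x>] to be the
    conjugate of [<Tx,y>]. *)
Lemma real_form_sym (T : H -> H) : linear T ->
  (forall x, '[T x, x] = (complex.Re '[T x, x])%:C%C) ->
  forall x y, '[T x, y] = '[x, T y].
Proof.
move=> lT rT x y.
have im x' : complex.Im '[T x', x'] = 0 by rewrite rT.
have T0 : T 0 = 0.
  by have := lT (-1) 0 0; rewrite scaler0 addr0 scaleN1r addNr.
have TZ a u : T (a *: u) = a *: T u by have := lT a u 0; rewrite T0 !addr0.
have TD u v : T (u + v) = T u + T v by have := lT 1 u v; rewrite !scale1r.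
have alg (p q u w : R[i]) : complex.Im p = 0 -> complex.Im q = 0 ->
    complex.Im (p + u + (w + q)) = 0 ->
    complex.Im ('i%C * (conjc 'i%C * p) + 'i%C * u + (conjc 'i%C * w + q)) = 0 ->
    w = conjc u.
  case: p q u w => [p p'] [q q'] [u u'] [w w'] /= -> -> h1 h2.
  by apply/eqP; rewrite eq_complex /=; apply/andP; split; apply/eqP; lra.
rewrite [RHS]innerC; rewrite -[LHS]conjcK; congr conjc; apply/esym.
apply: (alg _ _ _ _ (im x) (im y)).
  by rewrite -(im (x + y)) TD !(innerDl, innerDr).
by have := im ('i%C *: x + y); rewrite TD TZ !(innerDl, innerDr) !innerZl !innerZr.
Qed.

Section frame.
Variables (E : spectral_measure H) (nu : nat -> R).
Hypothesis nu_inj : injective nu.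
Local Notation P j := (E [set nu j]).
Local Notation Q := (E (range nu)).
Let mP (j : nat) : measurable ([set nu j] : set (measurableTypeR R)).
Proof. exact: measurable_set1. Qed.
Let mQ : measurable (range nu : set (measurableTypeR R)).
Proof. exact: measurable_range. Qed.

(** Symmetry moves the projections across the inner product: [<Q T x, y> = <x, T Q y> = <x, T y>],
    because [T] kills [y - Q y]. The eigenvector equations give the components in the same way. *)
Lemma diagonal_of_eigen (d : nat -> R) (T : H -> H) : linear T ->
  (forall x, '[T x, x] = (complex.Re '[T x, x])%:C%C) ->
  (forall j x, T (P j x) = (d j)%:C%C *: P j x) ->
  (forall x, Q x = 0 -> T x = 0) -> diagonal_op E nu d T.
Proof.
move=> lT rT TP T0; have sT := real_form_sym lT rT => x; split=> [j|].
  apply: inner_inj => y; rewrite (smeas_sym E)// sT TP innerZr conjc_real.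
  by rewrite innerZl (smeas_sym E).
apply: inner_inj => y; rewrite (smeas_sym E)// !sT; congr '[_, _].
have := lT (-1) y (Q y); rewrite !scaleN1r => h.
have : T (- y + Q y) = 0.
  by apply: T0; rewrite addrC smeasB// smeas_idem// subrr.
by rewrite h addrC => /subr0_eq.
Qed.

Section function.
Variables (f : R -> R) (d : nat -> R).
Hypotheses (mf : measurable_fun setT f) (fd : forall j, f (nu j) = d j).
Hypothesis f0 : forall x, E [set t | ~ range nu t /\ f t != 0] x = 0.
Let N : set (measurableTypeR R) := [set t | ~ range nu t /\ f t != 0].

Lemma measurable_neq0 (g : R -> R) : measurable_fun setT g ->
  measurable ([set t | g t != 0] : set (measurableTypeR R)).
Proof.
move=> mg; rewrite (_ : [set _ | _] = setT `&` g @^-1` (~` [set 0])).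
  by apply: mg => //; apply: measurableC; exact: measurable_set1.
by apply/seteqP; split=> t /= => [/eqP ?|[_] /eqP].
Qed.

Let mN : measurable N.
Proof.
rewrite (_ : N = ~` range nu `&` [set t | f t != 0])//.
by apply: measurableI; [exact: measurableC|exact: measurable_neq0].
Qed.

(** The uniqueness half: whichever operator [get] picks, its components are known. *)
Lemma spectral_integral_diagonal (T : H -> H) :
  spectral_integral E f (total_op T) -> diagonal_op E nu d T.
Proof.
move=> ET; have dT : dense (op_dom (total_op T)).
  by move=> O [x Ox] _; exists x.
have lT : linear T.
  by have [[_ lT] _ _] := ET; move=> a x y; have [] := lT a x y I I.
apply: diagonal_of_eigen => //.
- by move=> x; rewrite (spectral_form ET).
- move=> j x; apply: (spectral_eigen mf ET (mP j) dT) => //.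
    exact: smeas_idem.
  by move=> _ ->.
(* A vector without component on the atoms is carried by the zero set [Z] of [f], the rest of the
   support of [f] being null by [f0]; there [f] is the constant 0. *)
move=> x Qx; pose Z : set (measurableTypeR R) := ~` [set t | f t != 0].
have mZ : measurable Z by apply: measurableC; exact: measurable_neq0.
have Zx : E Z x = x.
  rewrite smeas_compl; last exact: measurable_neq0.
  rewrite -[RHS]subr0; congr (_ - _).
  have -> : [set t | f t != 0] = N `|` ([set t | f t != 0] `&` range nu).
    apply/seteqP; split=> t /=; last by move=> [[]|[]].
    by move=> ft; have [tr|ntr] := pselect (range nu t); [right|left].
  have mI : measurable ([set t | f t != 0] `&` range nu : set (measurableTypeR R)).
    by apply: measurableI => //; exact: measurable_neq0.
  rewrite smeasU//; last first.
    by apply/seteqP; split=> t //= [[nr _] [_ r]]; exact: nr.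
  by rewrite f0 add0r smeas_setI ?Qx ?smeas0//; exact: measurable_neq0.
rewrite -[RHS](scale0r x) -[0]/(0%:C%C).
by apply: (spectral_eigen mf ET mZ dT) => // t /=; move=> /negP; rewrite negbK => /eqP.
Qed.

Lemma integral_smeas_at_series (g : R -> R) x : measurable_fun setT g ->
  (forall j, 0 <= g (nu j)) -> (forall t, N t \/ range nu t \/ g t = 0) ->
  (\int[smeas_at E x]_t (g t)%:E =
   \sum_(0 <= j <oo) (g (nu j) * hnorm (P j x) ^+ 2)%:E)%E.
Proof.
move=> mg g0 gN.
have -> : (\int[smeas_at E x]_t (g t)%:E =
           \int[smeas_at E x]_(t in range nu) (g t)%:E)%E.
  rewrite [RHS]integral_mkcond; apply: ae_eq_integral => //.
  - exact/measurable_EFinP.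
  - apply/(measurable_restrictT _ mQ).
    by apply/measurable_EFinP; exact: measurable_funS mg.
  exists N; split=> //.
    by rewrite /= /smeas_at f0 hnorm0 expr0n.
  move=> t /=; apply: contra_notP => Nt _; rewrite patchE.
  case: ifPn => // /negP tr; have [//|[tr'|->//]] := gN t.
  by exfalso; apply: tr; rewrite inE.
have -> : range nu = \bigcup_j [set nu j].
  by apply/seteqP; split=> [_ [j _ <-]|_ [j _ ->]]; exists j.
rewrite ge0_integral_bigcup//; last 3 first.
- apply/measurable_EFinP; exact: measurable_funS mg.
- by move=> _ [j _ ->]; rewrite lee_fin.
- by move=> i j _ _ [t [/= -> /nu_inj]].
apply: eq_eseriesr => j _.
rewrite (@eq_integral _ _ _ _ _ (cst (g (nu j))%:E)); last by move=> _ /set_mem ->.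
by rewrite integral_cst.
Qed.

(** The existence half: integrals reduce to series over the atoms, and the bound [C] makes the
    domain the whole space. *)
Lemma diagonal_spectral_integral (T : H -> H) (C : R) :
  (forall j, 0 <= d j <= C) -> diagonal_op E nu d T ->
  spectral_integral E f (total_op T).
Proof.
move=> dC dT.
have off t : N t \/ range nu t \/ f t = 0.
  have [tr|ntr] := pselect (range nu t); first by right; left.
  by have [->|ft] := eqVneq (f t) 0; [right; right|left].
have f2 x : (\int[smeas_at E x]_t (f t ^+ 2)%:E < +oo)%E.
  rewrite integral_smeas_at_series; last 3 first.
  - exact: measurable_funX.
  - by move=> j; rewrite sqr_ge0.
  - by move=> t; have [|[|->]] := off t; [left|right; left|right; right; rewrite expr0n].
  apply: (@le_lt_trans _ _ (C ^+ 2 * hnorm (Q x) ^+ 2)%:E); last exact: ltry.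
  apply: lime_le.
    by apply: is_cvg_nneseries => j _ _; rewrite lee_fin mulr_ge0 ?sqr_ge0.
  near=> n; rewrite sumEFin lee_fin.
  apply: (@le_trans _ _ (C ^+ 2 * \sum_(0 <= j < n) hnorm (P j x) ^+ 2)).
    rewrite mulr_sumr; apply: ler_sum => j _; rewrite ler_wpM2r ?sqr_ge0// fd.
    have /andP[d0 dC'] := dC j; rewrite ler_pXn2r// nnegrE//.
    exact: le_trans dC'.
  rewrite ler_wpM2l ?sqr_ge0//.
  have cv := @frame_norm_cvg _ _ E _ nu_inj x.
  rewrite -(cvg_lim _ cv)//.
  apply: (@nondecreasing_cvgn_le _ (fun n => \sum_(0 <= j < n) hnorm (P j x) ^+ 2)).
    by apply/nondecreasing_seqP => k; rewrite big_nat_recr//= lerDl sqr_ge0.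
  by apply/cvg_ex; exists (hnorm (Q x) ^+ 2).
split.
- split=> // a x y _ _; split=> //; exact: (diagonal_linear nu_inj dT).
- by apply/seteqP; split=> x //= _; exact: f2.
move=> x _; rewrite (diagonal_form_real nu_inj dT); congr (_%:C%C).
rewrite /Rintegral integral_smeas_at_series//; last first.
  by move=> j; rewrite fd; have /andP[] := dC j.
have cv := @diagonal_form_cvg _ _ _ _ nu_inj _ _ dT x x.
rewrite (_ : (\sum_(_ <= _ <oo) _)%E = (complex.Re '[T x, x])%:E)//.
apply/cvg_lim => //.
rewrite (_ : (fun n => _) = (fun n => (\sum_(0 <= j < n) d j * complex.Re '[P j x, P j x])%:E)).
  by apply: cvg_EFin; [exact: nearW|exact: cv].
by apply/funext => n /=; rewrite sumEFin; congr EFin; apply: eq_bigr => j _; rewrite fd hnorm2.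
Unshelve. all: by end_near. Qed.

End function.
End frame.
End diagonal_spectral.

(** * Image of a spectral measure under a function *)

Section pushforward.
Context {R : realType} {H : hilbertType R}.
Variables (E : spectral_measure H) (f : R -> R).
Hypothesis mf : measurable_fun setT f.
Implicit Types (A B : set (measurableTypeR R)).

Let mpre A : measurable A -> measurable (f @^-1` A : set (measurableTypeR R)).
Proof. by move=> mA; rewrite -[_ @^-1` _]setTI; exact: mf. Qed.

Let push_sigma_additive x :
  semi_sigma_additive (fun A => (hnorm (E (f @^-1` A) x) ^+ 2)%:E).
Proof.
move=> F mF tF mU; rewrite preimage_bigcup.
apply: (@smeas_sigma_additive _ _ E x (fun i => f @^-1` F i)).
- by move=> i; exact: mpre.
- by move=> i j _ _ [t [Fi Fj]]; apply: tF => //; exists (f t).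
- by rewrite -preimage_bigcup; exact: mpre.
Qed.

(** If [E] is the spectral measure of [L], this is that of [f(L)]; it provides the witness required
    by [op_power]. The definition is transparent, so that [image_smeasE] holds by computation. *)
Definition image_smeas : spectral_measure H.
Proof.
refine (@SpectralMeasure _ _ (fun A => E (f @^-1` A)) _ _ _ _ _ _ push_sigma_additive).
- by move=> A mA; apply: smeas_linear; exact: mpre.
- by move=> A x mA; apply: smeas_idem; exact: mpre.
- by move=> A x y mA; apply: smeas_sym; exact: mpre.
- by move=> x; rewrite preimage_set0 smeas_set0.
- by move=> x; rewrite preimage_setT smeas_setT.
- by move=> A B x mA mB; rewrite preimage_setI smeas_setI//; exact: mpre.
Defined.

Lemma image_smeasE A x : image_smeas A x = E (f @^-1` A) x.
Proof. by []. Qed.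

End pushforward.

(** * Powers of a diagonal operator *)

Section powers.
Context {R : realType} {H : hilbertType R}.
Implicit Types (x y z w : H).
Variables (E : spectral_measure H) (nu d : nat -> R) (f : R -> R) (T : H -> H) (C : R).
Hypotheses (nu_inj : injective nu) (d_inj : injective d).
Hypotheses (dC : forall j, 0 < d j <= C).
Hypotheses (mf : measurable_fun setT f) (fd : forall j, f (nu j) = d j).
Hypothesis f0 : forall x, E [set t | ~ range nu t /\ f t != 0] x = 0.
Hypothesis dT : diagonal_op E nu d T.

Let N : set (measurableTypeR R) := [set t | ~ range nu t /\ f t != 0].

Let mN : measurable N.
Proof.
rewrite (_ : N = ~` range nu `&` [set t | f t != 0])//.
apply: measurableI; first by apply: measurableC; exact: measurable_range.
exact: measurable_neq0.
Qed.

Let E' := image_smeas E mf.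

Let smeas_ext (A B : set (measurableTypeR R)) x : measurable A -> measurable B ->
  A `<=` B -> B `\` A `<=` N -> E B x = E A x.
Proof.
move=> mA mB AB BN; have mD : measurable (B `\` A) by exact: measurableD.
rewrite -{1}(setDUK AB) smeasU//; last by rewrite setDIK.
by rewrite (smeas_sub0 mD mN BN) ?addr0// f0.
Qed.

(** As [d] is injective, the level set of [f] at [d j] meets [range nu] only in [nu j]; as [d j] is
    nonzero, the rest of it is null. *)
Let image_point j x : E' [set d j] x = E [set nu j] x.
Proof.
rewrite image_smeasE; apply: smeas_ext.
- exact: measurable_set1.
- by rewrite -[_ @^-1` _]setTI; apply: mf => //; exact: measurable_set1.
- by move=> _ ->; exact: fd.
move=> t [/= ft tj]; split; last by rewrite ft gt_eqF//; case/andP: (dC j).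
by move=> [k _ kt]; apply: tj; move: ft; rewrite -kt fd => /d_inj ->.
Qed.

Let image_range x : E' (range d) x = E (range nu) x.
Proof.
rewrite image_smeasE; apply: smeas_ext.
- exact: measurable_range.
- by rewrite -[_ @^-1` _]setTI; apply: mf => //; exact: measurable_range.
- by move=> _ [j _ <-] /=; rewrite fd; exists j.
by move=> t [/= [j _ dj] nt]; split=> //; rewrite -dj gt_eqF//; case/andP: (dC j).
Qed.

Let image_diagonal c S : diagonal_op E' d c S <-> diagonal_op E nu c S.
Proof.
split=> cS x; have [cSx rSx] := cS x; split.
- by move=> j; rewrite -!image_point.
- by rewrite -image_range.
- by move=> j; rewrite !image_point.
- by rewrite image_range.
Qed.

Let image_off (h : R -> R) x : h 0 = 0 -> measurable_fun setT h ->
  E' [set t | ~ range d t /\ h t != 0] x = 0.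
Proof.
move=> h0 mh; rewrite image_smeasE.
have mB : measurable (f @^-1` [set t | ~ range d t /\ h t != 0] : set (measurableTypeR R)).
  rewrite -[_ @^-1` _]setTI; apply: mf => //.
  rewrite (_ : [set _ | _] = ~` range d `&` [set t | h t != 0])//.
  apply: measurableI; first by apply: measurableC; exact: measurable_range.
  exact: measurable_neq0.
apply: (smeas_sub0 mB mN _ (f0 x)) => t /= [nd ht]; split.
  by move=> [j _ jt]; apply: nd; exists j => //; rewrite -jt fd.
by apply: contra_neq ht => ->.
Qed.

(* Existence comes from the image of E by f; conversely the eigenvectors of T
   determine any of its spectral measures on a total set. *)
Lemma diagonal_power s : 0 <= s -> diagonal_op E nu (fun j => d j `^ s) (op_power T s).
Proof.
move=> s0; pose h : R -> R := patch (fun=> 0) `]0, +oo[ (fun t => t `^ s).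
have mh : measurable_fun setT h.
  apply/(measurable_restrictT (fun t : R => t `^ s) (measurable_itv _)).
  apply: measurable_funS (measurable_powR s) => //; exact: measurableT.
have hd j : h (d j) = d j `^ s.
  rewrite /h patchE mem_set//= in_itv/= andbT; by case/andP: (dC j).
have h0 : h 0 = 0 by rewrite /h patchE; case: ifPn => //; rewrite inE/= in_itv/= ltxx.
have ET' : spectral_measure_of (total_op T) E'.
  apply: (@diagonal_spectral_integral _ _ E' d d_inj id d _ _ _ T C) => //.
  - by move=> x; exact: image_off.
  - by move=> j; have /andP[/ltW -> ->] := dC j.
  - by apply/image_diagonal.
have ds j : 0 <= d j `^ s <= C `^ s.
  have /andP[dj djC] := dC j; rewrite powR_ge0/= ge0_ler_powR// nnegrE ltW//.
  exact: lt_le_trans djC.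
have [|S dS] := @diagonal_exists _ _ E nu nu_inj (fun j => d j `^ s) (C `^ s).
  by move=> j; have /andP[dj djC] := ds j; rewrite ger0_norm.
have : exists P, exists2 E0, spectral_measure_of (total_op T) E0 &
    spectral_integral E0 h (total_op P).
  exists S, E' => //.
  apply: (@diagonal_spectral_integral _ _ E' d d_inj h _ mh hd _ S _ ds).
    by move=> x; exact: image_off.
  by apply/image_diagonal.
move/getPex; rewrite -/(op_power T s) => -[E0 ET EP].
set P := op_power T s in EP *.
have mid : measurable_fun setT (@id R) by exact: measurable_id.
have dP : dense (op_dom (total_op P)) by move=> O [x Ox] _; exists x.
have lP : linear P by have [[_ lP] _ _] := EP; move=> a x y; have [] := lP a x y I I.
apply: diagonal_of_eigen => //.
- by move=> x; rewrite (spectral_form EP).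
- move=> j x; apply: (spectral_eigen mh EP (measurable_set1 (d j)) dP) => //.
    apply: (spectral_eigenspace ET) => //.
    exact: (diagonal_eigen nu_inj dT).
  by move=> _ ->; exact: hd.
(* Such an [x] lies in the kernel of [T], so the chosen measure [E0] carries it at 0, where [h]
   vanishes. *)
move=> x Qx; rewrite -[RHS](scale0r x) -[0]/(0%:C%C).
apply: (spectral_eigen mh EP (measurable_set1 0) dP) => //; last by move=> _ ->.
apply: (spectral_eigenspace ET) => //=; rewrite scale0r.
apply: (diagonal_kernel nu_inj dT) => j.
by rewrite -frame_rangeK Qx smeas0//; exact: measurable_set1.
Qed.

End powers.

(** * Trace of a diagonal operator *)

Section trace.
Context {R : realType} {H : hilbertType R}.
Implicit Types (x y z w : H).

Lemma sqnormcZ (r : R) (z : R[i]) : sqnormc (r%:C%C * z) = r ^+ 2 * sqnormc z.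
Proof. by case: z => u v; rewrite /sqnormc /=; ring. Qed.

Lemma esum_swap (T1 T2 : choiceType) (I : set T1) (J : set T2) (a : T1 -> T2 -> \bar R) :
  (forall i j, 0 <= a i j)%E ->
  (\esum_(i in I) \esum_(j in J) a i j = \esum_(j in J) \esum_(i in I) a i j)%E.
Proof.
move=> a0; rewrite (esum_esum (J := fun=> J))//.
rewrite (esum_esum (J := fun=> I) (a := fun j i => a i j))//.
rewrite (@reindex_esum _ _ _ (J `*`` (fun=> I)) (I `*`` (fun=> J))
  (fun p => (p.2, p.1)))//.
split.
- by move=> [j i] [/= ? ?]; split.
- by move=> [j i] [j' i'] _ _ /= [-> ->].
- by move=> [i j] [/= ? ?]; exists (j, i).
Qed.

Section diagonal.
Variables (E : spectral_measure H) (nu d : nat -> R) (T : H -> H).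
Variable F : nat -> seq H.
Hypotheses (nu_inj : injective nu) (d0 : forall j, 0 <= d j).
Hypothesis dT : diagonal_op E nu d T.
Hypothesis oF : forall j, orthonormal_seq (F j).
Hypothesis FP : forall j x, E [set nu j] x = proj_seq (F j) x.

Lemma trace_diagonal : trace T = (\sum_(0 <= j <oo) (d j * (size (F j))%:R)%:E)%E.
Proof.
(* The weight d j is absorbed into the vectors, so that Parseval applies. *)
pose a x j := ((\sum_(f <- F j) sqnormc '[(Num.sqrt (d j))%:C%C *: f, x])%:E : \bar R).
have a0 x j : (0 <= a x j)%E.
  by rewrite lee_fin sumr_ge0// => f _; exact: sqnormc_ge0.
have form x : ((complex.Re '[T x, x])%:E = \sum_(0 <= j <oo) a x j)%E.
  apply/esym/cvg_lim => //.
  have cv := @diagonal_form_cvg _ _ _ _ nu_inj _ _ dT x x.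
  rewrite (_ : (fun n => _) = (fun n => (\sum_(0 <= j < n) d j *
    complex.Re '[E [set nu j] x, E [set nu j] x])%:E)).
    by apply: cvg_EFin; [exact: nearW|exact: cv].
  apply/funext => n /=; rewrite /a sumEFin; congr EFin; apply: eq_bigr => j _.
  rewrite -hnorm2 FP proj_seq_norm// mulr_sumr; apply: eq_bigr => f _.
  by rewrite innerZl sqnormcZ sqr_sqrtr// [in LHS]innerC sqnormcJ.
rewrite /trace (eq_esum (fun x _ => form x)).
rewrite (eq_esum (b := fun x => (\esum_(j in [set: nat]) a x j)%E)); last first.
  by move=> x _; rewrite nneseries_esumT.
rewrite esum_swap// nneseries_esumT; last first.
  by move=> j; rewrite lee_fin mulr_ge0.
apply: eq_esum => j _.
rewrite (eq_esum (b := fun x =>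
  (\sum_(f <- F j) (sqnormc '[(Num.sqrt (d j))%:C%C *: f, x])%:E)%E)); last first.
  by move=> x _; rewrite /a sumEFin.
rewrite esum_sum; last by move=> x f _ _; rewrite lee_fin sqnormc_ge0.
rewrite big_seq (eq_bigr (fun=> (d j)%:E)) -?big_seq.
  by rewrite sumEFin big_const_seq count_predT iter_addr_0 mulr_natr.
move=> f fF; rewrite parseval; last exact: hilbert_basisP.
have f1 : hnorm f ^+ 2 = 1 by rewrite hnorm2 (oF j).2// eqxx.
by rewrite hnorm_scaler exprMn f1 mulr1 real_normK ?num_real// sqr_sqrtr.
Qed.

End diagonal.
End trace.

(** * Compactness and singular values of diagonal operators *)

Section compact_diagonal.
Context {R : realType} {H : hilbertType R}.
Implicit Types (x y z w : H).

Lemma hnorm_scalei x : hnorm ('i%C *: x) = hnorm x.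
Proof.
apply/eqP; rewrite -(@eqrXn2 _ 2)// ?hnorm_ge0// !hnorm2.
by rewrite innerZl innerZr mulrA mulcJ_i mul1r.
Qed.

Lemma closed_hnorm_le (G : H -> H) (K c : R) : 0 <= K ->
  (forall y z, hnorm (G y - G z) <= K * hnorm (y - z)) ->
  closed [set y | hnorm (G y) <= c].
Proof.
move=> K0 GK p pcl /=; apply/ler_addgt0Pr => e e0.
have K1 : 0 < K + 1 by rewrite ltr_wpDl.
have eK : 0 < (e / (K + 1))%:C%C :> R[i] by rewrite -[0]/(0%:C%C) ltcR divr_gt0.
have [y [/= Gy /hballE py]] := pcl _ (nbhsx_ballx p _ eK).
have -> : G p = G y + (G p - G y) by rewrite addrC subrK.
apply: (le_trans (hnorm_triangle _ _)); rewrite lerD//.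
apply: (le_trans (GK _ _)).
apply: (@le_trans _ _ ((K + 1) * (e / (K + 1)))); last by rewrite mulrC divfK// gt_eqF.
by rewrite ler_pM ?hnorm_ge0// ?lerDl// ltW.
Qed.

(** * Limits of coefficients along an ultrafilter *)

Section ultrafilter.
Variables (F : set_system H) (UF : UltraFilter F).

Definition ultra_cvg (g : H -> H) (p : H) :=
  forall e : R, 0 < e -> F [set y | hnorm (g y - p) < e].

(** Compactness of the segment gives a cluster point; for an ultrafilter, a neighbourhood whose
    preimage is not in [F] has its complement there, so a cluster point is a limit. *)
Lemma ultra_bounded_cvg (g : H -> R) (K : R) : F [set y | `|g y| <= K] ->
  exists r, forall e : R, 0 < e -> F [set y | `|g y - r| < e].
Proof.
move=> gK; have [r [_ rcl]] : `[- K, K] `&` cluster (g @ F) !=set0.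
  apply: segment_compact; rewrite /fmap/=; apply: filterS gK => y /=.
  by rewrite in_itv/= ler_norml.
exists r => e e0; have [//|nF] := in_ultra_setVsetC [set y | `|g y - r| < e] UF.
exfalso; have /= := rcl (~` ball r e) (ball r e) _ (nbhsx_ballx r e e0).
rewrite setICl => /(_ _)[]; last by move=> ? [].
rewrite /fmap/=; apply: filterS nF => y /= /negP; rewrite -leNgt => gy.
by rewrite -ball_normE /ball_/= distrC; apply/negP; rewrite -leNgt.
Qed.

Lemma ultra_cvgD g1 g2 p1 p2 : ultra_cvg g1 p1 -> ultra_cvg g2 p2 ->
  ultra_cvg (fun y => g1 y + g2 y) (p1 + p2).
Proof.
move=> c1 c2 e e0; have e2 : 0 < e / 2 by rewrite divr_gt0.
apply: filterS (filterI (c1 _ e2) (c2 _ e2)) => y /= [h1 h2].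
rewrite opprD addrACA; apply: (le_lt_trans (hnorm_triangle _ _)).
by move: h1 h2; move: (hnorm _) (hnorm _) => u v; lra.
Qed.

Lemma ultra_cvg_sum (I : Type) (r : seq I) (g : I -> H -> H) :
  (forall i, exists p, ultra_cvg (g i) p) ->
  exists p, ultra_cvg (fun y => \sum_(i <- r) g i y) p.
Proof.
move=> gP; elim: r => [|i r [p IHr]].
  exists 0 => e e0; apply: filterS filterT => y _ /=.
  by rewrite big_nil subrr hnorm0.
have [q iq] := gP i; exists (q + p).
by move=> e e0; apply: filterS (ultra_cvgD iq IHr e0) => y /=; rewrite big_cons.
Qed.

Lemma ultra_cvg_coef (K : R) z : F [set y | hnorm y <= K] ->
  exists p, ultra_cvg (fun y => '[y, z] *: z) p.
Proof.
move=> FK.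
have [r rP] : exists r, forall e : R, 0 < e -> F [set y | `|complex.Re '[y, z] - r| < e].
  apply: (@ultra_bounded_cvg _ (K * hnorm z)); apply: filterS FK => y /= yK.
  by apply: (le_trans (Re_inner_le _ _)); rewrite ler_wpM2r// hnorm_ge0.
have [s sP] : exists s, forall e : R, 0 < e -> F [set y | `|complex.Im '[y, z] - s| < e].
  apply: (@ultra_bounded_cvg _ (K * hnorm ('i%C *: z))); apply: filterS FK => y /= yK.
  rewrite Im_innerE.
  by apply: (le_trans (Re_inner_le _ _)); rewrite ler_wpM2r// hnorm_ge0.
exists ((r +i* s)%C *: z) => e e0.
(* The factor 2 shares [e] between real and imaginary parts, and the [+ 1] covers [z = 0]. *)
have z1 : 0 < 2 * (hnorm z + 1) by rewrite mulr_gt0// ltr_wpDl ?hnorm_ge0.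
have d0 : 0 < e / (2 * (hnorm z + 1)) by rewrite divr_gt0.
apply: filterS (filterI (rP _ d0) (sP _ d0)) => y /=.
rewrite -scalerBl; case: '[y, z] => u v /= [ur vs].
have -> : (u +i* v)%C - (r +i* s)%C = (u - r)%:C%C + 'i%C * (v - s)%:C%C.
  by apply/eqP; rewrite eq_complex /=; apply/andP; split; apply/eqP; ring.
rewrite scalerDl -scalerA; apply: (le_lt_trans (hnorm_triangle _ _)).
rewrite hnorm_scalei !hnorm_scaler -mulrDl.
have hz := hnorm_ge0 z.
apply: (@le_lt_trans _ _ ((`|u - r| + `|v - s|) * (hnorm z + 1))).
  by rewrite ler_wpM2l ?addr_ge0// lerDl.
rewrite -ltr_pdivlMr ?ltr_wpDl//.
have -> : e / (hnorm z + 1) = e / (2 * (hnorm z + 1)) + e / (2 * (hnorm z + 1)).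
  by field; rewrite gt_eqF// ltr_wpDl.
by rewrite ltrD.
Qed.

End ultrafilter.

Section diagonal.
Variables (E : spectral_measure H) (nu d : nat -> R) (T : H -> H).
Variable F : nat -> seq H.
Hypotheses (nu_inj : injective nu) (d_gt0 : forall j, 0 < d j).
Hypotheses (d_decr : forall i j, (i < j)%N -> d j < d i) (d_cvg : d @ \oo --> (0 : R)).
Hypothesis dT : diagonal_op E nu d T.
Hypothesis oF : forall j, orthonormal_seq (F j).
Hypothesis FP : forall j x, E [set nu j] x = proj_seq (F j) x.
Hypothesis FE : forall j e, e \in F j -> E [set nu j] e = e.
Hypothesis Fmax : forall j G, orthonormal_seq G ->
  (forall e, e \in G -> E [set nu j] e = e) -> (size G <= size (F j))%N.

Let mP (j : nat) : measurable ([set nu j] : set (measurableTypeR R)).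
Proof. exact: measurable_set1. Qed.
Let mQ : measurable (range nu : set (measurableTypeR R)).
Proof. exact: measurable_range. Qed.

Let d_le i j : (i <= j)%N -> d j <= d i.
Proof. by rewrite leq_eqVlt => /orP[/eqP->//|/d_decr/ltW]. Qed.

Let d_inj : injective d.
Proof.
move=> i j dij; apply/eqP/negPn/negP; rewrite neq_ltn.
by case/orP => /d_decr; rewrite dij ltxx.
Qed.

Let S n y : H := \sum_(0 <= j < n) E [set nu j] y.

Let SE n y : S n y = \sum_(0 <= j < n) ((cst (1 : R)) j)%:C%C *: E [set nu j] y.
Proof. by rewrite frame_sumE. Qed.

Let S_proj k n y : E [set nu k] (S n y) = if (k < n)%N then E [set nu k] y else 0.
Proof. by rewrite SE (frame_sum_proj E nu_inj) /= scale1r. Qed.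

Let S_range n y : E (range nu) (S n y) = S n y.
Proof.
rewrite /S; elim/big_ind : _ => [|u v Qu Qv|j _]; first exact: smeas0.
  by rewrite smeasD// Qu Qv.
exact: frame_range.
Qed.

Let S_le n y : hnorm (S n y) <= hnorm y.
Proof.
rewrite -[leRHS]mul1r; apply: (frame_norm_le (E := E) nu_inj) => // j.
by rewrite S_proj mul1r; case: ifP => // _; rewrite hnorm0 hnorm_ge0.
Qed.

Let SB n y z : S n (y - z) = S n y - S n z.
Proof.
rewrite /S -sumrB; apply: eq_bigr => j _; exact: smeasB.
Qed.

Lemma diagonal_norm_le x : hnorm (T x) <= d 0%N * hnorm x.
Proof.
apply: (frame_norm_le (E := E) nu_inj); [exact: ltW|exact: (diagonal_range dT)|].
move=> j; rewrite (diagonal_proj dT) hnorm_scaler gtr0_norm//.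
by rewrite ler_wpM2r ?hnorm_ge0// d_le.
Qed.

Lemma diagonal_tail_le n x : hnorm (T x - S n (T x)) <= d n * hnorm x.
Proof.
apply: (frame_norm_le (E := E) nu_inj); first exact: ltW.
  by rewrite smeasB// S_range (diagonal_range dT).
move=> j; rewrite smeasB// S_proj; case: ltnP => jn.
  by rewrite subrr hnorm0 mulr_ge0 ?hnorm_ge0// ltW.
rewrite subr0 (diagonal_proj dT) hnorm_scaler gtr0_norm//.
by rewrite ler_wpM2r ?hnorm_ge0// d_le.
Qed.

(** The image of the unit ball lies in the closed set [D] of bounded vectors with uniformly small
    tails. An ultrafilter on [D] is Cauchy: its truncations converge, being finite sums of bounded
    coefficients, and the tails tend to 0 uniformly with [d]. *)
Lemma diagonal_compact : compact_op T.
Proof.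
split; first exact: (diagonal_linear nu_inj dT).
pose D : set H := [set y | hnorm y <= d 0%N] `&`
  \bigcap_n [set y | hnorm (y - S n y) <= d n].
have cD : closed D.
  apply: closedI.
    by apply: (@closed_hnorm_le id 1) => // y z; rewrite mul1r.
  apply: closed_bigI => n _; apply: (@closed_hnorm_le (fun y => y - S n y) 2) => // y z.
  have -> : y - S n y - (z - S n z) = (y - z) - S n (y - z).
    by rewrite SB !opprD addrACA.
  apply: (le_trans (hnorm_triangle _ _)); rewrite hnorm_opp.
  by have := S_le n (y - z); move: (hnorm (S n _)) (hnorm (y - z)) => u v; lra.
exists D.
  move=> _ [x /= x1 <-]; have {}x1 : hnorm x <= 1.
    by rewrite -lecR -hnormE.
  split=> [|n _] /=.
    apply: (le_trans (diagonal_norm_le x)).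
    by rewrite ler_piMr// ltW.
  apply: (le_trans (diagonal_tail_le n x)).
  by rewrite ler_piMr// ltW.
split=> //; rewrite compact_ultra => G UG GD.
have GK : G [set y | hnorm y <= d 0%N] by apply: filterS GD => y [].
have GS n : exists p, ultra_cvg G (S n) p.
  apply: ultra_cvg_sum => j.
  have [p pP] := @ultra_cvg_sum G UG H (F j) (fun e y => '[y, e] *: e)
    (fun e => ultra_cvg_coef UG e GK).
  by exists p => e e0; apply: filterS (pP e e0) => y /=; rewrite FP.
have cG : cauchy G.
  apply: cauchy_exP => eps eps0.
  have /complex_realP[r er] : eps \is Num.real by rewrite gtr0_real.
  have r0 : 0 < r by move: eps0; rewrite er -[0]/(0%:C%C) ltcR.
  have r2 : 0 < r / 2 by rewrite divr_gt0.
  have /cvgrPdist_lt/(_ _ r2)[n _ /(_ n (leqnn n))] := d_cvg.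
  rewrite /= sub0r normrN gtr0_norm// => dn.
  have [p pP] := GS n; exists p; rewrite er.
  apply: filterS (filterI GD (pP _ r2)) => y [[_ /(_ n I) /= yS] Sp].
  apply/hballE; rewrite hnorm_sub.
  have -> : y - p = (y - S n y) + (S n y - p) by rewrite addrA subrK.
  apply: (le_lt_trans (hnorm_triangle _ _)).
  by move: yS Sp dn; move: (hnorm (y - _)) (hnorm (_ - p)) => u v; lra.
have Gl : cvg G by exact: cauchy_cvg.
exists (lim G); split; last exact: Gl.
apply: cD => B /Gl GB; have [y [Dy By]] := filter_ex (filterI GD GB).
by exists y.
Qed.

Let sT := diagonal_sym nu_inj dT.

(** [T] is symmetric, so the condition reads [T (T x) = s^2 x]. Hence [x] is in the range of [T],
    and its [k]-th component is killed by [d k ^ 2 - s^2]. *)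
Lemma singular_space_sub (s : R) x : 0 < s ->
  adjoint_graph (total_op T) (T x) ((s ^+ 2)%:C%C *: x) ->
  E (range nu) x = x /\ forall k, d k != s -> E [set nu k] x = 0.
Proof.
move=> s0 hx; have TTx : T (T x) = (s ^+ 2)%:C%C *: x.
  apply: inner_inj => z; rewrite [LHS]innerC [RHS]innerC -sT.
  by congr conjc; exact: hx.
have s2 : (s ^+ 2)%:C%C != 0 :> R[i].
  by rewrite -[0]/(0%:C%C) (inj_eq (@complexI _)) expf_neq0// gt_eqF.
split.
  have xE : x = (s ^+ 2)%:C%C^-1 *: T (T x) by rewrite TTx scalerA mulVf// scale1r.
  by rewrite xE smeasZ// (diagonal_range dT).
move=> k dk; have := congr1 (E [set nu k]) TTx.
rewrite !(diagonal_proj dT) smeasZ// scalerA -realcM => /eqP.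
rewrite -subr_eq0 -scalerBl scaler_eq0 => /orP[|/eqP//].
rewrite -(rmorphB (real_complex R)) -[0]/(0%:C%C) (inj_eq (@complexI _)) subr_eq0.
rewrite -expr2 eqrXn2// ?ltW// => /eqP dks.
by rewrite dks eqxx in dk.
Qed.

Lemma singular_space_off (s : R) x : 0 < s -> ~ range d s ->
  adjoint_graph (total_op T) (T x) ((s ^+ 2)%:C%C *: x) -> x = 0.
Proof.
move=> s0 ns /(singular_space_sub s0)[Qx Px].
apply: (frame_eq0 (E := E) nu_inj) => // j; apply: Px.
by apply/eqP => dj; apply: ns; exists j.
Qed.

Lemma singular_space_on j x :
  adjoint_graph (total_op T) (T x) ((d j ^+ 2)%:C%C *: x) <-> E [set nu j] x = x.
Proof.
split=> [/(singular_space_sub (d_gt0 j))[Qx Px]|Px].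
  apply: (frame_inj (E := E) nu_inj); rewrite ?frame_range// => k.
  have [->|kj] := eqVneq k j; first by rewrite smeas_idem.
  rewrite (frame_orth E nu_inj)// Px//.
  by apply: contra_neq kj => /d_inj.
have Tx : T x = (d j)%:C%C *: x by rewrite -Px (diagonal_eigen nu_inj dT) Px.
by move=> z _ /=; rewrite sT Tx (diagonalZ nu_inj dT) Tx scalerA -realcM -expr2.
Qed.

Lemma singular_multiplicity_on j :
  (singular_multiplicity T (d j) = (size (F j))%:R%:E)%E.
Proof.
apply/eqP; rewrite eq_le; apply/andP; split.
  apply: ge_ereal_sup => _ [n [v vP] <-]; rewrite lee_fin ler_nat.
  have [|G [oG sG] Gv] := @orthonormal_fun_seq _ _ n v.
    by move=> i k; have [] := vP i k.
  rewrite -sG; apply: Fmax => // e /Gv[i ->]; apply/singular_space_on.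
  by have [] := vP i i.
apply: ereal_sup_ubound; exists (size (F j)) => //.
exists (fun i => (F j)`_i) => i k; split; last exact: orthonormal_seq_fun.
by apply/singular_space_on; apply: FE; rewrite mem_nth.
Qed.

Lemma singular_multiplicity_ge0 s : (0 <= singular_multiplicity T s)%E.
Proof.
apply: ereal_sup_ubound; exists 0%N => //.
by exists (fun=> 0) => -[].
Qed.

Lemma singular_multiplicity_off s : 0 < s -> ~ range d s ->
  singular_multiplicity T s = 0%E.
Proof.
move=> s0 ns; apply/eqP; rewrite eq_le singular_multiplicity_ge0 andbT.
apply: ge_ereal_sup => _ [[|n] [v vP] <-] //.
have [v0 v1] := vP ord0 ord0; exfalso; move: v1.
rewrite (singular_space_off s0 ns v0) inner0l eqxx => /eqP.
by rewrite eq_sym oner_eq0.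
Qed.

Local Notation M k := (\sum_(0 <= j < k) size (F j))%N.

Let fsum_sing k : (\sum_(u \in d @` `I_k) singular_multiplicity T u = (M k)%:R%:E)%E.
Proof.
have -> : d @` `I_k = [set` [seq d j | j <- iota 0 k]].
  apply/seteqP; split=> [_ [j jk <-]|_ /mapP[j jk ->]] /=.
    by apply/map_f; rewrite mem_iota.
  by exists j => //; move: jk; rewrite mem_iota.
rewrite -fsbig_seq; last by rewrite map_inj_uniq ?iota_uniq.
rewrite big_map natr_sum -sumEFin /index_iota subn0.
by apply: eq_bigr => j _; exact: singular_multiplicity_on.
Qed.

Lemma esum_singular_ge k s : s < d k ->
  ((M k.+1)%:R%:E <= \esum_(u in [set u | (s < u)%R]) singular_multiplicity T u)%E.
Proof.
move=> sk; apply: esum_ge; exists (d @` `I_k.+1); last by rewrite fsum_sing.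
split; first exact: finite_image.
by move=> _ [j jk <-] /=; apply: (lt_le_trans sk); apply: d_le.
Qed.

Lemma esum_singular k :
  (\esum_(u in [set u | (d k < u)%R]) singular_multiplicity T u = (M k)%:R%:E)%E.
Proof.
have dk : d @` `I_k `<=` [set u | d k < u] by move=> _ [j jk <-]; exact: d_decr.
rewrite (esumID (d @` `I_k)); last by move=> *; exact: singular_multiplicity_ge0.
rewrite ((setIidPr _ _).2 dk) esum_fset; last 2 first.
- exact: finite_image.
- by move=> *; exact: singular_multiplicity_ge0.
rewrite fsum_sing esum1 ?adde0// => u [/= ku nu_].
apply: singular_multiplicity_off; first exact: lt_trans ku.
move=> [j _ ju]; apply: nu_; exists j => //=.
by rewrite ltnNge; apply/negP => /d_le; rewrite ju leNgt ku.
Qed.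

(** The infimum is attained at [d k]: exactly [M k < n] singular values exceed it, while below [d k]
    at least [M k.+1 >= n] are exceeded. *)
Lemma singular_value_diagonal k n : (M k < n)%N -> (n <= M k.+1)%N ->
  singular_value T n = d k.
Proof.
move=> Mn nM; rewrite /singular_value; set A := [set s | _].
have Ad : A (d k) by split; [exact: ltW|rewrite esum_singular lte_fin ltr_nat].
have lb : lbound A (d k).
  move=> s [_ sn]; rewrite leNgt; apply/negP => /esum_singular_ge.
  by move=> /le_lt_trans/(_ sn); rewrite lte_fin ltr_nat ltnNge nM.
apply/eqP; rewrite eq_le; apply/andP; split.
  by apply: ge_inf => //; exists (d k).
by apply: lb_le_inf => //; exists (d k).
Qed.

End diagonal.
End compact_diagonal.

(** * Logarithmic means and power sums *)

Section logarithmic_means.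
Context {R : realType}.
Implicit Types (r e a b s : R).

Local Notation harm n := (\sum_(1 <= i < n.+1) i%:R^-1 : R).

(** The inequality [ln (1 + x) <= x]; applied to consecutive integers in either order, it bounds the
    harmonic sums on both sides. *)
Lemma ln_ratio_le a b : 0 < a -> 0 < b -> ln b - ln a <= b / a - 1.
Proof.
move=> a0 b0; rewrite -ln_div ?posrE//.
have := @le_ln1Dx R (b / a - 1); rewrite [1 + _]addrC subrK; apply.
by rewrite ltrBrDl subrr divr_gt0.
Qed.

Lemma harmonic_le_ln n : (0 < n)%N -> harm n <= 1 + ln n%:R.
Proof.
case: n => // n _; elim: n => [|n IHn]; first by rewrite big_nat1 ln1 addr0 invr1.
rewrite big_nat_recr//=; have := @ln_ratio_le n.+2%:R n.+1%:R.
rewrite !ltr0n => /(_ isT isT).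
have -> : n.+1%:R / n.+2%:R - 1 = - n.+2%:R^-1 :> R.
  have n0 : 0 < n.+1%:R :> R by rewrite ltr0n.
  by rewrite -(natr1 n.+1); move: n.+1%:R n0 => q q0; field; rewrite gt_eqF// addr_gt0.
by move: IHn; move: (\sum_(_ <= _ < _) _) (ln _) (ln _) (_^-1) => p q t u; lra.
Qed.

Lemma ln_le_harmonic n : ln n.+1%:R <= harm n.
Proof.
elim: n => [|n IHn]; first by rewrite big_geq// ln1.
rewrite big_nat_recr//=; have := @ln_ratio_le n.+1%:R n.+2%:R.
rewrite !ltr0n => /(_ isT isT).
have -> : n.+2%:R / n.+1%:R - 1 = n.+1%:R^-1 :> R.
  have n0 : 0 < n.+1%:R :> R by rewrite ltr0n.
  by rewrite -(natr1 n.+1); move: n.+1%:R n0 => q q0; field; rewrite gt_eqF.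
by move: IHn; move: (\sum_(_ <= _ < _) _) (ln _) (ln _) (_^-1) => p q t u; lra.
Qed.

Lemma ln_nat_ge (B : R) : exists n0, forall n, (n0 <= n)%N -> B <= ln n%:R.
Proof.
exists (Num.truncn (expR B)).+1 => n n0.
have eB : expR B < n%:R by apply: (lt_le_trans (truncnS_gt _)); rewrite ler_nat.
have n_gt0 : 0 < n%:R :> R by exact: lt_trans (expR_gt0 B) eB.
by rewrite -[B]expRK ler_ln ?posrE ?expR_gt0// ltW.
Qed.

(** For [mu := singular_value T] this unfolds to [singular_log_mean T]. *)
Definition log_average (mu : nat -> R) (N : nat) : R :=
  (ln N%:R)^-1 * \sum_(1 <= n < N.+1) mu n.

Section bounds.
Variable mu : nat -> R.
Hypothesis mu_ge0 : forall n, 0 <= mu n.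
Hypothesis mu_le : forall n, (0 < n)%N -> mu n <= n%:R^-1.

Lemma log_average_ge0 N : 0 <= log_average mu N.
Proof.
rewrite mulr_ge0 ?sumr_ge0// invr_ge0.
by case: N => [|N]; [rewrite ln0|rewrite ln_ge0// ler1n].
Qed.

Lemma log_average_le N : (2 <= N)%N -> log_average mu N <= 1 + (ln N%:R)^-1.
Proof.
move=> N2; have lN : 0 < ln N%:R :> R by rewrite ln_gt0// ltr1n.
have -> : 1 + (ln N%:R)^-1 = (ln N%:R)^-1 * (1 + ln N%:R) :> R.
  by field; rewrite gt_eqF.
rewrite ler_wpM2l ?invr_ge0 ?(ltW lN)//.
apply: (@le_trans _ _ (harm N)); last by apply: harmonic_le_ln; exact: leq_trans N2.
by rewrite big_nat [leRHS]big_nat; apply: ler_sum => i /andP[i1 _]; exact: mu_le.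
Qed.

Lemma log_average_bounded : exists B, forall N, `|log_average mu N| <= B.
Proof.
have l2 : 0 < ln 2%:R :> R by rewrite ln_gt0// ltr1n.
exists (1 + (ln 2%:R)^-1) => N; rewrite ger0_norm ?log_average_ge0//.
have [N2|] := leqP 2 N.
  apply: (le_trans (log_average_le N2)); rewrite lerD2l lef_pV2 ?posrE//.
    by rewrite ler_ln ?posrE ?ltr0n ?ler_nat//; exact: leq_trans N2.
  by rewrite ln_gt0// ltr1n.
have B0 : 0 <= 1 + (ln 2%:R)^-1 :> R by rewrite addr_ge0// invr_ge0 ltW.
(* For [N] equal to 0 or 1 the logarithm is 0, and so is its inverse by convention. *)
case: N => [|[|//]] _; first by rewrite /log_average ln0// invr0 mul0r.
by rewrite /log_average ln1 invr0 mul0r.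
Qed.

Lemma log_average_limsup e : 0 < e ->
  exists n0, forall N, (n0 <= N)%N -> log_average mu N <= 1 + e.
Proof.
move=> e0; have [n0 hn] := ln_nat_ge e^-1.
exists (maxn 2 n0) => N; rewrite geq_max => /andP[N2 Nn].
apply: (le_trans (log_average_le N2)); rewrite lerD2l.
have lN : 0 < ln N%:R :> R by rewrite ln_gt0// ltr1n.
by rewrite -[e]invrK lef_pV2 ?posrE ?invr_gt0// hn.
Qed.

(** The first [K] terms are dropped by positivity; the harmonic mass lost, [h], is at most
    [e * ln N] once [ln N >= h / e]. *)
Lemma log_average_liminf r e K : 0 < r -> 0 < e ->
  (forall n, (K < n)%N -> (r * n%:R)^-1 <= mu n) ->
  exists n0, forall N, (n0 <= N)%N -> r^-1 - e <= log_average mu N.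
Proof.
move=> r0 e0 mu_ge; pose h := r^-1 * harm K.
have h0 : 0 <= h by rewrite mulr_ge0 ?invr_ge0 ?(ltW r0)// sumr_ge0// => i _; rewrite invr_ge0.
have [n0 hn] := ln_nat_ge (h / e).
exists (maxn 2 (maxn K n0)) => N; rewrite !geq_max => /and3P[N2 KN Nn].
have lN : 0 < ln N%:R :> R by rewrite ln_gt0// ltr1n.
rewrite -(@ler_pM2l _ (ln N%:R))// /log_average mulVKf ?gt_eqF//.
have hN := hn N Nn; rewrite ler_pdivrMr// in hN.
have split (f : nat -> R) : \sum_(1 <= n < N.+1) f n =
    \sum_(1 <= n < K.+1) f n + \sum_(K.+1 <= n < N.+1) f n.
  by rewrite -big_cat_nat.
have s1 : r^-1 * \sum_(K.+1 <= n < N.+1) n%:R^-1 <= \sum_(1 <= n < N.+1) mu n.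
  rewrite (split mu) -[leLHS]add0r lerD ?sumr_ge0// mulr_sumr big_nat [leRHS]big_nat.
  by apply: ler_sum => i /andP[Ki _]; rewrite -invfM mu_ge.
apply: le_trans s1.
have -> : \sum_(K.+1 <= n < N.+1) n%:R^-1 = harm N - harm K :> R.
  by rewrite (split (fun n => n%:R^-1)) addrC addKr.
have lh : ln N%:R <= harm N.
  apply: le_trans (ln_le_harmonic N); rewrite ler_ln ?posrE ?ltr0n ?ler_nat//.
  exact: leq_trans N2.
have : r^-1 * ln N%:R <= r^-1 * harm N by rewrite ler_wpM2l ?invr_ge0 ?(ltW r0).
rewrite mulrBr -/h mulrBr.
move: hN; rewrite -/h [ln _ * e]mulrC [r^-1 * ln _]mulrC; clearbody h.
by lra.
Qed.

End bounds.
End logarithmic_means.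

(** * Comparison of power sums with telescoping sums *)

Section power_sums.
Context {R : realType}.
Implicit Types (r e a b s : R).

Lemma powRE a s : 0 < a -> a `^ s = expR (s * ln a).
Proof. by move=> a0; rewrite /powR gt_eqF. Qed.

(* From 1 + x <= exp x: it replaces the comparison of (b - a) b^-s with the
   integral of t^-s on [a, b]. *)
Lemma power_diff_ge a b s : 0 < a -> 0 < b -> 1 < s ->
  (s - 1) * ((b - a) * b^-1 `^ s) <= a `^ (1 - s) - b `^ (1 - s).
Proof.
move=> a0 b0 s1; have s0 : 0 < s - 1 by rewrite subr_gt0.
have -> : b^-1 `^ s = b `^ (1 - s) / b.
  rewrite !powRE ?invr_gt0// lnV ?posrE// -[in X in _ / X](@lnK _ b) ?posrE//.
  by rewrite -expRN -expRD; congr expR; ring.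
have -> : a `^ (1 - s) = b `^ (1 - s) * expR ((s - 1) * (ln b - ln a)).
  by rewrite !powRE// -expRD; congr expR; ring.
set q := b `^ (1 - s); have q0 : 0 <= q by exact: powR_ge0.
have h1 := @expR_ge1Dx R ((s - 1) * (ln b - ln a)).
have h2 : (s - 1) * (1 - a / b) <= (s - 1) * (ln b - ln a).
  by rewrite ler_wpM2l ?(ltW s0)//; have := ln_ratio_le b0 a0; lra.
have h3 : q * (1 + (s - 1) * (1 - a / b)) <= q * expR ((s - 1) * (ln b - ln a)).
  by rewrite ler_wpM2l//; lra.
have -> : (s - 1) * ((b - a) * (q / b)) = q * ((s - 1) * (1 - a / b)).
  by field; rewrite gt_eqF.
by move: h3; rewrite mulrDr mulr1; lra.
Qed.

(** [power_diff_ge] with [a] and [b] exchanged, as it does not order them. *)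
Lemma power_diff_le a b s : 0 < a -> 0 < b -> 1 < s ->
  a `^ (1 - s) - b `^ (1 - s) <= (s - 1) * ((b - a) * a^-1 `^ s).
Proof.
move=> a0 b0 s1; have := power_diff_ge b0 a0 s1.
by rewrite -(opprB b a) mulNr mulrN; lra.
Qed.

Section sequence.
Variable M : nat -> R.
Hypotheses (M0 : M 0%N = 0) (M_incr : forall k, M k + 1 <= M k.+1).

Definition power_term s j : R := (M j.+1)^-1 `^ s * (M j.+1 - M j).

Lemma power_seq_ge k : k%:R <= M k.
Proof.
elim: k => [|k IHk]; first by rewrite M0.
by apply: le_trans (M_incr k); rewrite -addn1 natrD lerD2r.
Qed.

Lemma power_seq_gt0 k : 0 < M k.+1.
Proof. by apply: lt_le_trans (power_seq_ge k.+1); rewrite ltr0n. Qed.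

Lemma power_term_ge0 s j : 0 <= power_term s j.
Proof. by rewrite mulr_ge0 ?powR_ge0// subr_ge0; have := M_incr j; lra. Qed.

(** The term [j = 0] equals [M 1 ^ (1 - s) <= 1] and is treated apart because [M 0 = 0]; the others
    telescope. For [M k = k] this bounds the zeta series. *)
Lemma power_sum_le s n : 1 < s ->
  \sum_(0 <= j < n) power_term s j <= 1 + (s - 1)^-1.
Proof.
move=> s1; have s0 : 0 < s - 1 by rewrite subr_gt0.
case: n => [|n]; first by rewrite big_geq// addr_ge0// invr_ge0 ltW.
have M1 : 1 <= M 1%N by have := M_incr 0; rewrite M0 add0r.
have M10 := power_seq_gt0 0.
have le1 : M 1%N `^ (1 - s) <= 1.
  by rewrite -[leRHS](powRr0 (M 1%N)) ler_powR//; lra.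
suff : \sum_(0 <= j < n.+1) power_term s j <=
    M 1%N `^ (1 - s) + (M 1%N `^ (1 - s) - M n.+1 `^ (1 - s)) / (s - 1).
  move/le_trans; apply; rewrite lerD// ler_pdivrMr// mulVf ?gt_eqF//.
  by have := powR_ge0 (M n.+1) (1 - s); lra.
elim: n => [|n IHn].
  rewrite big_nat1 /power_term M0 subr0 subrr mul0r addr0.
  rewrite !powRE ?invr_gt0// lnV ?posrE// -[X in _ * X](@lnK _ (M 1%N)) ?posrE//.
  by rewrite -expRD ler_expR; lra.
rewrite big_nat_recr//=; have := power_diff_ge (power_seq_gt0 n) (power_seq_gt0 n.+1) s1.
rewrite mulrC -ler_pdivlMr// mulrC -/(power_term s n.+1) => h.
apply: (le_trans (lerD IHn h)); rewrite -addrA lerD2l -mulrDl.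
by rewrite addrA subrK.
Qed.

(** From [M j.+1 <= r M j], replacing [M j] by [M j.+1] in the upper rectangles costs at most a
    factor [r ^ s]; the upper rectangles dominate a telescoping sum. *)
Lemma power_sum_ge r s J n : 0 < r -> 1 < s -> (0 < J)%N -> (J <= n)%N ->
  (forall j, (J <= j)%N -> M j.+1 <= r * M j) ->
  r^-1 `^ s * (M J `^ (1 - s) - M n `^ (1 - s)) <=
  (s - 1) * \sum_(0 <= j < n) power_term s j.
Proof.
move=> r0 s1 J0 Jn Mr; have s0 : 0 < s - 1 by rewrite subr_gt0.
rewrite (big_cat_nat (leq0n J) Jn)/= [leRHS]mulrDr -[leLHS]add0r lerD//.
  by rewrite mulr_ge0 ?(ltW s0)// sumr_ge0// => j _; exact: power_term_ge0.
elim: n Jn => [|n IHn]; first by rewrite leqn0 => /eqP J00; rewrite J00 in J0.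
rewrite leq_eqVlt => /orP[/eqP <-|]; first by rewrite subrr mulr0 big_geq// mulr0.
rewrite ltnS => Jn; rewrite big_nat_recr//= [leRHS]mulrDr.
have n0 : (0 < n)%N by exact: leq_trans Jn.
have Mn0 : 0 < M n by case: n n0 {IHn Jn} => // n _; exact: power_seq_gt0.
have step : r^-1 `^ s * (M n `^ (1 - s) - M n.+1 `^ (1 - s)) <= (s - 1) * power_term s n.
  apply: (@le_trans _ _ (r^-1 `^ s * ((s - 1) * ((M n.+1 - M n) * (M n)^-1 `^ s)))).
    rewrite ler_wpM2l ?powR_ge0//; apply: power_diff_le => //; exact: power_seq_gt0.
  rewrite mulrCA ler_wpM2l ?(ltW s0)// /power_term mulrCA mulrC.
  rewrite ler_wpM2r//; first by have := M_incr n; lra.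
  have MS0 := power_seq_gt0 n.
  rewrite -powRM ?invr_ge0 ?(ltW r0) ?(ltW Mn0)// -invfM.
  rewrite ge0_ler_powR ?nnegrE ?invr_ge0 ?mulr_ge0 ?(ltW r0) ?(ltW Mn0) ?(ltW MS0)//.
    by lra.
  by rewrite lef_pV2 ?posrE ?mulr_gt0 ?power_seq_gt0// Mr.
apply: le_trans (lerD (IHn Jn) step); rewrite -mulrDr ler_wpM2l ?powR_ge0//.
by rewrite addrA subrK.
Qed.

Lemma power_seq_small s e : 1 < s -> 0 < e ->
  exists n0, forall n, (n0 <= n)%N -> M n `^ (1 - s) <= e.
Proof.
move=> s1 e0; have s0 : 0 < s - 1 by rewrite subr_gt0.
have [n0 hn] := @ln_nat_ge R (- ln e / (s - 1)).
exists n0.+1 => -[//|n] nn; have Mn0 := power_seq_gt0 n.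
rewrite powRE// -[leRHS](@lnK _ e) ?posrE// ler_expR.
have : ln n.+1%:R <= ln (M n.+1).
  by rewrite ler_ln ?posrE ?ltr0n//; exact: power_seq_ge.
have := hn n.+1 (ltnW nn); rewrite ler_pdivrMr// => h1 h2.
have : ln n.+1%:R * (s - 1) <= ln (M n.+1) * (s - 1) by rewrite ler_wpM2r// ltW.
by rewrite -(opprB s 1) mulNr [(s - 1) * _]mulrC; lra.
Qed.

Lemma power_sum_liminf e : 0 < e ->
  (forall r, 1 < r -> exists J, forall j, (J <= j)%N -> M j.+1 <= r * M j) ->
  exists2 de, 0 < de & forall s, 1 < s -> s < 1 + de ->
    exists n, 1 - e <= (s - 1) * \sum_(0 <= j < n) power_term s j.
Proof.
(* The error is split into three parts [e / 3]: from [s * ln r] with [s <= 2] and [ln r <= e / 6],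
   from [(s - 1) * ln (M J)] through the choice of [de], and from the end term [M n ^ (1 - s)]. So
   [J] depends on [e], [de] on [J], and [n] on [s]. *)
move=> e0 Mr; pose r := 1 + e / 6.
have r1 : 1 < r by rewrite ltrDl divr_gt0.
have r0 : 0 < r by exact: lt_trans r1.
have [J' hJ'] := Mr r r1; pose J := J'.+1.
have hJ j : (J <= j)%N -> M j.+1 <= r * M j by move=> /ltnW; exact: hJ'.
pose l := ln (M J).
have MJ0 : 0 < M J by exact: power_seq_gt0.
have l0 : 0 <= l.
  rewrite ln_ge0//; apply: le_trans (power_seq_ge J); by rewrite ler1n.
have l1 : 0 < 3 * (l + 1) by rewrite mulr_gt0// ltr_wpDl.
pose de := Num.min 1 (e / (3 * (l + 1))).
have de0 : 0 < de by rewrite lt_min ltr01 divr_gt0.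
exists de => // s s1 sde; have s0 : 0 < s - 1 by rewrite subr_gt0.
have de1 : de <= 1 by rewrite ge_min lexx.
have del : de * l <= e / 3.
  apply: (@le_trans _ _ (e / (3 * (l + 1)) * (l + 1))).
    by rewrite ler_pM ?(ltW de0)// ?ge_min ?lexx ?orbT// lerDl.
  by rewrite invfM mulrA -mulrA mulVf ?mulr1// gt_eqF// ltr_wpDl.
have e3 : 0 < e / 3 by rewrite divr_gt0.
have [n0 hn] := power_seq_small s1 e3.
exists (maxn J n0).
apply: le_trans (power_sum_ge r0 s1 (ltn0Sn J') (leq_maxl J n0) hJ).
have small := hn _ (leq_maxr J n0).
rewrite mulrBr.
have rs1 : r^-1 `^ s <= 1.
  rewrite [leRHS](_ : 1 = 1 `^ s); last by rewrite powR1.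
  rewrite ge0_ler_powR ?nnegrE ?invr_ge0 ?(ltW r0)//; first by lra.
  by rewrite invf_le1// ltW.
have t1 : r^-1 `^ s * M (maxn J n0) `^ (1 - s) <= e / 3.
  rewrite -[leRHS]mul1r ler_pM// ?powR_ge0//.
suff : 1 - 2 * (e / 3) <= r^-1 `^ s * M J `^ (1 - s) by lra.
rewrite !powRE ?invr_gt0// lnV ?posrE// -expRD.
apply: le_trans (expR_ge1Dx _).
have lr : ln r <= e / 6 by have := @le_ln1Dx R (e / 6); apply; lra.
have lr0 : 0 <= ln r by rewrite ln_ge0// ltW.
have h1 : s * ln r <= 2 * (e / 6) by rewrite ler_pM//; lra.
have h2 : (s - 1) * l <= e / 3.
  by apply: le_trans del; rewrite ler_wpM2r//; lra.
by rewrite -/l -(opprB s 1) mulNr mulrN; lra.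
Qed.

End sequence.
End power_sums.

(** * Dixmier limits and the counting function *)

Section dixmier_bounds.
Context {R : realType}.
Implicit Types (u : nat -> R) (omega : (R -> R) -> R).

Lemma measurable_truncn_seq u : measurable_fun setT (fun t : R => u (Num.truncn t)).
Proof.
move=> _ B mB; rewrite setTI.
have -> : (fun t : R => u (Num.truncn t)) @^-1` B =
    \bigcup_(n in [set n | B (u n)]) [set t | Num.truncn t = n].
  by apply/seteqP; split=> [t Bt|t [n Bn /= ->]//]; exists (Num.truncn t).
apply: bigcup_measurable => n _.
have mle k : measurable [set t : R | (Num.truncn t <= k)%N].
  rewrite (_ : [set _ | _] = `]-oo, k.+1%:R[%classic); first exact: measurable_itv.
  by apply/seteqP; split=> t /=; rewrite in_itv/= truncn_le_nat.
case: n => [|n].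
  rewrite (_ : [set _ | _] = [set t : R | (Num.truncn t <= 0)%N])//.
  by apply/seteqP; split=> t /=; [move=> ->|rewrite leqn0 => /eqP].
rewrite (_ : [set _ | _] = [set t : R | (Num.truncn t <= n.+1)%N] `\`
  [set t : R | (Num.truncn t <= n)%N]); first exact: measurableD.
apply/seteqP; split=> t /=; first by move=> ->; rewrite leqnn ltnn.
by move=> [tn /negP]; rewrite -ltnNge => nt; apply/eqP; rewrite eqn_leq tn.
Qed.

Lemma lebesgue_above_ae (a : R) (Q : R -> Prop) :
  (forall t, a < t -> Q t) -> \forall t \ae lebesgue_above a, Q t.
Proof.
move=> aQ; exists `]-oo, a]%classic; split=> //=.
  rewrite /lebesgue_above /mrestr (_ : _ `&` _ = set0) ?measure0//.
  apply/seteqP; split=> t //= []; rewrite !in_itv/= andbT => ta at_.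
  by have := le_lt_trans ta at_; rewrite ltxx.
by move=> t nQ /=; rewrite in_itv/= leNgt; apply/negP => /aQ.
Qed.

Section bounded.
Variables (omega : (R -> R) -> R) (u : nat -> R) (B : R).
Hypotheses (omegaP : dixmier_state omega) (uB : forall n, `|u n| <= B).

Let f (t : R) := u (Num.truncn t).

Let f_Lfun : f \in Lfun (lebesgue_above 0) +oo%E.
Proof.
rewrite inE; apply/andP; split; first by rewrite inE/=; exact: measurable_truncn_seq.
rewrite inE/= /finite_norm unlock; case: ifPn => _; last exact: ltry.
apply: (@le_lt_trans _ _ B%:E); last exact: ltry.
by apply/ess_supP; apply: nearW => t /=; rewrite lee_fin uB.
Qed.

Lemma omega_lim_seq_le (b : R) : (exists n0, forall n, (n0 <= n)%N -> u n <= b) ->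
  omega_lim_seq omega u <= b.
Proof.
move=> [n0 ub]; rewrite -lee_fin.
have /andP[_ le] := dixmier_bounds omegaP f_Lfun; apply: (le_trans le).
(* The successor makes the threshold positive, as the essential upper limit requires. *)
apply: (@le_trans _ _ (ess_sup (lebesgue_above n0.+1%:R) (EFin \o f))).
  by apply: ereal_inf_lbound; exists n0.+1%:R => //=; rewrite ltr0n.
apply/ess_supP; apply: lebesgue_above_ae => t nt /=; rewrite lee_fin ub//.
by rewrite ltnW// truncn_gt_nat ltW.
Qed.

Lemma omega_lim_seq_ge (b : R) : (exists n0, forall n, (n0 <= n)%N -> b <= u n) ->
  b <= omega_lim_seq omega u.
Proof.
move=> [n0 ub]; rewrite -lee_fin.
have /andP[le _] := dixmier_bounds omegaP f_Lfun; apply: le_trans le.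
apply: (@le_trans _ _ (ess_inf (lebesgue_above n0.+1%:R) (EFin \o f))); last first.
  by apply: ereal_sup_ubound; exists n0.+1%:R => //=; rewrite ltr0n.
apply/ess_infP; apply: lebesgue_above_ae => t nt /=; rewrite lee_fin ub//.
by rewrite ltnW// truncn_gt_nat ltW.
Qed.

End bounded.
End dixmier_bounds.

(** * The counting function and its jumps *)

Section counting.
Context {R : realType}.
Variables (lam : nat -> R) (M : nat -> R) (N : R -> R).
Hypotheses (lam_incr : forall i j : nat, (i < j)%N -> lam i < lam j).
Hypothesis lam_unb : forall C : R, exists j, C < lam j.
Hypotheses (M_incr : forall k, M k + 1 <= M k.+1) (M0 : M 0%N = 0).
Hypothesis NE : forall x J, (forall k, (lam k <= x) = (k < J)%N) -> N x = M J.

Let N_left (x : R) : R := lim (N (x - d) @[d --> 0^'+]).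

Lemma lam_ler i j : (lam i <= lam j) = (i <= j)%N.
Proof.
have [ij|ji] := leqP i j; last by rewrite leNgt lam_incr.
by move: ij; rewrite leq_eqVlt => /orP[/eqP ->|/lam_incr/ltW//]; rewrite lexx.
Qed.

Lemma counting_index x : exists J, forall k, (lam k <= x) = (k < J)%N.
Proof.
have ex : exists j, x < lam j by exact: lam_unb.
case: (ex_minnP ex) => J xJ Jmin; exists J => k.
have [kJ|Jk] := ltnP k J.
  by rewrite leNgt; apply/negP => /Jmin; rewrite leqNgt kJ.
by apply/negbTE; rewrite -ltNge (lt_le_trans xJ)// lam_ler.
Qed.

Lemma counting_lam j : N (lam j) = M j.+1.
Proof. by apply: NE => k; rewrite lam_ler ltnS. Qed.

Lemma M_gt0 k : 0 < M k.+1.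
Proof. by apply: lt_le_trans (power_seq_ge M0 M_incr k.+1); rewrite ltr0n. Qed.

(** For small [d > 0] the eigenvalues at most [x - d] are exactly those below [x], so the limit is
    that of a constant. *)
Lemma counting_left x J : (forall k, (lam k < x) = (k < J)%N) -> N_left x = M J.
Proof.
move=> xJ; apply/cvg_lim => //; apply: cvg_near_cst.
have : \forall d \near 0^'+, forall k, (lam k <= x - d) = (k < J)%N.
  case: J xJ => [|J] xJ.
    near=> d => k; rewrite ltn0; apply/negbTE; rewrite -ltNge.
    have : x <= lam k by rewrite leNgt xJ.
    apply: lt_le_trans; rewrite ltrBlDr ltrDl; near: d; exact: nbhs_right_gt.
  have lJ : lam J < x by rewrite xJ.
  near=> d => k; have [kJ|Jk] := ltnP k J.+1.
    apply: (@le_trans _ _ (lam J)); first by rewrite lam_ler.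
    rewrite lerBrDr -lerBrDl; near: d; apply: nbhs_right_le.
    by rewrite subr_gt0.
  apply/negbTE; rewrite -ltNge.
  have : x <= lam k by rewrite leNgt xJ -leqNgt.
  apply: lt_le_trans; rewrite ltrBlDr ltrDl; near: d; exact: nbhs_right_gt.
by apply: filterS => d; exact: NE.
Unshelve. all: by end_near. Qed.

(** At an eigenvalue [lam j] the quotient is [M j.+1 / M j], and beyond the first eigenvalue it is 1
    elsewhere, hence dominated by a neighbouring jump. *)
Lemma counting_limsup :
  limf_esup (fun x : R => (N x / N_left x)%:E) +oo =
  limn_esup (fun k => (M k / M k.-1)%:E).
Proof.
have Mp k : 0 < M k.+1 by exact: M_gt0.
have ratio j : N (lam j) / N_left (lam j) = M j.+1 / M j.
  rewrite counting_lam (@counting_left _ j)// => k.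
  by rewrite ltNge lam_ler -ltnNge.
rewrite /limn_esup !limf_esupE; apply/eqP; rewrite eq_le; apply/andP; split.
  apply: le_ereal_inf_tmp => _ [V [n0 _ n0V] <-].
  pose W := [set x : R | lam n0.+1 < x].
  apply: (@le_trans _ _ (ereal_sup ((fun x : R => (N x / N_left x)%:E) @` W))).
    apply: ereal_inf_lbound; exists W => //.
    by exists (lam n0.+1); split=> //; exact: num_real.
  apply: ge_ereal_sup => _ [x xW <-].
  have [[|J] xJ] := counting_index x.
    by have := xJ n0.+1; rewrite ltW.
  have nJ : (n0.+1 <= J)%N by rewrite -ltnS -xJ ltW.
  have lJ : lam J <= x by rewrite xJ.
  have [xE|xl] := eqVneq x (lam J).
    rewrite xE ratio; apply: ereal_sup_ubound; exists J.+1 => //.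
    by apply: n0V => /=; rewrite ltnW// ltnW.
  (* Strictly between eigenvalues the function does not jump. *)
  have -> : N x / N_left x = 1.
    rewrite (NE xJ) (@counting_left _ J.+1) ?divff ?gt_eqF// => k.
    rewrite -xJ le_eqVlt; case: eqP => //= kx.
    have := xJ k; rewrite kx lexx => /esym; rewrite ltnS => kJ.
    by move: lJ xl; rewrite -kx eq_le !lam_ler kJ => ->.
  apply: (@le_trans _ _ (M J.+1 / M J)%:E).
    case: J nJ {xJ lJ xl} => // J _; rewrite lee_fin ler_pdivlMr// mul1r.
    by have := M_incr J.+1; lra.
  apply: ereal_sup_ubound; exists J.+1 => //.
  by apply: n0V => /=; rewrite ltnW// ltnW.
apply: le_ereal_inf_tmp => _ [W [B [_ BW]] <-].
have [j0 Bj0] := lam_unb B.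
pose V := [set k | (j0.+1 <= k)%N].
apply: (@le_trans _ _ (ereal_sup ((fun k => (M k / M k.-1)%:E) @` V))).
  by apply: ereal_inf_lbound; exists V => //; exists j0.+1.
apply: ge_ereal_sup => _ [[|k] kV <-] //.
apply: ereal_sup_ubound; exists (lam k); last by rewrite ratio.
by apply: BW; apply: (lt_le_trans Bj0); rewrite lam_ler.
Qed.

End counting.

Section series.
Context {R : realType}.

Lemma nneseries_finite (a : nat -> \bar R) K : (forall k, (K <= k)%N -> a k = 0%E) ->
  (\sum_(0 <= k <oo) a k = \sum_(0 <= k < K) a k)%E.
Proof.
move=> a0; apply/cvg_lim => //; apply: cvg_near_cst; exists K => // n /= Kn.
rewrite (big_cat_nat (leq0n K) Kn)/=.
rewrite [X in (_ + X)%E](_ : _ = 0%E) ?adde0// big_nat big1// => i /andP[Ki _].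
exact: a0.
Qed.

End series.

(** * The spectral weight *)

Section spectral_weight.
Context {R : realType} {H : hilbertType R}.
Variables (E : spectral_measure H) (lam : nat -> R) (F : nat -> seq H).
Hypothesis lam_incr : forall i j : nat, (i < j)%N -> lam i < lam j.
Hypothesis lam_pos : forall j, 0 < lam j.
Hypothesis lam_unb : forall C, exists j, C < lam j.
Hypothesis E_cont0 : forall x, E (`]0, +oo[ `\` range lam) x = 0.
Hypothesis oF : forall j, orthonormal_seq (F j).
Hypothesis F0 : forall j, (0 < size (F j))%N.
Hypothesis FE : forall j e, e \in F j -> E [set lam j] e = e.
Hypothesis FP : forall j x, E [set lam j] x = proj_seq (F j) x.
Hypothesis Fmax : forall j G, orthonormal_seq G ->
  (forall e, e \in G -> E [set lam j] e = e) -> (size G <= size (F j))%N.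
Implicit Types (x y : H).

Let lam_inj : injective lam.
Proof.
move=> i j lij; apply/eqP/negPn/negP; rewrite neq_ltn.
by case/orP => /lam_incr; rewrite lij ltxx.
Qed.

Let mrange : measurable (range lam : set (measurableTypeR R)).
Proof. exact: measurable_range. Qed.

(** The [M_k] as natural numbers, so that they can be compared with the indices of singular values;
    [cumul_multE] gives the link with [cumul_mult]. *)
Definition rank_sum k : nat := (\sum_(0 <= j < k) size (F j))%N.
Local Notation M := rank_sum.

Lemma rank_sumS k : M k.+1 = (M k + size (F k))%N.
Proof. by rewrite /rank_sum big_nat_recr. Qed.

Lemma rank_sum_incr k : (M k < M k.+1)%N.
Proof. by rewrite rank_sumS -addn1 leq_add2l. Qed.

Lemma rank_sum0 : M 0 = 0%N. Proof. by rewrite /rank_sum big_geq. Qed.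

Lemma rank_sum_leq i j : (i <= j)%N -> (M i <= M j)%N.
Proof.
move=> /subnK <-; elim: (j - i)%N => [//|k IHk].
by rewrite addSn (leq_trans IHk)// ltnW// rank_sum_incr.
Qed.

Lemma rank_sum_ge k : (k <= M k)%N.
Proof.
by elim: k => // k IHk; exact: leq_ltn_trans IHk (rank_sum_incr k).
Qed.

Lemma rank_sum_block n : (0 < n)%N -> exists k, (M k < n <= M k.+1)%N.
Proof.
move=> n0; have ex : exists k, (n <= M k)%N by exists n; exact: rank_sum_ge.
case: (ex_minnP ex) => -[|k] nk kmin; first by move: nk; rewrite rank_sum0 leqn0 gtn_eqF.
exists k; rewrite nk andbT ltnNge; apply/negP => /kmin; by rewrite ltnn.
Qed.

(** On the positive half-line [E] lives on the atoms, so its projections are diagonal with weights 0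
    and 1 and their traces fall under [trace_diagonal]. *)
Lemma range_smeas_diagonal (B : set (measurableTypeR R)) : measurable B ->
  B `<=` `]0, +oo[ ->
  diagonal_op E lam (fun k => (`[< B (lam k) >])%:R) (E B).
Proof.
move=> mB B0 x; split=> [j|].
  case: asboolP => Bj.
    rewrite -smeas_setI// (setIidPl _ _).2 ?scale1r//; by move=> _ ->.
  rewrite smeas_disj ?scale0r//.
  by apply/seteqP; split=> t //= [-> ].
rewrite -smeas_setI//.
have {2}-> : B = (range lam `&` B) `|` (B `\` range lam).
  by rewrite setIC setUIDK.
rewrite smeasU//; last 3 first.
- exact: measurableI.
- exact: measurableD.
- by apply/seteqP; split=> t //= [[tl _] [_ ntl]].
rewrite [X in _ = _ + X](smeas_sub0 (B := `]0, +oo[ `\` range lam)) ?addr0//.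
- exact: measurableD.
- by apply: measurableD => //; exact: measurable_itv.
- by move=> t [Bt nt]; split => //; exact: B0.
Qed.

Lemma trace_range_smeas (B : set (measurableTypeR R)) K : measurable B ->
  B `<=` `]0, +oo[ -> (forall k, B (lam k) -> (k < K)%N) ->
  trace (E B) = ((\sum_(0 <= j < K) `[< B (lam j) >] * size (F j))%N)%:R%:E.
Proof.
move=> mB B0 BK.
rewrite (trace_diagonal lam_inj _ (range_smeas_diagonal mB B0) oF FP); last first.
  by move=> j; rewrite ler0n.
rewrite (nneseries_finite (K := K)).
  by rewrite sumEFin natr_sum; congr EFin; apply: eq_bigr => j _; rewrite natrM.
move=> k Kk; case: asboolP => [/BK|_]; first by rewrite ltnNge Kk.
by rewrite mul0r.
Qed.

Lemma trace_eigenspace j : trace (E [set lam j]) = (size (F j))%:R%:E.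
Proof.
rewrite (@trace_range_smeas _ j.+1)//.
- rewrite big_nat_recr//= (_ : `[< _ >]) ?mul1n; last exact/asboolP.
  rewrite big_nat big1 ?add0n// => i /andP[_ ij].
  case: asboolP => // /lam_inj ji; by rewrite ji ltnn in ij.
- by move=> _ ->; rewrite /= in_itv/= lam_pos.
- by move=> k /lam_inj ->.
Qed.

Lemma cumul_multE k : cumul_mult E lam k = (M k)%:R.
Proof.
rewrite /cumul_mult /rank_sum natr_sum big_mkord; apply: eq_bigr => j _.
by rewrite trace_eigenspace.
Qed.

Lemma eig_countingE (x : R) J : (forall k, (lam k <= x) = (k < J)%N) ->
  eig_counting E x = (M J)%:R.
Proof.
move=> xJ; rewrite /eig_counting (@trace_range_smeas _ J)//=.
- congr (_%:R); rewrite /rank_sum !big_nat; apply: eq_bigr => j /andP[_ jJ].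
  rewrite (_ : `[< _ >]) ?mul1n//; apply/asboolP.
  by rewrite /= in_itv/= lam_pos xJ.
- by move=> t /=; rewrite !in_itv/= => /andP[-> _].
- by move=> k; rewrite in_itv/= xJ => /andP[].
Qed.

Let MR k : R := (M k)%:R.

Let MR_gt0 k : 0 < MR k.+1.
Proof. by rewrite ltr0n (leq_ltn_trans _ (rank_sum_incr k)). Qed.

Definition weight j : R := (M j.+1)%:R^-1.
Local Notation d := weight.

Lemma weight_gt0 j : 0 < d j. Proof. by rewrite invr_gt0; exact: MR_gt0. Qed.

Lemma weight_le1 j : d j <= 1.
Proof.
rewrite invf_le1; last exact: MR_gt0.
by rewrite ler1n (leq_ltn_trans _ (rank_sum_incr j)).
Qed.

Lemma weight_decr i j : (i < j)%N -> d j < d i.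
Proof.
move=> ij; rewrite ltf_pV2 ?posrE; [|exact: MR_gt0|exact: MR_gt0].
by rewrite ltr_nat (leq_ltn_trans (rank_sum_leq ij))// rank_sum_incr.
Qed.

Lemma weight_cvg : d @ \oo --> (0 : R).
Proof.
apply: (@squeeze_cvgr _ _ _ _ (cst 0) (@harmonic R)); last 2 first.
- exact: cvg_cst.
- exact: cvg_harmonic.
near=> n; rewrite ltW ?weight_gt0//= lef_pV2 ?posrE ?ltr0n//; last first.
  by have := MR_gt0 n; rewrite ltr0n.
by rewrite ler_nat rank_sum_ge.
Unshelve. all: by end_near. Qed.

Let d_inj : injective d.
Proof.
move=> i j dij; apply/eqP/negPn/negP; rewrite neq_ltn.
by case/orP => /weight_decr; rewrite dij ltxx.
Qed.

Let f : R -> R := patch (fun=> 0) `]0, +oo[ (fun t : R => (eig_counting E t)^-1).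

Let counting_ge0 t : 0 <= eig_counting E t.
Proof.
by have [J tJ] := counting_index lam_incr lam_unb t; rewrite (eig_countingE tJ) ler0n.
Qed.

Let mf : measurable_fun setT f.
Proof.
apply/(measurable_restrictT (fun t : R => (eig_counting E t)^-1) (measurable_itv _)).
(* Writing the inverse as a power gives measurability from that of [powR]; the two agree because the
   counting function is nonnegative. *)
have -> : (fun t : R => (eig_counting E t)^-1) = (fun t => eig_counting E t `^ (-1)).
  by apply/funext => t; rewrite powR_inv1.
have mN : measurable_fun setT (eig_counting E : R -> R).
  apply: nondecreasing_measurable => // x y xy.
  have [J xJ] := counting_index lam_incr lam_unb x.
  have [J' yJ] := counting_index lam_incr lam_unb y.
  rewrite (eig_countingE xJ) (eig_countingE yJ) ler_nat rank_sum_leq//.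
  case: J xJ => // J xJ; rewrite -yJ; apply: le_trans xy; by rewrite xJ.
apply: measurable_funS (measurableT_comp (measurable_powR (-1)) mN) => //.
Qed.

Let fd j : f (lam j) = d j.
Proof.
rewrite /f patchE mem_set//=; last by rewrite in_itv/= lam_pos.
congr (_^-1); apply: eig_countingE => k; by rewrite (lam_ler lam_incr) ltnS.
Qed.

Let f0 x : E [set t | ~ range lam t /\ f t != 0] x = 0.
Proof.
apply: (smeas_sub0 (B := `]0, +oo[ `\` range lam)) => //.
- rewrite (_ : [set _ | _] = ~` range lam `&` [set t | f t != 0])//.
  apply: measurableI; first exact: measurableC.
  exact: measurable_neq0.
- by apply: measurableD => //; exact: measurable_itv.
move=> t [/= nt ft]; split=> //; move: ft; rewrite /f patchE.
by case: ifPn => [/set_mem|_]//; rewrite eqxx.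
Qed.

Local Notation rho := (spectral_weight E).

Let d01 j : 0 <= d j <= 1. Proof. by rewrite ltW ?weight_gt0//= weight_le1. Qed.

(** The series with these weights is an admissible choice for [get], and any admissible choice is
    diagonal with these weights. *)
Lemma spectral_weight_diagonal : diagonal_op E lam d rho.
Proof.
have [|T dT] := @diagonal_exists _ _ E _ lam_inj d 1.
  by move=> j; have /andP[dj dj1] := d01 j; rewrite ger0_norm.
have ex : exists T : H -> H, [set T | spectral_integral E f (total_op T)] T.
  by exists T; exact: (diagonal_spectral_integral lam_inj mf fd f0 d01 dT).
exact: (spectral_integral_diagonal mf fd f0 (getPex ex)).
Qed.

Lemma spectral_weight_power s : 0 <= s ->
  diagonal_op E lam (fun j => d j `^ s) (op_power rho s).
Proof.
apply: (@diagonal_power _ _ E lam d f rho 1) => //.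
  by move=> j; rewrite weight_gt0 weight_le1.
exact: spectral_weight_diagonal.
Qed.

Let ds_gt0 s j : 0 < d j `^ s. Proof. by rewrite powR_gt0// weight_gt0. Qed.

Let ds_decr s i j : 1 < s -> (i < j)%N -> d j `^ s < d i `^ s.
Proof.
move=> s1 ij; rewrite gt0_ltr_powR ?nnegrE ?(ltW (weight_gt0 _))//; first by lra.
exact: weight_decr.
Qed.

Let ds_cvg s : 1 < s -> (fun j => d j `^ s) @ \oo --> (0 : R).
Proof.
move=> s1; apply: (@squeeze_cvgr _ _ _ _ (cst 0) d); last 2 first.
- exact: cvg_cst.
- exact: weight_cvg.
near=> n; rewrite powR_ge0/= ge1r_powR// ?weight_gt0 ?weight_le1//.
exact: ltW.
Unshelve. all: by end_near. Qed.

Lemma spectral_weight_compact : compact_op rho.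
Proof.
apply: (diagonal_compact lam_inj weight_gt0 weight_decr weight_cvg _ FP).
exact: spectral_weight_diagonal.
Qed.

Lemma spectral_weight_power_compact s : 1 < s -> compact_op (op_power rho s).
Proof.
move=> s1; have s0 : 0 <= s by lra.
apply: (diagonal_compact lam_inj _ _ (ds_cvg s1) _ FP) => //.
  by move=> i j; exact: ds_decr.
exact: spectral_weight_power.
Qed.

Lemma singular_value_weight k n : (M k < n <= M k.+1)%N -> singular_value rho n = d k.
Proof.
move=> /andP[kn nk].
apply: (singular_value_diagonal lam_inj weight_gt0 weight_decr _ _ FE Fmax) => //.
exact: spectral_weight_diagonal.
Qed.

Lemma singular_value_weight_power s k n : 1 < s -> (M k < n <= M k.+1)%N ->
  singular_value (op_power rho s) n = d k `^ s.
Proof.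
move=> s1 /andP[kn nk]; have s0 : 0 <= s by lra.
apply: (singular_value_diagonal (d := fun j => d j `^ s) lam_inj _ _ _ _ FE Fmax) => //.
  by move=> i j; exact: ds_decr.
exact: spectral_weight_power.
Qed.

Lemma trace_weight_power s : 1 < s ->
  trace (op_power rho s) = (\sum_(0 <= j <oo) (power_term MR s j)%:E)%E.
Proof.
move=> s1; have s0 : 0 <= s by lra.
rewrite (trace_diagonal lam_inj _ (spectral_weight_power s0) oF FP); last first.
  by move=> j; rewrite ltW.
apply: eq_eseriesr => j _; rewrite /power_term; congr (_ * _)%:E.
by rewrite /MR rank_sumS natrD addrC addKr.
Qed.

End spectral_weight.

(** * Sequences constant on blocks *)

Section asymptotics.
Context {R : realType}.
Variables (M : nat -> nat) (mu : nat -> R).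
Hypotheses (M_incr : forall k, (M k < M k.+1)%N).
Hypothesis mu_ge0 : forall n, 0 <= mu n.
Hypothesis muE : forall k n, (M k < n <= M k.+1)%N -> mu n = (M k.+1)%:R^-1.
Hypothesis block : forall n, (0 < n)%N -> exists k, (M k < n <= M k.+1)%N.

Let MR k : R := (M k)%:R.

Let M_leq i j : (i <= j)%N -> (M i <= M j)%N.
Proof.
move=> /subnK <-; elim: (j - i)%N => [//|k IHk].
by rewrite addSn (leq_trans IHk)// ltnW.
Qed.

Let M_gt0 k : 0 < MR k.+1.
Proof. by rewrite ltr0n (leq_ltn_trans _ (M_incr k)). Qed.

Lemma block_value_le n : (0 < n)%N -> mu n <= n%:R^-1.
Proof.
move=> n0; have [k kn] := block n0; rewrite (muE kn).
have /andP[_ nk] := kn.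
by rewrite lef_pV2 ?posrE ?ltr0n ?ler_nat// (leq_trans n0).
Qed.

(** In its block, [n > M k >= M k.+1 / r]; the condition [M K < n] forces the block index to be at
    least [K]. *)
Lemma block_value_ge (r : R) K : 0 < r -> (forall k, (K <= k)%N -> MR k.+1 <= r * MR k) ->
  forall n, (M K < n)%N -> (r * n%:R)^-1 <= mu n.
Proof.
move=> r0 Mr n Kn; have n0 : (0 < n)%N by exact: leq_ltn_trans Kn.
have [k kn] := block n0; rewrite (muE kn); have /andP[kn' nk] := kn.
have Kk : (K <= k)%N.
  rewrite leqNgt; apply/negP => /M_leq kK.
  by have := leq_trans (leq_ltn_trans kK Kn) nk; rewrite ltnn.
rewrite lef_pV2 ?posrE ?mulr_gt0 ?ltr0n// ?(leq_trans n0)//.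
by apply: (le_trans (Mr k Kk)); rewrite ler_wpM2l ?(ltW r0)// ler_nat ltnW.
Qed.

Local Notation c := (limn_esup (fun k => (MR k / MR k.-1)%:E)).

Lemma ratio_limsup_ge1 : (1%:E <= c)%E.
Proof.
rewrite /limn_esup limf_esupE; apply: le_ereal_inf_tmp => _ [V [n0 _ n0V] <-].
apply: (@le_trans _ _ (MR n0.+2 / MR n0.+1)%:E).
  by rewrite lee_fin ler_pdivlMr// mul1r ler_nat ltnW.
by apply: ereal_sup_ubound; exists n0.+2 => //; apply: n0V => /=; rewrite -addn2 leq_addr.
Qed.

Lemma ratio_limsup_lt (r : R) : (c < r%:E)%E ->
  exists K, forall k, (K <= k)%N -> MR k.+1 <= r * MR k.
Proof.
rewrite /limn_esup limf_esupE => /ereal_inf_lt[_ [V [n0 _ n0V] <-] supr].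
exists n0.+1 => -[//|k] kn.
have : ((MR k.+2 / MR k.+1)%:E < r%:E)%E.
  apply: le_lt_trans supr; apply: ereal_sup_ubound; exists k.+2 => //.
  by apply: n0V => /=; rewrite ltnW// ltnW.
by rewrite lte_fin ltr_pdivrMr// => /ltW.
Qed.

Lemma omega_block_le1 omega : dixmier_state omega ->
  omega_lim_seq omega (log_average mu) <= 1.
Proof.
move=> om; have [B hB] := log_average_bounded mu_ge0 block_value_le.
apply/ler_addgt0Pr => e e0; apply: (omega_lim_seq_le om hB).
exact: (log_average_limsup block_value_le e0).
Qed.

Lemma omega_block_ge omega : dixmier_state omega ->
  (c^-1 <= (omega_lim_seq omega (log_average mu))%:E)%E.
Proof.
move=> om; have [B hB] := log_average_bounded mu_ge0 block_value_le.
set t := omega_lim_seq _ _.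
have t0 : 0 <= t.
  by apply: (omega_lim_seq_ge om hB); exists 0%N => n _; exact: log_average_ge0.
have key (r : R) : 0 < r -> (c < r%:E)%E -> 1 <= t * r.
  move=> r0 /ratio_limsup_lt[K hK].
  rewrite -ler_pdivrMr// mul1r; apply/ler_addgt0Pr => e e0; rewrite -lerBlDr.
  apply: (omega_lim_seq_ge om hB).
  apply: (log_average_liminf mu_ge0 r0 e0 (K := M K)).
  exact: block_value_ge.
(* For [c = +oo] the inverse is 0 and positivity of the limit suffices; [c = -oo] is excluded by
   [1 <= c]. *)
have := ratio_limsup_ge1; case: c key => [c0|_|_]; last by rewrite leNgt ltNyr.
  rewrite lee_fin => key c1; have c00 : 0 < c0 by exact: lt_le_trans c1.
  rewrite inver gt_eqF// lee_fin -[leLHS]mul1r ler_pdivrMr//.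
  apply/ler_addgt0Pr => e e0.
  have t1 : 0 < t + 1 by rewrite ltr_wpDl.
  (* With [r = c0 + e / (t + 1)], the excess [t * e / (t + 1)] is at most [e], also when [t = 0]. *)
  have d0 : 0 < e / (t + 1) by rewrite divr_gt0.
  have := key (c0 + e / (t + 1)); rewrite addr_gt0// lte_fin ltrDl d0 => /(_ isT isT).
  move=> /le_trans; apply; rewrite mulrDr lerD2l.
  by rewrite mulrCA ler_piMr ?(ltW e0)// ler_pdivrMr// mul1r lerDl.
by move=> _; rewrite invey lee_fin.
Qed.

Lemma block_value_equiv : c = 1%:E ->
  (fun n => mu n : R^o) ~_\oo (fun n => 1 / n%:R : R^o).
Proof.
move=> c1; apply/eqaddoP => e e0.
have [|K hK] := @ratio_limsup_lt (1 + e); first by rewrite c1 lte_fin ltrDl.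
have r0 : 0 < 1 + e by rewrite addr_gt0.
exists (M K).+1 => // n /= Kn.
have n0 : (0 < n)%N by exact: leq_ltn_trans Kn.
have := block_value_ge r0 hK Kn; have := block_value_le n0.
have nR : 0 < n%:R^-1 :> R by rewrite invr_gt0 ltr0n.
rewrite /= mul1r invfM => le ge; change (`|mu n - 1 / n%:R| <= e * `|n%:R^-1|); rewrite mul1r.
rewrite [X in _ <= _ * X]gtr0_norm// ler0_norm ?subr_le0// opprB lerBlDr -lerBlDl.
apply: le_trans ge; rewrite -[X in X - _]mul1r -mulrBl ler_wpM2r ?(ltW nR)//.
(* It remains that [(1 - e) (1 + e) <= 1]. *)
rewrite -[leRHS]mul1r ler_pdivlMr//.
by have := sqr_ge0 e; rewrite expr2; lra.
Qed.

End asymptotics.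

(** * Behaviour of the trace as [s] decreases to 1 *)

Section trace_limits.
Context {R : realType}.
Variables (M : nat -> R) (tr : R -> \bar R).
Hypotheses (M0 : M 0%N = 0) (M_incr : forall k, M k + 1 <= M k.+1).
Hypothesis trE : forall s, 1 < s -> tr s = (\sum_(0 <= j <oo) (power_term M s j)%:E)%E.

Let w s := ((s - 1)%:E * tr s)%E.

Let term0 s j : (0 <= (power_term M s j)%:E)%E.
Proof. by rewrite lee_fin power_term_ge0. Qed.

Lemma power_series_le s : 1 < s -> (w s <= s%:E)%E.
Proof.
move=> s1; have s0 : 0 < s - 1 by rewrite subr_gt0.
rewrite /w trE//; apply: (@le_trans _ _ ((s - 1)%:E * (1 + (s - 1)^-1)%:E)%E).
  rewrite lee_pmul2l//; apply: lime_le; first by apply: is_cvg_nneseries => *; exact: term0.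
  by near=> n; rewrite sumEFin lee_fin power_sum_le.
by rewrite -EFinM lee_fin mulrDr mulr1 mulfV ?gt_eqF// subrK.
Unshelve. all: by end_near. Qed.

Lemma power_series_ge s n : 1 < s ->
  (((s - 1) * \sum_(0 <= j < n) power_term M s j)%:E <= w s)%E.
Proof.
move=> s1; have s0 : 0 < s - 1 by rewrite subr_gt0.
rewrite /w trE// EFinM lee_pmul2l//.
by rewrite -sumEFin; apply: nneseries_lim_ge => *; exact: term0.
Qed.

Lemma power_series_limsup : (limf_esup w (1 : R)^'+ <= 1%:E)%E.
Proof.
apply/lee_addgt0Pr => e e0; rewrite limf_esupE.
apply: (@le_trans _ _ (ereal_sup (w @` [set s | 1 < s < 1 + e]))).
  apply: ereal_inf_lbound; exists [set s | 1 < s < 1 + e] => //.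
  near=> s; apply/andP; split; near: s; first exact: nbhs_right_gt.
  by apply: nbhs_right_lt; rewrite ltrDl.
apply: ge_ereal_sup => _ [s /andP[s1 se] <-].
by apply: (le_trans (power_series_le s1)); rewrite -EFinD lee_fin ltW.
Unshelve. all: by end_near. Qed.

Lemma power_series_cvg :
  (forall r, 1 < r -> exists J, forall j, (J <= j)%N -> M j.+1 <= r * M j) ->
  w s @[s --> (1 : R)^'+] --> 1%:E.
Proof.
move=> Mr.
have fin s : 1 < s -> w s \is a fin_num.
  move=> s1; apply/fin_numP; split.
    rewrite -ltNye; apply: lt_le_trans (power_series_ge 0 s1).
    by rewrite ltNyr.
  by rewrite -ltey; apply: (le_lt_trans (power_series_le s1)); rewrite ltry.
apply/fine_cvgP; split.
  by near=> s; apply: fin; near: s; exact: nbhs_right_gt.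
apply/cvgrPdist_le => e e0.
have [de de0 hde] := power_sum_liminf M0 M_incr e0 Mr.
near=> s.
have s1 : 1 < s by near: s; exact: nbhs_right_gt.
have sde : s < 1 + de by near: s; apply: nbhs_right_lt; rewrite ltrDl.
have se : s < 1 + e by near: s; apply: nbhs_right_lt; rewrite ltrDl.
have [n hn] := hde s s1 sde.
have := power_series_le s1; have := power_series_ge n s1.
rewrite /= -(fineK (fin s s1)) !lee_fin => h1 h2.
rewrite ler_distl; apply/andP; split; first by rewrite lerBlDr (le_trans h2)// ltW// addrC.
by have := le_trans hn h1; rewrite lerBlDr.
Unshelve. all: by end_near. Qed.

End trace_limits.

Lemma singular_value_ge0 (R : realType) (H : hilbertType R) (T : H -> H) n :
  0 <= singular_value T n.
Proof.
rewrite /singular_value; set A := [set s | _].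
have [->|A0] := eqVneq A set0; first by rewrite inf0.
by apply: lb_le_inf; [exact/set0P|move=> s []].
Qed.

Unset Implicit Arguments.

Theorem proposition2p5 (R : realType) (H : hilbertType R)
    (L : operator H) (E : spectral_measure H)
    (Linv : H -> H) (lam : nat -> R)
    (L_sa : selfadjoint L) (L_ge0 : nonnegative_op L) (L_unb : unbounded L)
    (L_E : spectral_measure_of L E)
    (LinvP : inverse_off_kernel L Linv) (Linv_cpt : compact_op Linv)
    (lam_incr : forall i j : nat, (i < j)%N -> lam i < lam j)
    (lam_eig : range lam = [set a | a != 0 /\ eigenvalue_op L a]) :
  let rho := spectral_weight E in
  let N := eig_counting E in
  let N_left := eig_counting_left E in
  let M := cumul_mult E lam in
  let c := limf_esup (fun x : R => (N x / N_left x)%:E) +oo in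
  [/\ dual_macaev rho,
      c = limn_esup (fun k => (M k / M k.-1)%:E) &
      forall omega, dixmier_state omega ->
        (c^-1 <= (dixmier_trace omega rho)%:E <= 1%:E)%E] /\
  ((forall s : R, 1 < s -> trace_class (op_power rho s)) /\
   (limf_esup (fun s : R => (s - 1)%:E * trace (op_power rho s)) (1^'+)
      <= 1%:E)%E) /\
  (c = 1%:E -> (M k / M k.-1) @[k --> \oo] --> (1 : R) ->
   [/\ (fun n => singular_value rho n : R^o) ~_\oo
         (fun n => 1 / n%:R : R^o),
       (forall omega, dixmier_state omega -> dixmier_trace omega rho = 1) /\
       dixmier_measurable rho &
       ((s - 1)%:E * trace (op_power rho s))%E @[s --> (1 : R)^'+]
         --> 1%:E]).
Proof.
have F_ex := eigenspace_basis L_sa L_ge0 L_E LinvP Linv_cpt lam_eig.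
pose F j := projT1 (cid (F_ex j)).
have FS j := projT2 (cid (F_ex j)).
have oF j : orthonormal_seq (F j) by case: (FS j).
have F0 j : (0 < size (F j))%N by case: (FS j).
have FE j e : e \in F j -> E [set lam j] e = e by case: (FS j) => _ _ + _ _; apply.
have FP j x : E [set lam j] x = proj_seq (F j) x by case: (FS j).
have Fmax j G : orthonormal_seq G -> (forall e, e \in G -> E [set lam j] e = e) ->
    (size G <= size (F j))%N by case: (FS j) => _ _ _ _; apply.
have lam0 := lam_gt0 L_ge0 lam_eig.
have lamU := lam_unbounded L_sa L_ge0 L_E LinvP Linv_cpt lam_eig lam_incr.
have cont0 := continuous_part L_sa L_ge0 L_E LinvP Linv_cpt lam_eig.
(* From here on, the bases are known only through the properties listed above. *)
clearbody F.
pose m := rank_sum F; pose mR k : R := (m k)%:R.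
have m0 : m 0%N = 0%N by exact: rank_sum0.
have m_incr k : (m k < m k.+1)%N by exact: rank_sum_incr.
have mR0 : mR 0%N = 0 by rewrite /mR m0.
have mR_incr k : mR k + 1 <= mR k.+1 by rewrite /mR natr1 ler_nat.
move=> rho N N_left M.
have -> : M = mR.
  by apply/funext => k; rewrite /M (cumul_multE lam_incr lam0 cont0 oF FP).
have NE x J : (forall k, (lam k <= x) = (k < J)%N) -> N x = mR J.
  exact: (eig_countingE lam_incr lam0 cont0 oF FP).
move=> c.
have cE : c = limn_esup (fun k => (mR k / mR k.-1)%:E).
  exact: (counting_limsup lam_incr lamU mR_incr mR0 NE).
pose mu := singular_value rho.
have mu0 n : 0 <= mu n by exact: singular_value_ge0.
have muE k n : (m k < n <= m k.+1)%N -> mu n = (m k.+1)%:R^-1.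
  exact: (singular_value_weight lam_incr lam0 lamU cont0 oF F0 FE FP Fmax).
have block n : (0 < n)%N -> exists k, (m k < n <= m k.+1)%N.
  exact: rank_sum_block.
have mu_le := block_value_le muE block.
have macaev : dual_macaev rho.
  split; first exact: (spectral_weight_compact lam_incr lam0 lamU cont0 oF F0 FP).
  have [B hB] := log_average_bounded mu0 mu_le.
  apply: (@le_lt_trans _ _ B%:E); last exact: ltry.
  apply: ge_ereal_sup => _ [n _ <-]; rewrite lee_fin.
  exact: le_trans (ler_norm _) (hB n).
have bounds omega : dixmier_state omega ->
    (c^-1 <= (dixmier_trace omega rho)%:E <= 1%:E)%E.
  move=> om; apply/andP; split.
    by rewrite cE; exact: (omega_block_ge m_incr mu0 muE block om).
  by rewrite lee_fin; exact: (omega_block_le1 mu0 muE block om).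
have trE s : 1 < s -> trace (op_power rho s) =
    (\sum_(0 <= j <oo) (power_term mR s j)%:E)%E.
  exact: (trace_weight_power lam_incr lam0 lamU cont0 oF F0 FP).
split; first by split.
split.
  split; last exact: (power_series_limsup mR0 mR_incr trE).
  move=> s s1; split.
    exact: (spectral_weight_power_compact lam_incr lam0 lamU cont0 oF F0 FP).
  have s0 : 0 <= s by lra.
  apply: (@le_lt_trans _ _ (1 + (s - 1)^-1)%:E); last exact: ltry.
  apply: lime_le.
    by apply: is_cvg_nneseries => n _ _; rewrite lee_fin singular_value_ge0.
  near=> n; rewrite sumEFin lee_fin.
  (* Summability of the singular values: the [n]-th one is at most [n^-s], and the sum of these is
     the power sum of the sequence [M k = k]. *)
  have id_incr k : k%:R + 1 <= k.+1%:R :> R by rewrite natr1.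
  have n1 : (0 < n)%N by near: n; exists 1%N.
  apply: le_trans (power_sum_le (M := fun k => k%:R) _ id_incr n.-1 s1) => //.
  rewrite -{1}(prednK n1) big_add1/= big_nat [leRHS]big_nat; apply: ler_sum => i _.
  have -> : power_term (fun k => k%:R) s i = i.+1%:R^-1 `^ s :> R.
    by rewrite /power_term -natrB// subSnn mulr1.
  have [k ki] := block i.+1 isT.
  rewrite (singular_value_weight_power lam_incr lam0 lamU cont0 oF F0 FE FP Fmax s1 ki).
  rewrite ge0_ler_powR ?nnegrE ?invr_ge0//.
  rewrite lef_pV2 ?posrE ?ltr0n// ?ler_nat; last exact: leq_ltn_trans (m_incr k).
  by case/andP: ki.
move=> c1 _; have c1' : limn_esup (fun k => (mR k / mR k.-1)%:E) = 1%:E by rewrite -cE.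
have tr1 omega : dixmier_state omega -> dixmier_trace omega rho = 1.
  move=> /bounds; rewrite c1 inve1 !lee_fin => h.
  by apply/eqP; rewrite eq_le andbC.
split.
- exact: (block_value_equiv m_incr muE block c1').
- by split=> //; split=> // o1 o2 /tr1 -> /tr1 ->.
apply: (power_series_cvg mR0 mR_incr trE) => r r1.
by apply: (ratio_limsup_lt m_incr); rewrite c1' lte_fin.
Unshelve. all: by end_near. Qed.
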